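(* Let $\Lambda = (\Lambda, \mathfrak{m}, D)$ be a local Noetherian ring with the property that $\mathrm{Ext}^i_\Lambda(D,\Lambda)$ and $\mathrm{Ext}^i_{\Lambda^{op}}(D,\Lambda)$ have finite length for each $i \geq 0$. Then $$\operatorname{depth}\Lambda^{op} = \operatorname{depth}\Lambda = \operatorname{findim}\Lambda^{op} = \operatorname{findim}\Lambda = \operatorname{dell}\Lambda^{op} = \operatorname{dell}\Lambda.$$ Moreover, when $\Lambda$ has finite depth $d$, the unit map $\eta_{d+1}$ gives rise to a stable equivalence $$\Omega^d D \xrightarrow{\ \simeq\ } \Omega^{d+1}\Sigma^{d+1}\Omega^d D,$$ and $d = \operatorname{depth}\Lambda$ is the lowest index for which this holds, i.e. the smallest $n \geq 0$ such that $\eta_{n+1} : \Omega^n D \to \Omega^{n+1}\Sigma^{n+1}\Omega^n D$ is a stable equivalence.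
   Context: Noetherian means two-sided Noetherian. A Noetherian ring $\Lambda = (\Lambda,\mathfrak{m},D)$ (not necessarily commutative) is local if $\Lambda/\mathfrak{m} = D$ is a division ring, where $\mathfrak{m} = \operatorname{rad}\Lambda$ is the Jacobson radical; such $\Lambda$ is semiperfect, and $D$ is its unique simple right (and left) module. $\mathsf{mod}\, \Lambda$ is the category of finitely presented right modules; left modules are identified with modules over $\Lambda^{op}$. $\mathrm{Ext}^i_\Lambda(D,\Lambda)$ is a left $\Lambda$-module and $\mathrm{Ext}^i_{\Lambda^{op}}(D,\Lambda)$ a right $\Lambda$-module. For $\Gamma \in \{\Lambda,\Lambda^{op}\}$: $\operatorname{depth}\Gamma = \inf\{i \ge 0 \mid \mathrm{Ext}^i_\Gamma(D,\Gamma)\neq 0\}$ (in general the supremum of this quantity over simple modules); $\operatorname{findim}\Gamma$ is the supremum of $\operatorname{projdim} M$ over $M\in\mathsf{mod}\,\Gamma$ of finite projective dimension. The stable category $\underline{\mathsf{mod}}\, \Gamma$ has the objects of $\mathsf{mod}\,\Gamma$, with morphisms taken modulo those factoring through projective objects; stable equivalences (resp. stable retracts) are isomorphisms (resp. retracts) in $\underline{\mathsf{mod}}\,\Gamma$. The syzygy functor $\Omega$ on $\underline{\mathsf{mod}}\,\Gamma$ is $\Omega M = \ker(P \twoheadrightarrow M)$ for any epimorphism from a projective $P$ in $\mathsf{mod}\,\Gamma$. $\operatorname{dell}\Gamma = \operatorname{dell} D := \inf\{ n \geq 0 \mid \Omega^n D \text{ is a stable retract of } \Omega^{n+1} N \text{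 for some } N \in \underline{\mathsf{mod}}\, \Gamma\}$ ($\infty$ if none). The Auslander–Bridger transpose $\mathrm{Tr}$ sends $M$ with presentation $P_1 \to P_0 \to M \to 0$ by finitely generated projectives to $\mathrm{coker}(P_0^* \to P_1^* )$, $(-)^* = \mathrm{Hom}(-,\Lambda)$; it is a contravariant duality $\underline{\mathsf{mod}}\,\Lambda \to \underline{\mathsf{mod}}\,\Lambda^{op}$. Put $\Sigma := \mathrm{Tr}\,\Omega\,\mathrm{Tr}$; by a result of Auslander–Reiten $\Sigma$ is left adjoint to $\Omega$, so $\Sigma^n$ is left adjoint to $\Omega^n$, and $\eta_n : X \to \Omega^n\Sigma^n X$ denotes the unit. *)

(* Defs.v *)
From HB Require Import structures.
From mathcomp Require Import all_boot all_algebra.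
From mathcomp Require Import generic_quotient ring_quotient boolp.

Set Implicit Arguments.
Unset Strict Implicit.
Unset Printing Implicit Defensive.

Import GRing.Theory.
Local Open Scope quotient_scope.
Local Open Scope ring_scope.

(* A left module over [A] is an [lmodType A], a right module over [A] is an
   [lmodType A^c].  The theory is developed for left modules over an arbitrary
   ring [A] and applied to a ring and to its converse. *)

(* [None] stands for infinity. *)

Definition enat := option nat.

(* The infimum of the empty set is infinity. *)
Definition einf (S : nat -> Prop) : enat :=
  if pselect (exists n, `[< S n >]) is left ex then Some (ex_minn ex) else None.

(* Least upper bound; infinity if [S] is unbounded. *)
Definition esup (S : nat -> Prop) : enat :=
  einf (fun b => forall n, S n -> (n <= b)%N).

Definition surj (U V : Type) (f : U -> V) := forall y, exists x, f x = y.

Section LinearMaps.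
Variable A : nzRingType.
Implicit Types U V W : lmodType A.

Definition mklin U V (f : U -> V) (fL : linear f) : {linear U -> V} :=
  HB.pack f (GRing.isLinear.Build A U V *:%R f fL).

Definition lcomp U V W (g : {linear V -> W}) (f : {linear U -> V}) :
  {linear U -> W} := g \o f.

Definition lid U : {linear U -> U} := idfun.

Lemma linear_eqP U V (f g : {linear U -> V}) : f =1 g -> f = g.
Proof.
move=> /funext; case: f g => [f fc] [g gc] /= fg; subst g.
by congr GRing.Linear.Pack; case: fc gc => [[a] [b]] [[c] [d]];
  congr (GRing.Linear.Class _ _); f_equal; apply: Prop_irrelevance.
Qed.

End LinearMaps.

Record submod (A : nzRingType) (V : lmodType A) := Submod {
  sm_set :> V -> Prop;
  sm0 : sm_set 0;
  smD : forall x y, sm_set x -> sm_set y -> sm_set (x + y);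
  smZ : forall a x, sm_set x -> sm_set (a *: x) }.

Section Submodules.
Variables (A : nzRingType).
Implicit Types (U V : lmodType A).

Lemma smN V (S : submod V) x : S x -> S (- x).
Proof. by move=> Sx; rewrite -scaleN1r; apply: smZ. Qed.

Lemma smB V (S : submod V) x y : S x -> S y -> S (x - y).
Proof. by move=> Sx Sy; apply: smD => //; apply: smN. Qed.

Definition sm_pred V (S : submod V) : {pred V} := fun x => `[< S x >].

Lemma sm_predP V (S : submod V) x : reflect (S x) (x \in sm_pred S).
Proof. exact: asboolP. Qed.

Lemma sm_pred_closed V (S : submod V) : submod_closed (sm_pred S).
Proof.
split; first exact/sm_predP/sm0.
by move=> a x y /sm_predP Sx /sm_predP Sy; apply/sm_predP/smD/Sy/smZ.
Qed.

HB.instance Definition _ V (S : submod V) :=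
  GRing.isSubmodClosed.Build A V (sm_pred S) (sm_pred_closed S).

Record subm V (S : submod V) := Subm { sm_val : V; _ : sm_val \in sm_pred S }.

HB.instance Definition _ V (S : submod V) := [isSub for @sm_val V S].
HB.instance Definition _ V (S : submod V) := [Choice of subm S by <:].
HB.instance Definition _ V (S : submod V) :=
  [SubChoice_isSubLmodule of subm S by <:].

Definition sm_incl V (S : submod V) : {linear subm S -> V} := val.

Lemma sm_inclP V (S : submod V) (x : subm S) : S (sm_incl S x).
Proof. exact/sm_predP/(valP x). Qed.

Definition sm_mk V (S : submod V) (x : V) (Sx : S x) : subm S :=
  Subm (introT (sm_predP S x) Sx).

Lemma sm_incl_inj V (S : submod V) : injective (sm_incl S).
Proof. exact: val_inj. Qed.

Lemma sm_corestr_linear U V (S : submod V) (f : {linear U -> V})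
  (h : forall x, S (f x)) : linear (fun x => sm_mk (h x)).
Proof. by move=> a x y; apply: sm_incl_inj; rewrite [RHS]linearP; apply: linearP. Qed.

Definition sm_corestr U V (S : submod V) (f : {linear U -> V})
  (h : forall x, S (f x)) : {linear U -> subm S} :=
  mklin (sm_corestr_linear h).

Definition quo V (S : submod V) : Type := Quotient.quot (sm_pred S).

HB.instance Definition _ V (S : submod V) := GRing.Zmodule.on (quo S).

Definition quo_pi V (S : submod V) (x : V) : quo S := \pi_(Quotient.quot (sm_pred S)) x.

Lemma quo_piD V (S : submod V) : {morph @quo_pi V S : x y / x + y}.
Proof. by move=> x y; rewrite /quo_pi raddfD. Qed.

Lemma quo_pi_eq V (S : submod V) x y : quo_pi S x = quo_pi S y <-> S (x - y).
Proof.
split=> [|Sxy].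
  by move=> /eqP; rewrite -Quotient.idealrBE => /sm_predP.
by apply/eqP; rewrite -Quotient.idealrBE; apply/sm_predP.
Qed.

Lemma quo_pi_surj V (S : submod V) : surj (quo_pi S).
Proof. by move=> y; exists (repr y); rewrite /quo_pi reprK. Qed.

Definition quo_scale V (S : submod V) (a : A) (x : quo S) : quo S :=
  quo_pi S (a *: repr x).

Lemma quo_scale_pi V (S : submod V) a x :
  quo_scale a (quo_pi S x) = quo_pi S (a *: x).
Proof.
apply/quo_pi_eq; rewrite -scalerBr; apply: smZ.
by apply/quo_pi_eq; rewrite /quo_pi reprK.
Qed.

Lemma quo_scaleA V (S : submod V) a b (x : quo S) :
  quo_scale a (quo_scale b x) = quo_scale (a * b) x.
Proof. by have [u <-] := @quo_pi_surj V S x; rewrite !quo_scale_pi scalerA. Qed.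

Lemma quo_scale1 V (S : submod V) : left_id 1 (@quo_scale V S).
Proof. by move=> x; have [u <-] := @quo_pi_surj V S x; rewrite quo_scale_pi scale1r. Qed.

Lemma quo_scaleDr V (S : submod V) : right_distributive (@quo_scale V S) +%R.
Proof.
move=> a x y; have [[u <-] [v <-]] := (@quo_pi_surj V S x, @quo_pi_surj V S y).
by rewrite -quo_piD !quo_scale_pi -quo_piD scalerDr.
Qed.

Lemma quo_scaleDl V (S : submod V) (x : quo S) :
  {morph (@quo_scale V S)^~ x : a b / a + b}.
Proof.
move=> a b; have [u <-] := @quo_pi_surj V S x.
by rewrite /= !quo_scale_pi -quo_piD scalerDl.
Qed.

HB.instance Definition _ V (S : submod V) :=
  GRing.Zmodule_isLmodule.Build A (quo S)
    (@quo_scaleA V S) (@quo_scale1 V S) (@quo_scaleDr V S) (@quo_scaleDl V S).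

Lemma quo_pi_linear V (S : submod V) : linear (quo_pi S).
Proof. by move=> a x y; rewrite quo_piD -quo_scale_pi. Qed.

Definition quo_proj V (S : submod V) : {linear V -> quo S} :=
  mklin (@quo_pi_linear V S).

Lemma quo_proj_eq0 V (S : submod V) x : quo_proj S x = 0 <-> S x.
Proof. by rewrite -(linear0 (quo_proj S)) /= quo_pi_eq subr0. Qed.

Lemma quo_proj_surj V (S : submod V) : surj (quo_proj S).
Proof. exact: quo_pi_surj. Qed.

Section QuoMap.
Variables (U V : lmodType A) (S : submod U) (T : submod V).
Variables (f : {linear U -> V}) (fST : forall x, S x -> T (f x)).

Definition quo_map_fun (x : quo S) : quo T := quo_proj T (f (repr x)).

Lemma quo_map_pi x : quo_map_fun (quo_proj S x) = quo_proj T (f x).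
Proof.
apply/quo_pi_eq; rewrite -linearB; apply: fST.
by apply/quo_pi_eq; rewrite /quo_pi /= reprK.
Qed.

Lemma quo_map_linear : linear quo_map_fun.
Proof.
move=> a x y; have [[u <-] [v <-]] := (quo_proj_surj x, quo_proj_surj y).
by rewrite -linearP !quo_map_pi !linearP.
Qed.

Definition quo_map : {linear quo S -> quo T} := mklin quo_map_linear.

End QuoMap.

Section QuoLift.
Variables (U V : lmodType A) (S : submod U).
Variables (f : {linear U -> V}) (fS : forall x, S x -> f x = 0).

Definition quo_lift_fun (x : quo S) : V := f (repr x).

Lemma quo_lift_pi x : quo_lift_fun (quo_proj S x) = f x.
Proof.
apply/eqP; rewrite -subr_eq0 -linearB; apply/eqP/fS.
by apply/quo_pi_eq; rewrite /quo_pi /= reprK.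
Qed.

Lemma quo_lift_linear : linear quo_lift_fun.
Proof.
move=> a x y; have [[u <-] [v <-]] := (quo_proj_surj x, quo_proj_surj y).
by rewrite -linearP !quo_lift_pi !linearP.
Qed.

Definition quo_lift : {linear quo S -> V} := mklin quo_lift_linear.

End QuoLift.

Definition sm_zero V : submod V.
Proof.
exists (fun x => x = 0) => // [x y -> ->|a x ->]; first exact: addr0.
exact: scaler0.
Defined.

Definition sm_ker U V (f : {linear U -> V}) : submod U.
Proof.
exists (fun x => f x = 0) => [|x y|a x]; rewrite ?linear0 ?linearD ?linearZ //=.
  by move=> -> ->; rewrite addr0.
by move=> ->; rewrite scaler0.
Defined.

Definition sm_im U V (f : {linear U -> V}) : submod V.
Proof.
exists (fun y => exists x, f x = y).
- by exists 0; rewrite linear0.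
- by move=> _ _ [x <-] [y <-]; exists (x + y); rewrite linearD.
- by move=> a _ [x <-]; exists (a *: x); rewrite linearZ.
Defined.

Definition sm_preim U V (f : {linear U -> V}) (S : submod V) : submod U.
Proof.
exists (fun x => S (f x)).
- by rewrite linear0; apply: sm0.
- by move=> x y; rewrite linearD; apply: smD.
- by move=> a x; rewrite linearZ; apply: smZ.
Defined.

End Submodules.

(* Existence of a composition series *)

Definition finite_length (A : nzRingType) (V : lmodType A) :=
  exists (n : nat) (S : nat -> submod V),
    [/\ forall x, S 0%N x -> x = 0,
        forall x, S n x
      & forall i, (i < n)%N ->
        [/\ forall x, S i x -> S i.+1 x,
            exists2 x, S i.+1 x & ~ S i x
          & forall T : submod V,
              (forall x, S i x -> T x) -> (forall x, T x -> S i.+1 x) ->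
              (forall x, T x -> S i x) \/ (forall x, S i.+1 x -> T x)]].

(* Left Noetherian: every left ideal is finitely generated.  Two-sided
   Noetherian is [noetherian R] together with [noetherian R^c]. *)
Definition noetherian (A : nzRingType) :=
  forall I : submod A^o, exists (n : nat) (g : 'I_n -> A),
    forall x : A, I x <-> exists c : 'I_n -> A, x = \sum_i c i * g i.

Section Radical.
Variable R : nzRingType.
Implicit Types (I J : submod R^o).

Definition maximal_left_ideal I :=
  ~ I 1 /\ forall J, (forall x, I x -> J x) -> ~ J 1 -> forall x, J x -> I x.

(* The Jacobson radical, as the intersection of the maximal left ideals.  It is
   two-sided ([jrad_mulr]), so R / jrad R is both a left and a right module. *)
Definition jrad (x : R) := forall I, maximal_left_ideal I -> I x.

Definition jrad_left : submod R^o.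
Proof.
exists jrad => [I _|x y jx jy I mI|a x jx I mI]; first exact: sm0.
  by apply: smD; [apply: jx | apply: jy].
by apply: smZ; apply: jx.
Defined.

Lemma jrad_mulr x a : jrad x -> jrad (x * a).
Proof.
move=> jx I mI; have [Ia|nIa] := pselect (I a); first exact: (smZ (s := I) x Ia).
have CP : linear (fun r : R^o => r * a : R^o).
  by move=> b u v; rewrite mulrDl /GRing.scale /= mulrA.
pose C : submod R^o := sm_preim (mklin CP) I.
apply: (jx C); split=> [|J CJ J1 j Jj]; first by rewrite /= mul1r.
have [//|nIja] := pselect (I (j * a)); case: J1.
have JsP : exists K : submod R^o,
    forall y, K y <-> exists i r, I i /\ y = i + r * (j * a).
  unshelve eexists (Submod (sm_set := fun y : R^o =>
    exists i r : R, I i /\ y = i + r * (j * a)) _ _ _) => //.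
  - by exists 0, 0; rewrite mul0r addr0; split=> //; apply: sm0.
  - move=> _ _ [i [r [Ii ->]]] [i' [r' [Ii' ->]]]; exists (i + i'), (r + r').
    by rewrite mulrDl addrACA; split=> //; apply: smD.
  - move=> b _ [i [r [Ii ->]]]; exists (b * i), (b * r); split.
      exact: (smZ (s := I) b Ii).
    by rewrite /GRing.scale /= mulrDr mulrA.
have [K KP] := JsP.
have [K1|nK1] := pselect (K 1); last first.
  case: nIja; apply: mI.2 nK1 _ _; last first.
    by apply/KP; exists 0, 1; rewrite add0r mul1r; split=> //; apply: sm0.
  by move=> y Iy; apply/KP; exists y, 0; rewrite mul0r addr0.
have [i [r [Ii e1]]] : exists i r, I i /\ a = i + r * (j * a).
  have /KP[i [r [Ii E]]] := smZ (s := K) a K1.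
  by exists i, r; rewrite -E /GRing.scale /= mulr1.
have Cj : C (1 - r * j).
  by rewrite /= mulrBl mul1r -mulrA {1}e1 addrK.
have := smD (CJ _ Cj) (smZ (s := J) r Jj).
by rewrite /GRing.scale /= subrK.
Qed.

Definition jrad_right : submod (R^c)^o.
Proof.
exists jrad => [I _|x y jx jy I mI|a x jx]; first exact: sm0.
  by apply: smD; [apply: jx | apply: jy].
exact: jrad_mulr.
Defined.

(* R / jrad R is a division ring. *)
Definition is_local :=
  ~ jrad 1 /\
  forall x, ~ jrad x -> exists y, jrad (x * y - 1) /\ jrad (y * x - 1).

End Radical.

(* [op_map : B -> A] identifies [B] with the opposite ring of [A]. *)
Record opposite (A B : nzRingType) := Opposite {
  op_map :> B -> A;
  opD : {morph op_map : x y / x + y};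
  op1 : op_map 1 = 1;
  opM : forall x y, op_map (x * y) = op_map y * op_map x;
  op_bij : bijective op_map }.

Section Converse.
Variable R : nzRingType.

Let id_bij : bijective (id : R -> R). Proof. by exists id. Qed.

Definition opposite_c : opposite R R^c :=
  @Opposite R R^c (id : R -> R) (fun _ _ => erefl) erefl (fun _ _ => erefl) id_bij.

Definition c_opposite : opposite R^c R :=
  @Opposite R^c R (id : R -> R) (fun _ _ => erefl) erefl (fun _ _ => erefl) id_bij.

End Converse.

(* Hom_A(M, A) with its [B]-module structure (b f)(x) = f(x) b *)
Definition dual (A B : nzRingType) (t : opposite A B) (M : lmodType A) : Type :=
  {linear M -> A^o}.

Section Dual.
Variables (A B : nzRingType) (t : opposite A B).
Implicit Types M N : lmodType A.

HB.instance Definition _ M := gen_eqMixin (dual t M).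
HB.instance Definition _ M := gen_choiceMixin (dual t M).

Definition dual_fun M (f : dual t M) : {linear M -> A^o} := f.

Lemma dualP M (f g : dual t M) : dual_fun f =1 dual_fun g -> f = g.
Proof. exact: linear_eqP. Qed.

Definition dual_zero M : dual t M := \0 : {linear M -> A^o}.
Definition dual_opp M (f : dual t M) : dual t M :=
  \- dual_fun f : {linear M -> A^o}.
Definition dual_add M (f g : dual t M) : dual t M :=
  dual_fun f \+ dual_fun g : {linear M -> A^o}.

Lemma dual_addA M : associative (@dual_add M).
Proof. by move=> f g h; apply: dualP => x; apply: addrA. Qed.
Lemma dual_addC M : commutative (@dual_add M).
Proof. by move=> f g; apply: dualP => x; apply: addrC. Qed.
Lemma dual_add0 M : left_id (dual_zero M) (@dual_add M).
Proof. by move=> f; apply: dualP => x; apply: add0r. Qed.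
Lemma dual_addN M : left_inverse (dual_zero M) (@dual_opp M) (@dual_add M).
Proof. by move=> f; apply: dualP => x; apply: addNr. Qed.

HB.instance Definition _ M := GRing.isZmodule.Build (dual t M)
  (@dual_addA M) (@dual_addC M) (@dual_add0 M) (@dual_addN M).

Lemma dual_scale_linear M (b : B) (f : dual t M) :
  linear (fun x => dual_fun f x * t b : A^o).
Proof.
by move=> a x y; rewrite linearP mulrDl /GRing.scale /= mulrA.
Qed.

Definition dual_scale M (b : B) (f : dual t M) : dual t M :=
  mklin (dual_scale_linear b f).

Lemma dual_scaleA M a b (f : dual t M) :
  dual_scale a (dual_scale b f) = dual_scale (a * b) f.
Proof. by apply: dualP => x /=; rewrite opM mulrA. Qed.
Lemma dual_scale1 M : left_id 1 (@dual_scale M).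
Proof. by move=> f; apply: dualP => x /=; rewrite op1 mulr1. Qed.
Lemma dual_scaleDr M : right_distributive (@dual_scale M) +%R.
Proof. by move=> a f g; apply: dualP => x /=; apply: mulrDl. Qed.
Lemma dual_scaleDl M (f : dual t M) :
  {morph (@dual_scale M)^~ f : a b / a + b}.
Proof. by move=> a b; apply: dualP => x /=; rewrite opD mulrDr. Qed.

HB.instance Definition _ M := GRing.Zmodule_isLmodule.Build B (dual t M)
  (@dual_scaleA M) (@dual_scale1 M) (@dual_scaleDr M) (@dual_scaleDl M).

Definition dual_map_fun M N (h : {linear M -> N}) (f : dual t N) : dual t M :=
  lcomp (dual_fun f) h.

Lemma dual_map_linear M N (h : {linear M -> N}) : linear (dual_map_fun h).
Proof. by move=> a f g; apply: dualP. Qed.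

Definition dual_map M N (h : {linear M -> N}) : {linear dual t N -> dual t M} :=
  mklin (dual_map_linear h).

End Dual.

Section Projective.
Variable A : nzRingType.

Definition projective (P : lmodType A) :=
  forall (U V : lmodType A) (g : {linear U -> V}) (f : {linear P -> V}),
    surj g -> exists h : {linear P -> U}, forall x, g (h x) = f x.

(* There is a projective resolution of M with P_i = 0 for i > n. *)
Definition has_resolution (M : lmodType A) (n : nat) :=
  exists (P : nat -> lmodType A) (d : forall i, {linear P i.+1 -> P i})
         (e : {linear P 0%N -> M}),
    [/\ forall i, projective (P i),
        surj e,
        forall x, e x = 0 <-> exists y, d 0%N y = x,
        forall i x, d i x = 0 <-> exists y, d i.+1 y = x
      & forall i, (n < i)%N -> forall x : P i, x = 0].

Definition projdim (M : lmodType A) : enat := einf (has_resolution M).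

End Projective.

Section FinitelyPresented.
Variable A : nzRingType.

Record presentation (M : lmodType A) := Presentation {
  p_m : nat;
  p_n : nat;
  p_rel : {linear 'rV[A]_p_m -> 'rV[A]_p_n};
  p_aug : {linear 'rV[A]_p_n -> M};
  p_surj : surj p_aug;
  p_exact : forall x, p_aug x = 0 <-> exists y, p_rel y = x }.

Definition finitely_presented (M : lmodType A) := inhabited (presentation M).

Record fpmod := FpMod {
  fp_mod :> lmodType A;
  fp_fin : finitely_presented fp_mod }.

(* A chosen presentation P_1 -> P_0 -> M -> 0 of each object; syzygies and
   transposes are formed with it.  Other presentations by finitely generated
   projectives give stably isomorphic results. *)
Definition pres (M : fpmod) : presentation M :=
  inhabited_witness (fp_fin M).

Definition cover0 (M : fpmod) : lmodType A := 'rV[A]_(p_n (pres M)).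
Definition cover1 (M : fpmod) : lmodType A := 'rV[A]_(p_m (pres M)).
Definition aug (M : fpmod) : {linear cover0 M -> M} := p_aug (pres M).
Definition rel1 (M : fpmod) : {linear cover1 M -> cover0 M} := p_rel (pres M).

Lemma aug_surj M : surj (aug M). Proof. exact: p_surj. Qed.
Lemma aug_exact M x : aug M x = 0 <-> exists y, rel1 M y = x.
Proof. exact: p_exact. Qed.

Lemma free_lin_linear (V : lmodType A) n (v : 'I_n -> V) :
  linear (fun x : 'rV[A]_n => \sum_i x 0 i *: v i).
Proof.
move=> a x y; rewrite scaler_sumr -big_split; apply: eq_bigr => i _ /=.
by rewrite !mxE scalerDl scalerA.
Qed.

Definition free_lin (V : lmodType A) n (v : 'I_n -> V) : {linear 'rV[A]_n -> V} :=
  mklin (free_lin_linear v).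

Lemma free_lin_delta (V : lmodType A) n (v : 'I_n -> V) i :
  free_lin v (delta_mx 0 i) = v i.
Proof.
rewrite /= (bigD1 i) //= big1 ?addr0 => [|j ji]; rewrite mxE !eqxx /=.
  by rewrite scale1r.
by rewrite (negPf ji) scale0r.
Qed.

Lemma free_lin_ext (V : lmodType A) n (f g : {linear 'rV[A]_n -> V}) :
  (forall i, f (delta_mx 0 i) = g (delta_mx 0 i)) -> f =1 g.
Proof.
move=> fg x; rewrite (row_sum_delta x) !linear_sum; apply: eq_bigr => i _.
by rewrite !linearZ fg.
Qed.

Lemma free_lift (U V : lmodType A) n (g : {linear U -> V})
    (f : {linear 'rV[A]_n -> V}) :
  (forall x, exists u, g u = f x) ->
  exists h : {linear 'rV[A]_n -> U}, forall x, g (h x) = f x.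
Proof.
move=> gf; have /choice[v vP] := fun i : 'I_n => gf (delta_mx 0 i).
exists (free_lin v); apply: (free_lin_ext (f := lcomp g (free_lin v))) => i.
by rewrite /lcomp [LHS]/= -[X in g X]/(free_lin v _) free_lin_delta.
Qed.

Lemma free_projective n : projective 'rV[A]_n.
Proof. by move=> U V g f gs; apply: free_lift => x; apply: gs. Qed.

Lemma free_fp n : finitely_presented 'rV[A]_n.
Proof.
split; apply: (@Presentation _ 0 n \0 (lid _)) => [x|x]; first by exists x.
by split=> [/= ->|[y <-]//]; exists 0.
Qed.

Definition free_mod n : fpmod := FpMod (free_fp n).

End FinitelyPresented.

Section Noetherian.
Variables (A : nzRingType) (nA : noetherian A).

Lemma row_hd0 n (w : 'rV[A]_(1 + n)) : w 0 0 = 0 -> w = row_mx 0 (rsubmx w).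
Proof.
move=> w0; apply/rowP => j; rewrite [RHS]mxE; case: split_ordP => k ->.
  by rewrite mxE -w0 ord1; congr (w _ _); apply: val_inj.
by rewrite mxE.
Qed.

Lemma sub_free_fg n (S : submod 'rV[A]_n) :
  exists k (g : {linear 'rV[A]_k -> 'rV[A]_n}),
    forall x, S x <-> exists y, g y = x.
Proof.
elim: n S => [|n IHn] S.
  exists 0%N, \0 => x; rewrite (thinmx0 x); split=> _; first by exists 0.
  exact: sm0.
pose ir : 'rV[A]_n -> 'rV[A]_(1 + n) := row_mx 0.
have irL : linear ir.
  by move=> a x y; rewrite /ir scale_row_mx add_row_mx scaler0 addr0.
pose hd : 'rV[A]_(1 + n) -> A^o := fun x => x 0 0.
have hdL : linear hd by move=> a x y; rewrite /hd !mxE.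
have [k [g gP]] := IHn (sm_preim (mklin irL) S : submod 'rV[A]_n).
pose J : submod A^o := sm_im (lcomp (mklin hdL) (sm_incl (S : submod 'rV[A]_(1 + n)))).
have [m [c cP]] := nA J.
have /choice[v vP] : forall i, exists v : 'rV[A]_(1 + n), S v /\ hd v = c i.
  move=> i; have [] := (cP (c i)).2 _.
    exists (fun j => (j == i)%:R); rewrite (bigD1 i) //= big1 => [|j /negPf->].
      by rewrite eqxx mul1r addr0.
    by rewrite mul0r.
  by move=> u uP; exists (sm_incl _ u); split=> //; apply: sm_inclP.
pose F (y : 'rV[A]_(m + k)) := free_lin v (lsubmx y) + ir (g (rsubmx y)).
have FL : linear F.
  move=> a x y; rewrite /F !linearP -[ir]/(mklin irL : _ -> _) linearP.
  by rewrite scalerDr addrACA.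
have sv y : S (free_lin v y).
  rewrite /=; elim/big_ind: _ => [||i _]; [exact: sm0|exact: smD|].
  by apply: smZ; case: (vP i).
have hdv y : hd (free_lin v y) = \sum_i y 0 i * c i.
  rewrite -[hd _]/(mklin hdL _) linear_sum; apply: eq_bigr => i _.
  by rewrite linearZ; case: (vP i) => _ <-.
exists (m + k)%N, (mklin FL) => x; split=> [Sx|[y <-]]; last first.
  by apply: smD; [apply: sv|apply/(gP (g (rsubmx y))); exists (rsubmx y)].
have [c' c'P] := (cP (hd x)).1 (ex_intro _ (sm_mk Sx) erefl).
pose u := \row_i c' i.
have hd0 : hd (x - free_lin v u) = 0.
  rewrite -[hd _]/(mklin hdL _) linearB [X in X - _]c'P [X in _ - X]hdv.
  by apply/eqP; rewrite subr_eq0; apply/eqP/eq_bigr => i _; rewrite mxE.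
have xE : x - free_lin v u = ir (rsubmx (x - free_lin v u : 'rV_(1 + n))).
  exact: row_hd0.
have [z zP] : exists z, g z = rsubmx (x - free_lin v u : 'rV_(1 + n)).
  by apply/gP; rewrite /= -xE; apply: smB.
exists (row_mx u z); rewrite /= /F row_mxKl row_mxKr zP -xE.
by rewrite addrC subrK.
Qed.

Lemma fg_fp n (M : lmodType A) (f : {linear 'rV[A]_n -> M}) :
  surj f -> finitely_presented M.
Proof.
move=> fs; have [k [g gP]] := sub_free_fg (sm_ker f).
by split; apply: (Presentation (p_rel := g) fs).
Qed.

Lemma subm_free_fp n (S : submod 'rV[A]_n) : finitely_presented (subm S).
Proof.
have [k [g gP]] := sub_free_fg S.
have gS y : S (g y) by apply/gP; exists y.
apply: (@fg_fp k _ (sm_corestr gS)) => x.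
have [y yP] := (gP _).1 (sm_inclP x).
by exists y; apply: sm_incl_inj.
Qed.

Lemma cyclic_fp (I : submod A^o) : finitely_presented (quo I).
Proof.
pose hd : 'rV[A]_1 -> A^o := fun x => x 0 0.
have hdL : linear hd by move=> a x y; rewrite /hd !mxE.
apply: (@fg_fp 1 _ (lcomp (quo_proj I) (mklin hdL))) => x.
have [y <-] := @quo_proj_surj _ _ I x.
by exists (const_mx y); rewrite /lcomp /= /hd mxE.
Qed.

End Noetherian.

Definition residue_left (R : nzRingType) (nR : noetherian R) : fpmod R :=
  FpMod (cyclic_fp nR (jrad_left R)).

Definition residue_right (R : nzRingType) (nR : noetherian R^c) : fpmod R^c :=
  FpMod (cyclic_fp nR (jrad_right R)).

Section Stable.
Variable A : nzRingType.
Implicit Types X Y Z : fpmod A.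

(* [stable_eq] is equality of morphisms in the stable category: the difference
   factors through a projective object of mod A. *)
Definition stable_eq X Y (f g : {linear X -> Y}) :=
  exists (P : fpmod A) (a : {linear X -> P}) (b : {linear P -> Y}),
    projective P /\ forall x, f x - g x = b (a x).

Definition stable_iso X Y (f : {linear X -> Y}) :=
  exists g : {linear Y -> X},
    stable_eq (lcomp g f) (lid X) /\ stable_eq (lcomp f g) (lid Y).

Definition stable_retract X Y :=
  exists (s : {linear X -> Y}) (r : {linear Y -> X}),
    stable_eq (lcomp r s) (lid X).

End Stable.

Section StableTheory.
Variable A : nzRingType.
Implicit Types X Y Z : fpmod A.

Lemma stable_refl X Y (f : {linear X -> Y}) : stable_eq f f.
Proof.
exists (free_mod A 0), \0, \0; split; first exact: free_projective.
by move=> x; rewrite subrr.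
Qed.

Lemma stable_sym X Y (f g : {linear X -> Y}) : stable_eq f g -> stable_eq g f.
Proof.
move=> [P [a [b [pP fg]]]]; exists P, a, (\- b); split=> // x.
by rewrite /= -fg opprB.
Qed.

Lemma stable_eq_free X Y (f g : {linear X -> Y}) : stable_eq f g ->
  exists n (a : {linear X -> 'rV[A]_n}) (b : {linear 'rV[A]_n -> Y}),
    forall x, f x - g x = b (a x).
Proof.
move=> [P [a [b [pP fg]]]]; have [s sP] := pP _ _ (aug P) (lid P) (@aug_surj _ P).
exists (p_n (pres P)), (lcomp s a), (lcomp b (aug P)) => x /=.
by rewrite sP fg.
Qed.

Lemma stable_trans X Y (g f h : {linear X -> Y}) :
  stable_eq f g -> stable_eq g h -> stable_eq f h.
Proof.
move=> /stable_eq_free[n [a [b fg]]] /stable_eq_free[m [c [d gh]]].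
have acL : linear (fun x => row_mx (a x) (c x)).
  by move=> k x y; rewrite !linearP scale_row_mx add_row_mx.
have bdL : linear (fun x : 'rV[A]_(n + m) => b (lsubmx x) + d (rsubmx x)).
  by move=> k x y; rewrite !linearP scalerDr addrACA.
exists (free_mod A (n + m)), (mklin acL), (mklin bdL); split.
  exact: free_projective.
by move=> x; rewrite /= row_mxKl row_mxKr -fg -gh addrA subrK.
Qed.

End StableTheory.

Record sfunctor (A B : nzRingType) := SFunctor {
  fob :> fpmod A -> fpmod B;
  fmor : forall X Y : fpmod A, {linear X -> Y} -> {linear fob X -> fob Y};
  fmor_eq : forall (X Y : fpmod A) (f g : {linear X -> Y}),
    stable_eq f g -> stable_eq (fmor f) (fmor g);
  fmor_id : forall X : fpmod A, stable_eq (fmor (lid X)) (lid (fob X));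
  fmor_comp : forall (X Y Z : fpmod A) (g : {linear Y -> Z}) (f : {linear X -> Y}),
    stable_eq (fmor (lcomp g f)) (lcomp (fmor g) (fmor f)) }.

Record cofunctor (A B : nzRingType) := CoFunctor {
  cob :> fpmod A -> fpmod B;
  cmor : forall X Y : fpmod A, {linear X -> Y} -> {linear cob Y -> cob X};
  cmor_eq : forall (X Y : fpmod A) (f g : {linear X -> Y}),
    stable_eq f g -> stable_eq (cmor f) (cmor g);
  cmor_id : forall X : fpmod A, stable_eq (cmor (lid X)) (lid (cob X));
  cmor_comp : forall (X Y Z : fpmod A) (g : {linear Y -> Z}) (f : {linear X -> Y}),
    stable_eq (cmor (lcomp g f)) (lcomp (cmor f) (cmor g)) }.

(* Adjunctions between stable categories, as natural bijections
   Hom(F X, Y) = Hom(X, G Y), and their units. *)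
Record adjunction (A B : nzRingType) (F : sfunctor A B) (G : sfunctor B A) :=
  Adjunction {
  adj : forall (X : fpmod A) (Y : fpmod B),
    {linear F X -> Y} -> {linear X -> G Y};
  adj_eq : forall (X : fpmod A) (Y : fpmod B) (f g : {linear F X -> Y}),
    stable_eq f g <-> stable_eq (adj f) (adj g);
  adj_surj : forall (X : fpmod A) (Y : fpmod B) (h : {linear X -> G Y}),
    exists f : {linear F X -> Y}, stable_eq (adj f) h;
  adj_nat : forall (X' X : fpmod A) (Y Y' : fpmod B)
      (h : {linear X' -> X}) (f : {linear F X -> Y}) (g : {linear Y -> Y'}),
    stable_eq (adj (lcomp g (lcomp f (fmor F h))))
              (lcomp (fmor G g) (lcomp (adj f) h)) }.

Definition adj_unit (A B : nzRingType) (F : sfunctor A B) (G : sfunctor B A)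
    (a : adjunction F G) (X : fpmod A) : {linear X -> G (F X)} :=
  adj a (lid (F X)).

Definition fid (A : nzRingType) : sfunctor A A.
Proof.
apply: (@SFunctor A A id (fun _ _ f => f)) => // [X|X Y Z g f]; exact: stable_refl.
Defined.

Definition fcomp (A B C : nzRingType) (F : sfunctor B C) (G : sfunctor A B) :
  sfunctor A C.
Proof.
apply: (@SFunctor A C (fun X => F (G X)) (fun X Y f => fmor F (fmor G f))).
- by move=> X Y f g fg; apply/fmor_eq/fmor_eq.
- by move=> X; apply: stable_trans (fmor_id _ _); apply/fmor_eq/fmor_id.
- by move=> X Y Z g f; apply: stable_trans (fmor_comp _ _ _); apply/fmor_eq/fmor_comp.
Defined.

Fixpoint fpow (A : nzRingType) (F : sfunctor A A) (n : nat) : sfunctor A A :=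
  if n is m.+1 then fcomp F (fpow F m) else fid A.

Section Syzygy.
Variables (A : nzRingType) (nA : noetherian A).
Implicit Types X Y Z : fpmod A.

Definition syz X : fpmod A := FpMod (subm_free_fp nA (sm_ker (aug X))).

Definition syz_incl X : {linear syz X -> cover0 X} := sm_incl (sm_ker (aug X)).

Lemma syz_inclP X x : aug X (syz_incl X x) = 0.
Proof. exact: (sm_inclP (S := sm_ker (aug X)) x). Qed.

(* [a] is induced on kernels by a lift of [f] to the chosen projectives *)
Definition syz_lift X Y (f : {linear X -> Y}) (a : {linear syz X -> syz Y}) :=
  exists F : {linear cover0 X -> cover0 Y},
    (forall x, aug Y (F x) = f (aug X x)) /\
    (forall x, syz_incl Y (a x) = F (syz_incl X x)).

Lemma syz_lift_ex X Y (f : {linear X -> Y}) : exists a, syz_lift f a.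
Proof.
have [F FP] : exists F : {linear cover0 X -> cover0 Y},
    forall x, aug Y (F x) = lcomp f (aug X) x.
  by apply: free_lift => x; apply: aug_surj.
have h x : sm_ker (aug Y) (lcomp F (syz_incl X) x).
  by rewrite /= FP /= syz_inclP linear0.
by exists (sm_corestr h), F; split.
Qed.

Lemma syz_lift_eq X Y (f g : {linear X -> Y}) a b :
  stable_eq f g -> syz_lift f a -> syz_lift g b -> stable_eq a b.
Proof.
move=> [P [u [v [pP fg]]]] [F [F1 F2]] [G [G1 G2]].
have [w wP] := pP _ _ (aug Y) v (@aug_surj _ Y).
pose K : {linear cover0 X -> cover0 Y} := (F \- G) \- lcomp w (lcomp u (aug X)).
have h x : sm_ker (aug Y) (K x).
  by rewrite /= !linearB wP -fg F1 G1 subrr.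
exists (free_mod A _), (syz_incl X), (sm_corestr h); split.
  exact: free_projective.
move=> x; apply: (@sm_incl_inj _ _ (sm_ker (aug Y))); rewrite linearB.
rewrite [sm_incl _ (a x)]F2 [sm_incl _ (b x)]G2 -[RHS]/(K (syz_incl X x)) /K /=.
by rewrite -[aug X _]/(aug X (syz_incl X x)) syz_inclP !linear0 addr0.
Qed.

Definition syz_map X Y (f : {linear X -> Y}) : {linear syz X -> syz Y} :=
  projT1 (cid (syz_lift_ex f)).

Lemma syz_mapP X Y (f : {linear X -> Y}) : syz_lift f (syz_map f).
Proof. exact: (projT2 (cid (syz_lift_ex f))). Qed.

Definition Omega : sfunctor A A.
Proof.
apply: (@SFunctor A A syz syz_map) => [X Y f g fg|X|X Y Z g f].
- exact: syz_lift_eq fg (syz_mapP f) (syz_mapP g).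
- apply: syz_lift_eq (stable_refl _) (syz_mapP _) _.
  by exists (lid _); split.
- apply: syz_lift_eq (stable_refl _) (syz_mapP _) _.
  have [F [F1 F2]] := syz_mapP f; have [G [G1 G2]] := syz_mapP g.
  exists (lcomp G F); split=> x; first by rewrite /lcomp /= G1 F1.
  by rewrite -[lcomp _ _ x]/(syz_map g (syz_map f x)) G2 F2.
Defined.

End Syzygy.

Section Transpose.
Variables (A B : nzRingType) (t : opposite A B).
Implicit Types X Y Z : fpmod A.

Definition coord_fun n (i : 'I_n) (x : 'rV[A]_n) : A^o := x 0 i.

Lemma coord_linear n (i : 'I_n) : linear (coord_fun i).
Proof. by move=> a x y; rewrite /coord_fun !mxE. Qed.

Definition coord n (i : 'I_n) : dual t 'rV[A]_n := mklin (coord_linear i).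

Definition dual_free n : {linear 'rV[B]_n -> dual t 'rV[A]_n} :=
  free_lin (@coord n).

Lemma dual_free_delta n c j : dual_fun (dual_free n c) (delta_mx 0 j) = t (c 0 j).
Proof.
have dual_fun_sum I (s : seq I) (F : I -> dual t 'rV[A]_n) x :
    dual_fun (\sum_(i <- s) F i) x = \sum_(i <- s) dual_fun (F i) x.
  elim: s => [|i s IHs]; first by rewrite !big_nil.
  by rewrite !big_cons -IHs.
rewrite /= dual_fun_sum (bigD1 j) //= big1 ?addr0 => [|i ij].
  by rewrite /coord_fun mxE !eqxx mul1r.
by rewrite /coord_fun mxE eqxx (negPf ij) mul0r.
Qed.

Lemma dual_free_surj n : surj (dual_free n).
Proof.
move=> f; have [t' _ tK] := op_bij t.
exists (\row_i t' (dual_fun f (delta_mx 0 i))); apply: dualP.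
by apply: free_lin_ext => i; rewrite dual_free_delta mxE tK.
Qed.

Lemma dual_free_inj n : injective (dual_free n).
Proof.
move=> c d /(congr1 (@dual_fun _ _ _ _)) cd; apply/rowP => j.
by apply: (bij_inj (op_bij t)); rewrite -!dual_free_delta cd.
Qed.

Lemma dual_free_inv n : exists h : {linear dual t 'rV[A]_n -> 'rV[B]_n},
  cancel (dual_free n) h /\ cancel h (dual_free n).
Proof.
have /choice[h hK] := @dual_free_surj n.
have hL : linear h.
  by move=> a x y; apply: (@dual_free_inj n); rewrite linearP !hK.
by exists (mklin hL); split=> // x; apply: (@dual_free_inj n); apply: hK.
Qed.

Definition tr_sub X := sm_im (dual_map t (rel1 X)).

(* coker (P_0^* -> P_1^* ) *)
Definition tr_mod X : lmodType B := quo (tr_sub X).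

Lemma tr_fp X : finitely_presented (tr_mod X).
Proof.
have [h [_ hK]] := dual_free_inv (p_m (pres X)).
split; apply: (@Presentation _ _ _ _
  (lcomp h (lcomp (dual_map t (rel1 X)) (dual_free (p_n (pres X)))))
  (lcomp (quo_proj (tr_sub X)) (dual_free (p_m (pres X))))) => [y|x].
  have [u <-] := quo_proj_surj y; have [v <-] := dual_free_surj u.
  by exists v.
rewrite quo_proj_eq0; split=> [[y yx]|[y <-]].
  have [z zy] := dual_free_surj y; exists z.
  by apply: (@dual_free_inj (p_m (pres X))); rewrite hK -yx -zy.
by exists (dual_free _ y); rewrite hK.
Qed.

Definition tr X : fpmod B := FpMod (tr_fp X).

Definition tr_proj X : {linear dual t (cover1 X) -> tr X} := quo_proj (tr_sub X).

(* [a] is induced on cokernels by the dual of a lift of [f] to presentations *)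
Definition tr_lift X Y (f : {linear X -> Y}) (a : {linear tr Y -> tr X}) :=
  exists (F0 : {linear cover0 X -> cover0 Y})
         (F1 : {linear cover1 X -> cover1 Y}),
    [/\ forall x, aug Y (F0 x) = f (aug X x),
        forall x, rel1 Y (F1 x) = F0 (rel1 X x)
      & forall p, a (tr_proj Y p) = tr_proj X (dual_map t F1 p)].

Lemma aug_rel1 X x : aug X (rel1 X x) = 0.
Proof. by apply/aug_exact; exists x. Qed.

Lemma tr_lift_ex X Y (f : {linear X -> Y}) : exists a, tr_lift f a.
Proof.
have [F0 F0P] : exists F : {linear cover0 X -> cover0 Y},
    forall x, aug Y (F x) = lcomp f (aug X) x.
  by apply: free_lift => x; apply: aug_surj.
have [F1 F1P] : exists F : {linear cover1 X -> cover1 Y},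
    forall x, rel1 Y (F x) = lcomp F0 (rel1 X) x.
  by apply: free_lift => x; apply/aug_exact; rewrite /= F0P /= aug_rel1 linear0.
have h p : tr_sub Y p -> tr_sub X (dual_map t F1 p).
  move=> [q <-]; exists (dual_map t F0 q); apply: dualP => x /=.
  by rewrite F1P.
by exists (quo_map h), F0, F1; split=> // p; apply: quo_map_pi.
Qed.

Lemma tr_lift_eq X Y (f g : {linear X -> Y}) a b :
  stable_eq f g -> tr_lift f a -> tr_lift g b -> stable_eq a b.
Proof.
move=> [P [u [v [pP fg]]]] [F0 [F1 [F0P F1P aP]]] [G0 [G1 [G0P G1P bP]]].
have [w wP] := pP _ _ (aug Y) v (@aug_surj _ Y).
pose H : {linear cover0 X -> cover0 Y} := (F0 \- G0) \- lcomp w (lcomp u (aug X)).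
have [h hP] : exists h : {linear cover0 X -> cover1 Y},
    forall x, rel1 Y (h x) = H x.
  apply: free_lift => x; apply/aug_exact.
  by rewrite /= !linearB wP -fg F0P G0P subrr.
pose k : {linear cover1 X -> cover1 Y} := (F1 \- G1) \- lcomp h (rel1 X).
have kP x : rel1 Y (k x) = 0.
  rewrite /= !linearB hP F1P G1P /= aug_rel1 !linear0 addr0.
  by rewrite subrr.
have [l [_ lK]] := dual_free_inv (p_m (pres X)).
have zS p : tr_sub Y p -> lcomp l (dual_map t k) p = 0.
  move=> [q <-]; rewrite -[RHS](linear0 l); congr (l _); apply: dualP => x.
  by rewrite /= -[RHS](linear0 (dual_fun q)); congr (dual_fun q _); apply: kP.
exists (free_mod B _), (quo_lift zS), (lcomp (tr_proj X) (dual_free _)); split.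
  exact: free_projective.
move=> y; have [p <-] := quo_proj_surj y.
rewrite [a _]aP [b _]bP -linearB [quo_lift zS _](quo_lift_pi zS).
rewrite -[RHS]/(tr_proj X (dual_free _ (l (dual_map t k p)))) lK.
apply/quo_pi_eq; exists (lcomp (dual_fun p) h); apply: dualP => x /=.
by rewrite !(linearB (dual_fun p)) subKr.
Qed.

Definition tr_map X Y (f : {linear X -> Y}) : {linear tr Y -> tr X} :=
  projT1 (cid (tr_lift_ex f)).

Lemma tr_mapP X Y (f : {linear X -> Y}) : tr_lift f (tr_map f).
Proof. exact: (projT2 (cid (tr_lift_ex f))). Qed.

Definition Tr : cofunctor A B.
Proof.
apply: (@CoFunctor A B tr tr_map) => [X Y f g fg|X|X Y Z g f].
- exact: tr_lift_eq fg (tr_mapP f) (tr_mapP g).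
- apply: tr_lift_eq (stable_refl _) (tr_mapP _) _.
  exists (lid _), (lid _); split=> // p.
  by congr (tr_proj X _); apply: dualP.
- apply: tr_lift_eq (stable_refl _) (tr_mapP _) _.
  have [F0 [F1 [F0P F1P aP]]] := tr_mapP f.
  have [G0 [G1 [G0P G1P bP]]] := tr_mapP g.
  exists (lcomp G0 F0), (lcomp G1 F1); split=> [x|x|p] /=.
  + by rewrite G0P F0P.
  + by rewrite G1P F1P.
  + by rewrite bP aP; congr (tr_proj X _); apply: dualP.
Defined.

End Transpose.

(* Sigma = Tr Omega Tr; [t] and [t'] identify [A] and [B] with the opposite of
   each other. *)
Definition Sigma (A B : nzRingType) (t : opposite A B) (t' : opposite B A)
  (nB : noetherian B) : sfunctor A A.
Proof.
pose D := Tr t; pose D' := Tr t'; pose O := Omega nB.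
apply: (@SFunctor A A (fun X => D' (O (D X)))
          (fun X Y f => cmor D' (fmor O (cmor D f)))).
- by move=> X Y f g fg; apply/cmor_eq/fmor_eq/cmor_eq.
- move=> X; apply: stable_trans (cmor_id _ _); apply: cmor_eq.
  by apply: stable_trans (fmor_id _ _); apply/fmor_eq/cmor_id.
- move=> X Y Z g f; apply: stable_trans (cmor_comp _ _ _); apply: cmor_eq.
  by apply: stable_trans (fmor_comp _ _ _); apply/fmor_eq/cmor_comp.
Defined.

Section Ext.
Variables (A B : nzRingType) (t : opposite A B) (nA : noetherian A).

(* The projective resolution of [M] obtained by splicing the sequences
   0 -> Omega^(i+1) M -> P_i -> Omega^i M -> 0 *)
Definition res (M : fpmod A) (i : nat) : lmodType A :=
  cover0 (fpow (Omega nA) i M).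

Definition res_d (M : fpmod A) (i : nat) : {linear res M i.+1 -> res M i} :=
  lcomp (syz_incl nA (fpow (Omega nA) i M)) (aug (fpow (Omega nA) i.+1 M)).

Definition res_aug (M : fpmod A) : {linear res M 0 -> M} := aug M.

Definition cocycles (M : fpmod A) (i : nat) : submod (dual t (res M i)) :=
  sm_ker (dual_map t (res_d M i)).

Definition coboundaries (M : fpmod A) (i : nat) : submod (dual t (res M i)) :=
  match i with
  | 0 => sm_zero _
  | j.+1 => sm_im (dual_map t (res_d M j))
  end.

(* Ext^i_A(M, A), as a [B]-module *)
Definition Ext (i : nat) (M : fpmod A) : lmodType B :=
  quo (sm_preim (sm_incl (cocycles M i)) (coboundaries M i)).

(* inf {i | Ext^i(M, A) != 0}; the depth of a local ring is that of its residue
   module. *)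
Definition depth (M : fpmod A) : enat :=
  einf (fun i => exists x : Ext i M, x != 0).

End Ext.

Lemma res_exact (A : nzRingType) (nA : noetherian A) (M : fpmod A) :
  [/\ forall i, projective (res nA M i),
      surj (res_aug nA M),
      forall x, res_aug nA M x = 0 <-> exists y, res_d nA M 0 y = x
    & forall i x, res_d nA M i x = 0 <-> exists y, res_d nA M i.+1 y = x].
Proof.
have H (X : fpmod A) (x : cover0 X) : aug X x = 0 <->
    exists y, lcomp (syz_incl nA X) (aug (syz nA X)) y = x.
  split=> [x0|[y <-]]; last exact: syz_inclP.
  have [y yP] := @aug_surj _ (syz nA X) (sm_mk (S := sm_ker (aug X)) x0).
  by exists y; rewrite /lcomp /= yP.
split=> [i||x|i x]; [exact: free_projective|exact: aug_surj|exact: H|].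
rewrite -[_ <-> _]/(_ <-> exists y, lcomp (syz_incl nA (syz nA _)) (aug _) y = x).
rewrite -H; split=> [x0|x0]; last first.
  exact: (etrans (congr1 (syz_incl nA _) x0) (linear0 _)).
by apply: (@sm_incl_inj _ _ (sm_ker (aug (fpow (Omega nA) i M)))); rewrite linear0.
Qed.

Definition findim (A : nzRingType) : enat :=
  esup (fun n => exists M : fpmod A, projdim M = Some n).

(* The delooping level of a module; that of a local ring is that of its residue
   module. *)
Definition dell (A : nzRingType) (nA : noetherian A) (M : fpmod A) : enat :=
  einf (fun n => exists N : fpmod A,
    stable_retract (fpow (Omega nA) n M) (fpow (Omega nA) n.+1 N)).

(* Main.v *)
From mathcomp Require Import all_boot all_algebra.
From mathcomp Require Import boolp classical_sets.
Require Import Defs.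

(* Let P be the free resolution of D over one side A, and X_i the cokernel of
   P_(i-1)^* -> P_i^*, a module over the other side B; for i at most depth D the
   X_i have the finite free resolutions P_0^* -> ... -> P_i^*.

   Equality of the depths: if D has depth d over A, a socle element of the finite
   length module Ext^d(D, A), contained in X_d, is a nonzero map from the residue
   module of B to X_d; as X_d has projective dimension d, dimension shifting gives
   Ext^i(D_B, B) <> 0 for some i <= d.  The argument is symmetric.

   Stable equivalence: X_(d-1) embeds in V = (Omega^d D)^* with cokernel
   E = Ext^d(D, A).  As E has finite length, Ext^i(E, B) = 0 for i < d, so the
   Ext^i(V, B) vanish for 0 < i < d - 1 and for i = d - 1 they embed in the simple
   module Ext^(d-1)(X_(d-1), B); if they filled it, the inclusion of X_(d-1) in V
   would split, and E would embed in a free module.  Dualizing a free resolution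
   of V therefore gives a (d+1)-fold cosyzygy S of Omega^d D with Ext^i(S, A) = 0
   for 0 < i <= d + 1.  Then Omega^(d+1) is full at S, which by the universal
   property of the unit makes eta_(d+1) invertible at Omega^d D.

   Finitistic dimension: X_d has projective dimension d over B, while if
   Omega^k D is a stable retract of Omega^(k+1) N and M has projective dimension
   n > k, then Tor_n(D, M) is a summand of Tor_(n+1)(N, M) = 0, contradicting
   Nakayama's lemma for Ext^n(M, B).

   Adjunction: dualizing a presentation of Omega Tr X gives a map from X to a
   free module through which, up to stable equivalence, all maps from X to free
   modules factor; it induces the unit X -> Omega Sigma X. *)

Set Implicit Arguments.
Unset Strict Implicit.
Unset Printing Implicit Defensive.

Import GRing.Theory.
Local Open Scope ring_scope.

(** * Duality of free modules *)


(** Both directions of the identification are kept, so that [opp_sym] carries every result to the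
    other side. *)
Record opp_pair (A B : nzRingType) := OppPair {
  op_l : opposite A B;
  op_r : opposite B A;
  op_rK : cancel op_r op_l;
  op_lK : cancel op_l op_r }.

Definition opp_sym (A B : nzRingType) (o : opp_pair A B) : opp_pair B A :=
  OppPair (op_lK o) (op_rK o).

Lemma op0 (A B : nzRingType) (t : opposite A B) : t 0 = 0.
Proof. by apply: (addrI (t 0)); rewrite -opD !addr0. Qed.

Lemma op_sum (A B : nzRingType) (t : opposite A B) I (s : seq I) (F : I -> B) :
  t (\sum_(i <- s) F i) = \sum_(i <- s) t (F i).
Proof. exact: (big_morph t (opD t) (op0 t)). Qed.

Section FreeDuality.
Variables (A B : nzRingType) (o : opp_pair A B).

(** Evaluation of functionals in coordinates: [y] stands for an element of the dual of the free
    module, so row vectors over [B] replace [dual]. *)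
Definition pairing n (x : 'rV[A]_n) (y : 'rV[B]_n) : A :=
  \sum_i x 0 i * op_l o (y 0 i).

Lemma pairing_linear n (y : 'rV[B]_n) : linear (fun x => pairing x y : A^o).
Proof.
move=> a x x'; rewrite /pairing scaler_sumr -big_split; apply: eq_bigr => i _ /=.
by rewrite !mxE mulrDl /GRing.scale /= mulrA.
Qed.

Definition pairing_lin n (y : 'rV[B]_n) : {linear 'rV[A]_n -> A^o} :=
  mklin (@pairing_linear n y).

Lemma pairing_delta n (y : 'rV[B]_n) i : pairing (delta_mx 0 i) y = op_l o (y 0 i).
Proof.
rewrite /pairing (bigD1 i) //= big1 ?addr0 => [|j ji]; rewrite mxE !eqxx /=.
  by rewrite mul1r.
by rewrite (negPf ji) mul0r.
Qed.

Lemma pairingDr n (x : 'rV[A]_n) (y y' : 'rV[B]_n) :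
  pairing x (y + y') = pairing x y + pairing x y'.
Proof.
by rewrite /pairing -big_split; apply: eq_bigr => i _; rewrite mxE opD mulrDr.
Qed.

Lemma pairingZr n (x : 'rV[A]_n) b (y : 'rV[B]_n) :
  pairing x (b *: y) = pairing x y * op_l o b.
Proof. by rewrite /pairing mulr_suml; apply: eq_bigr => i _; rewrite mxE opM mulrA. Qed.

Lemma pairing0l n (y : 'rV[B]_n) : pairing 0 y = 0.
Proof. exact: (linear0 (pairing_lin y)). Qed.

Lemma pairing0r n (x : 'rV[A]_n) : pairing x 0 = 0.
Proof. by rewrite -(scale0r 0) pairingZr op0 mulr0. Qed.

Lemma pairingDl n (x x' : 'rV[A]_n) (y : 'rV[B]_n) :
  pairing (x + x') y = pairing x y + pairing x' y.
Proof. exact: (linearD (pairing_lin y)). Qed.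

Lemma pairingBl n (x x' : 'rV[A]_n) (y : 'rV[B]_n) :
  pairing (x - x') y = pairing x y - pairing x' y.
Proof. exact: (linearB (pairing_lin y)). Qed.

Lemma pairingZl n a (x : 'rV[A]_n) (y : 'rV[B]_n) :
  pairing (a *: x) y = a * pairing x y.
Proof. exact: (linearZ_LR (pairing_lin y)). Qed.

Lemma pairing_nondeg_r n (y y' : 'rV[B]_n) :
  (forall x, pairing x y = pairing x y') -> y = y'.
Proof.
move=> H; apply/rowP => i; have := H (delta_mx 0 i).
by rewrite !pairing_delta => /(can_inj (op_lK o)).
Qed.

Lemma functional_pairing n (f : {linear 'rV[A]_n -> A^o}) :
  exists y, forall x, f x = pairing x y.
Proof.
exists (\row_i op_r o (f (delta_mx 0 i))).
apply: (free_lin_ext (g := pairing_lin _)) => i.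
by rewrite /pairing_lin /= pairing_delta mxE op_rK.
Qed.

(** The transposed matrix with entries in the opposite ring; [pairing_transp] determines it. *)
Definition transp m n (f : {linear 'rV[A]_m -> 'rV[A]_n}) :
  {linear 'rV[B]_n -> 'rV[B]_m} :=
  free_lin (fun j => \row_k op_r o (f (delta_mx 0 k) 0 j)).

Lemma pairing_transp m n (f : {linear 'rV[A]_m -> 'rV[A]_n}) x y :
  pairing (f x) y = pairing x (transp f y).
Proof.
apply: (free_lin_ext (f := lcomp (pairing_lin y) f) (g := pairing_lin _)) => k.
rewrite /lcomp /pairing_lin /= pairing_delta summxE op_sum.
by apply: eq_bigr => i _; rewrite !mxE opM op_rK.
Qed.

Lemma transp_comp m n p (g : {linear 'rV[A]_n -> 'rV[A]_p})
  (f : {linear 'rV[A]_m -> 'rV[A]_n}) y : transp (lcomp g f) y = transp f (transp g y).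
Proof. by apply: pairing_nondeg_r => x; rewrite -!pairing_transp. Qed.

Lemma transp_eq m n (f g : {linear 'rV[A]_m -> 'rV[A]_n}) : f =1 g -> transp f =1 transp g.
Proof. by move=> fg y; apply: pairing_nondeg_r => x; rewrite -!pairing_transp fg. Qed.

Lemma transpB m n (f g : {linear 'rV[A]_m -> 'rV[A]_n}) y :
  transp (f \- g) y = transp f y - transp g y.
Proof.
apply: pairing_nondeg_r => x; rewrite -pairing_transp /= pairingBl.
have -> : transp f y - transp g y = transp f y + (-1) *: transp g y by rewrite scaleN1r.
rewrite pairingDr pairingZr -!pairing_transp.
congr (_ + _); rewrite -[in LHS](mulr1 (pairing (g x) y)) -mulrN; congr (_ * _).
by apply: (addrI (op_l o 1)); rewrite -opD !subrr !op1 subrr op0.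
Qed.

Lemma transp_id n y : transp (lid 'rV[A]_n) y = y.
Proof. by apply: pairing_nondeg_r => x; rewrite -pairing_transp. Qed.

Lemma transp0 m n (f : {linear 'rV[A]_m -> 'rV[A]_n}) :
  (forall x, f x = 0) -> forall y, transp f y = 0.
Proof.
by move=> f0 y; apply: pairing_nondeg_r => x; rewrite -pairing_transp f0 pairing0l pairing0r.
Qed.

End FreeDuality.

Section FreeDualitySym.
Variables (A B : nzRingType) (o : opp_pair A B).

Lemma pairing_sym n (x : 'rV[A]_n) (y : 'rV[B]_n) :
  pairing (opp_sym o) y x = op_r o (pairing o x y).
Proof. by rewrite /pairing op_sum; apply: eq_bigr => i _; rewrite opM /= op_lK. Qed.

Lemma pairing_nondeg_l n (x x' : 'rV[A]_n) :
  (forall y, pairing o x y = pairing o x' y) -> x = x'.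
Proof. by move=> H; apply: (@pairing_nondeg_r _ _ (opp_sym o)) => y; rewrite !pairing_sym H. Qed.

Lemma pairing_eq0_sym n (x : 'rV[A]_n) (y : 'rV[B]_n) :
  pairing (opp_sym o) y x = 0 <-> pairing o x y = 0.
Proof.
rewrite pairing_sym; split=> [|->]; last exact: op0.
by move/(congr1 (op_l o)); rewrite op_rK op0.
Qed.

Lemma transpK m n (f : {linear 'rV[A]_m -> 'rV[A]_n}) : transp (opp_sym o) (transp o f) =1 f.
Proof.
move=> x; apply: pairing_nondeg_l => y; rewrite [RHS]pairing_transp.
apply: (can_inj (op_rK o)); rewrite -!pairing_sym.
by rewrite pairing_transp.
Qed.

Lemma dual_freeE n (y : 'rV[B]_n) x :
  dual_fun (dual_free (op_l o) n y) x = pairing o x y.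
Proof.
apply: (free_lin_ext (g := pairing_lin o y)) => i.
by rewrite dual_free_delta /= pairing_delta.
Qed.

Lemma dual_map_free m n (h : {linear 'rV[A]_m -> 'rV[A]_n}) y :
  dual_map (op_l o) h (dual_free _ n y) = dual_free (op_l o) m (transp o h y).
Proof. by apply: dualP => x; rewrite dual_freeE -pairing_transp -dual_freeE. Qed.

End FreeDualitySym.

(** * Short exact sequences and vanishing of Ext *)


Section Modules.
Variable A : nzRingType.
Implicit Types U V W X Y Z : lmodType A.

Definition ses U V W (i : {linear U -> V}) (p : {linear V -> W}) :=
  [/\ injective i, surj p & forall x, p x = 0 <-> exists y, i y = x].

(** For [V] free, [i] injective and [X] the ring, this says that Ext^1(V/U, A) = 0. *)
Definition extends U V (i : {linear U -> V}) X :=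
  forall f : {linear U -> X}, exists g : {linear V -> X}, forall x, g (i x) = f x.

Lemma lcompE U V W (g : {linear V -> W}) (f : {linear U -> V}) x : lcomp g f x = g (f x).
Proof. by []. Qed.

Lemma lin_inj U V (f : {linear U -> V}) : (forall x, f x = 0 -> x = 0) -> injective f.
Proof.
move=> f0 x y fxy; apply/eqP; rewrite -subr_eq0; apply/eqP/f0.
by rewrite linearB fxy subrr.
Qed.

Lemma surj_factor V W X (p : {linear V -> W}) (f : {linear V -> X}) :
  surj p -> (forall x, p x = 0 -> f x = 0) ->
  exists g : {linear W -> X}, forall x, g (p x) = f x.
Proof.
move=> /choice[s sP] pf.
have E x : f (s (p x)) = f x.
  by apply/eqP; rewrite -subr_eq0 -linearB; apply/eqP/pf; rewrite linearB sP subrr.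
have gL : linear (fun w => f (s w)).
  move=> a w w'; rewrite -{1}(sP w) -{1}(sP w') -linearP E linearP.
  by [].
by exists (mklin gL).
Qed.

Lemma inj_factor U V X (i : {linear U -> V}) (f : {linear X -> V}) :
  injective i -> (forall x, exists y, i y = f x) ->
  exists g : {linear X -> U}, forall x, i (g x) = f x.
Proof.
move=> ii /choice[g gP].
have gL : linear g by move=> a x y; apply: ii; rewrite linearP !gP linearP.
by exists (mklin gL).
Qed.

Lemma ses_ker V W (p : {linear V -> W}) : surj p -> ses (sm_incl (sm_ker p)) p.
Proof.
move=> ps; split=> // [|x]; first exact: sm_incl_inj.
split=> [px|[y <-]]; last exact: (sm_inclP (S := sm_ker p) y).
by exists (sm_mk (S := sm_ker p) px).
Qed.

Lemma ses_coker U V (i : {linear U -> V}) :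
  injective i -> ses i (quo_proj (sm_im i)).
Proof.
by move=> ii; split=> // [|x]; [exact: quo_proj_surj | exact: quo_proj_eq0].
Qed.

Lemma ses0 U V W (i : {linear U -> V}) (p : {linear V -> W}) :
  ses i p -> forall x, p (i x) = 0.
Proof. by case=> _ _ e x; apply/e; exists x. Qed.

Lemma extends_free U V (i : {linear U -> V}) n :
  extends i A^o -> extends i 'rV[A]_n.
Proof.
move=> ie f.
pose cf (j : 'I_n) : {linear 'rV[A]_n -> A^o} := mklin (@coord_linear A n j).
have /choice[g gP] := fun j => ie (lcomp (cf j) f).
have GL : linear (fun v => \row_j (g j v : A)).
  by move=> a x y; apply/rowP => j; rewrite !mxE linearP.
by exists (mklin GL) => x; apply/rowP => j; rewrite mxE gP.
Qed.

Section Rows.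
Variables (m n : nat).

Lemma rinl_linear : linear (fun x : 'rV[A]_m => row_mx x 0 : 'rV[A]_(m + n)).
Proof. by move=> a x y; rewrite scale_row_mx add_row_mx scaler0 addr0. Qed.
Lemma rinr_linear : linear (fun x : 'rV[A]_n => row_mx 0 x : 'rV[A]_(m + n)).
Proof. by move=> a x y; rewrite scale_row_mx add_row_mx scaler0 addr0. Qed.
Lemma rprl_linear : linear (fun x : 'rV[A]_(m + n) => lsubmx x).
Proof. by move=> a x y; apply/rowP => j; rewrite !mxE. Qed.
Lemma rprr_linear : linear (fun x : 'rV[A]_(m + n) => rsubmx x).
Proof. by move=> a x y; apply/rowP => j; rewrite !mxE. Qed.

Definition rinl : {linear 'rV[A]_m -> 'rV[A]_(m + n)} := mklin rinl_linear.
Definition rinr : {linear 'rV[A]_n -> 'rV[A]_(m + n)} := mklin rinr_linear.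
Definition rprl : {linear 'rV[A]_(m + n) -> 'rV[A]_m} := mklin rprl_linear.
Definition rprr : {linear 'rV[A]_(m + n) -> 'rV[A]_n} := mklin rprr_linear.

Lemma rprl_inl x : rprl (rinl x) = x. Proof. exact: row_mxKl. Qed.
Lemma rprr_inl x : rprr (rinl x) = 0. Proof. exact: row_mxKr. Qed.
Lemma rprl_inr x : rprl (rinr x) = 0. Proof. exact: row_mxKl. Qed.
Lemma rprr_inr x : rprr (rinr x) = x. Proof. exact: row_mxKr. Qed.
Lemma row_eta x : x = rinl (rprl x) + rinr (rprr x).
Proof. by rewrite /= add_row_mx addr0 add0r hsubmxK. Qed.

Definition copair V (f : {linear 'rV[A]_m -> V}) (g : {linear 'rV[A]_n -> V}) :
  {linear 'rV[A]_(m + n) -> V} := lcomp f rprl \+ lcomp g rprr.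

Lemma copair_inl V (f : {linear 'rV[A]_m -> V}) g x : copair f g (rinl x) = f x.
Proof.
by rewrite -[LHS]/(f (rprl (rinl x)) + g (rprr (rinl x))) rprl_inl rprr_inl linear0 addr0.
Qed.
Lemma copair_inr V (f : {linear 'rV[A]_m -> V}) g x : copair f g (rinr x) = g x.
Proof.
by rewrite -[LHS]/(f (rprl (rinr x)) + g (rprr (rinr x))) rprl_inr rprr_inr linear0 add0r.
Qed.
Lemma copairE V (f : {linear 'rV[A]_m -> V}) g x : copair f g x = f (rprl x) + g (rprr x).
Proof. by []. Qed.

End Rows.

(* [ext_vanish_upto n Z] says that Ext^i(Z, A) = 0 for 1 <= i <= n. *)
Fixpoint ext_vanish_upto (n : nat) Z : Prop :=
  if n is m.+1 then
    exists k (Z' : lmodType A) (i : {linear Z' -> 'rV[A]_k}) (p : {linear 'rV[A]_k -> Z}),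
      [/\ ses i p, extends i A^o & ext_vanish_upto m Z']
  else True.

Section Horseshoe.
Variables (L' L L'' : lmodType A) (i : {linear L' -> L}) (p : {linear L -> L''}).
Variables (Z' Z'' : lmodType A) (k l : nat).
Variables (i' : {linear Z' -> 'rV[A]_k}) (p' : {linear 'rV[A]_k -> L'}).
Variables (i'' : {linear Z'' -> 'rV[A]_l}) (p'' : {linear 'rV[A]_l -> L''}).
Hypotheses (s : ses i p) (s' : ses i' p') (s'' : ses i'' p'').

(** The middle module is covered by [lcomp i p'] on one summand and a lift of [p''] on the other; a
    diagram chase makes the kernels of the three covers an exact sequence. *)
Lemma horseshoe : exists (Z : lmodType A) (j : {linear Z -> 'rV[A]_(k + l)})
    (q : {linear 'rV[A]_(k + l) -> L}) (a : {linear Z' -> Z}) (b : {linear Z -> Z''}),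
  [/\ ses j q, ses a b,
      forall x, q (rinl k l x) = i (p' x),
      forall x, j (a x) = rinl k l (i' x)
    & forall x, i'' (b x) = rprr k l (j x)].
Proof.
have [[ii ps e] [ii' ps' e'] [ii'' ps'' e'']] := And3 s s' s''.
have [h hP] := free_projective (n := l) p'' ps.
pose q : {linear 'rV[A]_(k + l) -> L} := copair (lcomp i p') h.
have pq x : p (q x) = p'' (rprr k l x).
  rewrite copairE linearD hP -[lcomp i p' _]/(i (p' _)) (ses0 s) add0r.
  by [].
have qs : surj q.
  move=> y; have [x'' x''y] := ps'' (p y).
  have [z zP] : exists z, i z = y - h x'' by apply/e; rewrite linearB hP x''y subrr.
  have [x' x'z] := ps' z.
  exists (rinl k l x' + rinr k l x''); rewrite linearD copair_inl copair_inr.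
  by rewrite -[lcomp i p' _]/(i (p' _)) x'z zP subrK.
have sq := ses_ker qs; set j := sm_incl _ in sq; have [ji _ je] := sq.
have [a aP] : exists a : {linear Z' -> subm (sm_ker q)}, forall x, j (a x) = lcomp (rinl k l) i' x.
  apply: inj_factor => // x; apply/je.
  by rewrite copair_inl -[lcomp i p' _]/(i (p' _)) (ses0 s') linear0.
have [b bP] : exists b : {linear subm (sm_ker q) -> Z''}, forall x, i'' (b x) = lcomp (rprr k l) j x.
  apply: inj_factor => // x; apply/e''.
  by rewrite -[lcomp _ _ _]/(rprr k l (j x)) -pq (ses0 sq) linear0.
exists (subm (sm_ker q)), j, q, a, b; split=> //; last by move=> x; rewrite copair_inl.
split=> [||x].
- apply: lin_inj => x ax; apply: ii'; rewrite linear0.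
  have := aP x; rewrite ax linear0 => /(congr1 (@rprl k l)).
  by rewrite linear0 -[lcomp _ _ _]/(rinl k l (i' x)) rprl_inl.
- move=> z; have [y yP] : exists y, i y = - h (i'' z).
    by apply/e; rewrite linearN hP (ses0 s'') oppr0.
  have [x xP] := ps' y.
  have [w wP] : exists w, j w = rinl k l x + rinr k l (i'' z).
    apply/je; rewrite linearD copair_inl copair_inr -[lcomp _ _ _]/(i (p' x)) xP yP.
    exact: addNr.
  exists w; apply: ii''; rewrite bP -[lcomp _ _ _]/(rprr k l (j w)) wP linearD.
  by rewrite rprr_inl rprr_inr add0r.
- split=> [bx|[y <-]]; last first.
    apply: ii''; rewrite bP -[lcomp _ _ _]/(rprr k l (j (a y))) aP linear0.
    exact: rprr_inl.
  have jr : rprr k l (j x) = 0 by rewrite -[LHS]/(lcomp (rprr k l) j x) -bP bx linear0.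
  have jE : j x = rinl k l (rprl k l (j x)) by rewrite {1}(row_eta (j x)) jr linear0 addr0.
  have : q (j x) = 0 := ses0 sq x.
  rewrite jE copair_inl -[lcomp _ _ _]/(i (p' _)) => /(_ =P _); rewrite -(linear0 i).
  move=> /eqP/ii /e'[y yP]; exists y; apply: ji; rewrite aP jE.
  by rewrite -[lcomp _ _ _]/(rinl k l (i' y)) yP.
Qed.

End Horseshoe.

(** The error [f \- lcomp g j] vanishes on the image of [a], so it descends to [Z''], extends along
    [i''] and is pulled back by [r]. *)
Lemma extends_ses Z' Z Z'' k (j : {linear Z -> 'rV[A]_k}) (a : {linear Z' -> Z})
    (b : {linear Z -> Z''}) l (i'' : {linear Z'' -> 'rV[A]_l})
    (r : {linear 'rV[A]_k -> 'rV[A]_l}) (f : {linear Z -> A^o})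
    (g : {linear 'rV[A]_k -> A^o}) :
  ses a b -> (forall x, i'' (b x) = r (j x)) -> extends i'' A^o ->
  (forall x, g (j (a x)) = f (a x)) ->
  exists g' : {linear 'rV[A]_k -> A^o}, forall x, g' (j x) = f x.
Proof.
move=> [ai bs e] ir ext ga.
have [h hP] : exists h : {linear Z'' -> A^o}, forall x, h (b x) = (f \- lcomp g j) x.
  apply: surj_factor => // x /e[y <-].
  by rewrite /= -[g _]/(g (j (a y))) ga subrr.
have [h' h'P] := ext h.
exists (lcomp h' r \+ g) => x.
by rewrite -[LHS]/(h' (r (j x)) + g (j x)) -ir h'P hP /= subrK.
Qed.

(** By the horseshoe, a first syzygy of [L] is an extension of first syzygies of [L''] and [L'],
    which allows induction on [n]. *)
Lemma ext_vanish_upto_ext n (L' L L'' : lmodType A) (i : {linear L' -> L}) (p : {linear L -> L''}) :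
  ses i p -> ext_vanish_upto n L' -> ext_vanish_upto n L'' -> ext_vanish_upto n L.
Proof.
elim: n L' L L'' i p => // n IHn L' L L'' i p s
  [k [Z' [i' [p' [s' ext' x']]]]] [l [Z'' [i'' [p'' [s'' ext'' x'']]]]].
have [Z [j [q [a [b [sq sab ql ja ib]]]]]] := horseshoe s s' s''.
exists (k + l)%N, Z, j, q; split=> //; last exact: IHn sab x' x''.
move=> f; have [g gP] := ext' (lcomp f a).
apply: (extends_ses (g := lcomp g (rprl k l)) sab ib ext'') => x.
by rewrite ja /lcomp /= -[lsubmx _]/(rprl k l (rinl k l (i' x))) rprl_inl gP.
Qed.

End Modules.

(** * The dual of a free resolution *)


Section DualComplex.
Variables (A B : nzRingType) (o : opp_pair A B).
Variables (r : nat -> nat) (d : forall i, {linear 'rV[A]_(r i.+1) -> 'rV[A]_(r i)}).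
Hypothesis dex : forall i x, d i x = 0 <-> exists y, d i.+1 y = x.

Let os := opp_sym o.

(** P_(-1) is zero, so X_0 is P_0^* itself. *)
Definition xsub i : submod 'rV[B]_(r i) :=
  if i is j.+1 then sm_im (transp o (d j)) else sm_zero _.

Definition xmod i : lmodType B := quo (xsub i).
Definition xproj i : {linear 'rV[B]_(r i) -> xmod i} := quo_proj (xsub i).

Lemma xproj_surj i : surj (xproj i). Proof. exact: quo_proj_surj. Qed.
Lemma xproj_eq0 i y : xproj i y = 0 <-> xsub i y. Proof. exact: quo_proj_eq0. Qed.

Lemma transp_dd i y : transp o (d i.+1) (transp o (d i) y) = 0.
Proof. by rewrite -transp_comp; apply: transp0 => x; apply/dex; exists x. Qed.

Lemma xsub_transp i y : xsub i y -> transp o (d i) y = 0.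
Proof. by case: i y => [y ->|i y [z <-]]; [rewrite linear0 | apply: transp_dd]. Qed.

(** The kernel of this map is the cohomology of the dual complex in degree [i]; it is injective
    where that vanishes. *)
Definition xinc i : {linear xmod i -> 'rV[B]_(r i.+1)} := quo_lift (@xsub_transp i).

Lemma xincE i y : xinc i (xproj i y) = transp o (d i) y.
Proof. exact: (quo_lift_pi (@xsub_transp i)). Qed.

Lemma xproj_inc i x : xproj i.+1 (xinc i x) = 0.
Proof. by have [y <-] := xproj_surj x; rewrite xincE; apply/xproj_eq0; exists y. Qed.

(** A functional on X_(i+1) is an element of P_(i+1) orthogonal to the image of the transpose of
    [d i], hence in the kernel of [d i]; exactness makes it a boundary. *)
Lemma xmod_functional i (f : {linear xmod i.+1 -> B^o}) :
  exists z, forall y, f (xproj i.+1 y) = pairing os y (d i.+1 z).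
Proof.
have [z zP] := functional_pairing os (lcomp f (xproj i.+1)).
have /dex[z' z'z] : d i z = 0.
  apply: (@pairing_nondeg_l _ _ o) => y; rewrite pairing0l; apply/pairing_eq0_sym.
  rewrite -(transpK o (d i)) -pairing_transp -zP lcompE.
  have -> : xproj i.+1 (transp o (d i) y) = 0 by apply/xproj_eq0; exists y.
  exact: linear0.
by exists z' => y; rewrite z'z -zP.
Qed.

Variable N : nat.
Hypothesis coex : forall i, (i < N)%N -> forall y, transp o (d i) y = 0 -> xsub i y.

Lemma xses i : (i < N)%N -> ses (xinc i) (xproj i.+1).
Proof.
move=> iN; split=> [||x]; last 1 first.
- rewrite xproj_eq0; split=> [[y <-]|[z <-]]; first by exists (xproj i y); apply: xincE.
  by have [y <-] := xproj_surj z; exists y; rewrite xincE.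
- apply: lin_inj => x; have [y <-] := xproj_surj x.
  by rewrite xincE => /(coex iN)/xproj_eq0.
- exact: xproj_surj.
Qed.

Lemma xmod0_section : exists s : {linear xmod 0 -> 'rV[B]_(r 0)},
  (forall y, s (xproj 0 y) = y) /\ (forall x, xproj 0 (s x) = x).
Proof.
have [s sP] : exists s : {linear xmod 0 -> 'rV[B]_(r 0)}, forall y, s (xproj 0 y) = lid _ y.
  by apply: surj_factor => [|x /xproj_eq0 ->] //; exact: xproj_surj.
by exists s; split=> // x; have [y <-] := xproj_surj x; rewrite sP.
Qed.

(** By [xses] the obstruction to lifting [u] lies in Ext^1(Z, X_i), which vanishes because maps into
    X_i extend along [j]. *)
Lemma xlift i (Z' Z : lmodType B) k (j : {linear Z' -> 'rV[B]_k}) (p : {linear 'rV[B]_k -> Z})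
    (u : {linear Z -> xmod i.+1}) :
  (i < N)%N -> ses j p -> extends j (xmod i) ->
  exists G : {linear Z -> 'rV[B]_(r i.+1)}, forall z, xproj i.+1 (G z) = u z.
Proof.
move=> iN sj ext; have [ji ps e] := sj.
have [F FP] := free_projective (n := k) (lcomp u p) (@xproj_surj i.+1).
have [xi _ xe] := xses iN.
have [w wP] : exists w : {linear Z' -> xmod i}, forall x, xinc i (w x) = lcomp F j x.
  apply: inj_factor => // x; apply/xe.
  by rewrite lcompE FP lcompE (ses0 sj) linear0.
have [w' w'P] := ext w.
have [G GP] : exists G : {linear Z -> 'rV[B]_(r i.+1)},
    forall x, G (p x) = (F \- lcomp (xinc i) w') x.
  apply: surj_factor => // x /e[y <-].
  by rewrite -[LHS]/(F (j y) - xinc i (w' (j y))) w'P wP lcompE subrr.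
exists G => z; have [x <-] := ps z; rewrite GP linearB FP.
by rewrite -[X in _ - X]/(xproj i.+1 (xinc i (w' x))) xproj_inc subr0.
Qed.

(** Dimension shifting: X_i has a free resolution of length [i], so Ext^1(Z, X_i) is controlled by
    Ext^1(Z, B), ..., Ext^(i+1)(Z, B). *)
Lemma extends_xmod i (Z : lmodType B) : (i <= N)%N -> ext_vanish_upto i.+1 Z ->
  exists k (Z' : lmodType B) (j : {linear Z' -> 'rV[B]_k}) (p : {linear 'rV[B]_k -> Z}),
    ses j p /\ extends j (xmod i).
Proof.
elim: i Z => [|i IHi] Z iN [k [Z1 [j [p [sj ext xZ1]]]]].
  exists k, Z1, j, p; split=> // f.
  have [s [sx xs]] := xmod0_section.
  have [g gP] := extends_free (n := r 0) ext (lcomp s f).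
  by exists (lcomp (xproj 0) g) => x; rewrite lcompE gP xs.
have [l [Z2 [j2 [p2 [sj2 ext2]]]]] := IHi Z1 (ltnW iN) xZ1.
exists k, Z1, j, p; split=> // u.
have [G GP] := xlift u iN sj2 ext2.
have [g gP] := extends_free (n := r i.+1) ext G.
by exists (lcomp (xproj i.+1) g) => x; rewrite lcompE gP GP.
Qed.

Lemma hom_free_eq0 (L : lmodType B) n (u : {linear L -> 'rV[B]_n}) :
  (forall (f : {linear L -> B^o}) x, f x = 0) -> forall x, u x = 0.
Proof.
move=> L0 x; apply/rowP => k; rewrite mxE.
exact: (L0 (lcomp (mklin (@coord_linear B n k)) u)).
Qed.

Lemma hom_xmod_eq0 i (L : lmodType B) (u : {linear L -> xmod i}) :
  (i <= N)%N -> ext_vanish_upto i L -> (forall (f : {linear L -> B^o}) x, f x = 0) ->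
  forall x, u x = 0.
Proof.
case: i u => [|i] u iN xL L0 x.
  have [s [_ xs]] := xmod0_section.
  by rewrite -(xs (u x)) -[s _]/(lcomp s u x) hom_free_eq0 // linear0.
have [k [Z' [j [p [sj ext]]]]] := extends_xmod (ltnW iN) xL.
have [G GP] := xlift u iN sj ext.
by rewrite -GP (hom_free_eq0 G L0) linear0.
Qed.

Hypothesis simple_coker : forall z, ~ (exists z', d 0 z' = z) ->
  forall x, exists a z', x = a *: z + d 0 z'.

(** For i = 0, the functionals on X_0 that extend to [V] form a submodule of P_0, which contains the
    image of [d 0] because of [e]. By [simple_coker] it is this image or all of P_0, and in the
    latter case the identity of X_0 extends to [V]. The horseshoe reduces [i.+1] to [i] by passing
    to syzygies. *)
Lemma xmod_extension i (V Z : lmodType B) (g : {linear xmod i -> V})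
    (q : {linear V -> Z}) (e : {linear V -> 'rV[B]_(r i.+1)}) :
  (i <= N)%N -> ses g q -> (forall x, e (g x) = xinc i x) -> ext_vanish_upto i Z ->
  (exists h : {linear V -> xmod i}, forall x, h (g x) = x) \/
  (ext_vanish_upto i V /\ forall f : {linear V -> B^o},
     exists z, forall y, f (g (xproj i y)) = pairing os y (d i z)).
Proof.
elim: i V Z g q e => [|i IHi] V Z g q e iN sg eg xZ.
  have [|nH] := pselect (forall f : {linear V -> B^o},
     exists z, forall y, f (g (xproj 0 y)) = pairing os y (d 0 z)); first by right.
  left; have [f fH] : exists f : {linear V -> B^o}, ~ exists z,
      forall y, f (g (xproj 0 y)) = pairing os y (d 0 z).
    by apply/existsNP.
  have [z zP] := functional_pairing os (lcomp f (lcomp g (xproj 0))).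
  have nz : ~ exists z', d 0 z' = z.
    by move=> [z' z'z]; apply: fH; exists z' => y; rewrite z'z -zP.
  (* Write the k-th basis vector as [a *: z + d 0 z']; then [a] acting on [f], plus the pairing of
     [e] with [z'], extends the k-th coordinate. *)
  have /choice[F FP] : forall k, exists F : {linear V -> B^o},
      forall y, F (g (xproj 0 y)) = y 0 k.
    move=> k; have [a [z' E]] := simple_coker nz (delta_mx 0 k).
    exists (dual_fun (dual_scale (t := op_r o) a f) \+ lcomp (pairing_lin os z') e) => y.
    have -> : y 0 k = pairing os y (delta_mx 0 k : 'rV[A]_(r 0)).
      by rewrite pairing_sym pairing_delta op_lK.
    rewrite E pairingDr pairingZr -zP /=; congr (_ + _).
    by rewrite eg xincE pairing_transp transpK.
  have hL : linear (fun v => \row_k (F k v : B) : 'rV[B]_(r 0)).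
    by move=> a x y; apply/rowP => k; rewrite !mxE linearP.
  exists (lcomp (xproj 0) (mklin hL)) => x; have [y <-] := xproj_surj x.
  by rewrite lcompE; congr (xproj 0 _); apply/rowP => k; rewrite mxE FP.
have [k [Z' [j [p [sj ext xZ']]]]] := xZ.
have [V' [jj [qq [a [b [sq sab ql ja jb]]]]]] := horseshoe sg (xses iN) sj.
have [gi _ ge] := sg; have [ai bs abe] := sab; have [qi qs qe] := sq.
pose e' := lcomp (rprl B (r i.+1) k) jj.
have e'a x : e' (a x) = xinc i x by rewrite lcompE ja rprl_inl.
have [[h hP]|[xV' fV']] := IHi V' Z' a b e' (ltnW iN) sab e'a xZ'; [left|right].
  (* A splitting for the syzygy [V'] gives one for [V]: the difference of [lcomp (xinc i) h] and
     [e'] descends to [Z'] and extends to [h2]. Then [R] sends the relations of [V] into the image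
     of [xinc], which [xproj] kills. *)
  have [h1 h1P] : exists h1 : {linear Z' -> 'rV[B]_(r i.+1)},
      forall v, h1 (b v) = (lcomp (xinc i) h \- e') v.
    apply: surj_factor => // v /abe[x <-].
    by rewrite -[LHS]/(xinc i (h (a x)) - e' (a x)) hP e'a subrr.
  have [h2 h2P] := extends_free (n := r i.+1) ext h1.
  pose R : {linear 'rV[B]_(r i.+1 + k) -> 'rV[B]_(r i.+1)} :=
    rprl B (r i.+1) k \+ lcomp h2 (rprr B (r i.+1) k).
  have [h3 h3P] : exists h3 : {linear V -> xmod i.+1},
      forall x, h3 (qq x) = lcomp (xproj i.+1) R x.
    apply: surj_factor => // x /qe[v <-].
    have -> : lcomp (xproj i.+1) R (jj v) = xproj i.+1 (xinc i (h v)).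
      rewrite lcompE; congr (xproj _ _).
      rewrite -[LHS]/(e' v + h2 (rprr B (r i.+1) k (jj v))) -jb h2P h1P.
      by rewrite /= addrC subrK.
    exact: xproj_inc.
  exists h3 => x; have [y <-] := xproj_surj x.
  rewrite -ql h3P lcompE; congr (xproj _ _).
  rewrite -[LHS]/(rprl B (r i.+1) k (rinl B (r i.+1) k y) +
    h2 (rprr B (r i.+1) k (rinl B (r i.+1) k y))).
  by rewrite rprl_inl rprr_inl linear0 addr0.
(* The statement on functionals is [xmod_functional]; what remains is that functionals on [V']
   extend, by [extends_ses]. *)
split=> [|f]; last first.
  have [z zP] := xmod_functional (lcomp f g).
  by exists z => y; rewrite -zP.
exists (r i.+1 + k)%N, V', jj, qq; split=> // f.
have [z zP] := fV' f.
apply: (extends_ses (g := lcomp (pairing_lin os z) (rprl B (r i.+1) k)) sab jb ext) => x.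
have [y <-] := xproj_surj x.
by rewrite ja lcompE rprl_inl xincE zP -[LHS]/(pairing os (transp o (d i) y) z) pairing_transp transpK.
Qed.

End DualComplex.

(** * Modules of finite length and depth *)


Lemma einf_some (S : nat -> Prop) n :
  einf S = Some n <-> S n /\ forall m, S m -> (n <= m)%N.
Proof.
rewrite /einf; case: pselect => [ex|nex]; last first.
  by split=> // -[Sn _]; case: nex; exists n; apply/asboolP.
case: ex_minnP => m /asboolP Sm mmin; split=> [[<-]|[Sn nmin]].
  by split=> // k Sk; apply: mmin; apply/asboolP.
by congr Some; apply/eqP; rewrite eqn_leq nmin // mmin //; apply/asboolP.
Qed.

Lemma einf_none (S : nat -> Prop) : einf S = None <-> forall n, ~ S n.
Proof.
rewrite /einf; case: pselect => [ex|nex]; split=> //.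
  by move=> H; exfalso; have [n /asboolP /H] := ex.
by move=> _ n Sn; apply: nex; exists n; apply/asboolP.
Qed.

Lemma orbit_linear (A : nzRingType) (V : lmodType A) (e : V) :
  linear (fun a : A^o => a *: e).
Proof. by move=> a x y; rewrite scalerDl scalerA. Qed.

Definition orbit_map (A : nzRingType) (V : lmodType A) (e : V) : {linear A^o -> V} :=
  mklin (orbit_linear e).

Section LocalIdeal.
Variables (A : nzRingType) (J : submod A^o).
Hypotheses (J1 : ~ J 1) (Junit : forall x : A, ~ J x -> exists y, y * x = 1).

Definition res_mod : lmodType A := quo J.

Lemma one_sub_unit (x : A) : J x -> exists y, y * (1 - x) = 1.
Proof.
move=> Jx; apply: Junit => J1x; apply: J1.
by rewrite -(subrK x 1); apply: (smD (s := J)).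
Qed.

(** For [e] in [S'] outside [S], the elements carrying [e] into [S] are exactly those of [J], so 1
    can be sent to the class of [e]. *)
Lemma simple_factor (V : lmodType A) (S S' : submod V) :
  (forall x, S x -> S' x) -> (exists2 x, S' x & ~ S x) ->
  (forall T : submod V, (forall x, S x -> T x) -> (forall x, T x -> S' x) ->
     (forall x, T x -> S x) \/ (forall x, S' x -> T x)) ->
  exists u : {linear res_mod -> quo (sm_preim (sm_incl S') S)}, injective u /\ surj u.
Proof.
move=> SS' [e S'e nSe] simp.
(* [T a] is A a e + S; simplicity allows only [S] or [S']. *)
have /choice[T TP] : forall a : A, exists T : submod V,
    forall x, T x <-> exists (b : A) s, S s /\ x = b *: (a *: e) + s.
  move=> a; unshelve eexists (Submod (sm_set := fun x =>
    exists (b : A) s, S s /\ x = b *: (a *: e) + s) _ _ _) => //.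
  - by exists 0, 0; rewrite scale0r addr0; split=> //; apply: sm0.
  - move=> _ _ [b [s [Ss ->]]] [b' [s' [Ss' ->]]]; exists (b + b'), (s + s').
    by rewrite scalerDl addrACA; split=> //; apply: smD.
  - move=> c _ [b [s [Ss ->]]]; exists (c * b), (c *: s).
    by split; [apply: smZ | rewrite scalerDr !scalerA mulrA].
have TS a : (forall x, T a x -> S x) \/ (forall x, S' x -> T a x).
  apply: simp => [x Sx|x /TP[b [s [Ss ->]]]].
    by apply/TP; exists 0, x; rewrite scale0r add0r.
  by apply: smD; [do 2!apply: smZ | apply: SS'].
have Ta a : T a (a *: e).
  by apply/TP; exists 1, 0; rewrite scale1r addr0; split=> //; apply: sm0.
(* If [T a] were [S'], then e = b a e + s; as 1 - b a has a left inverse, [e] would lie in [S]. *)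
have JS a : J a -> S (a *: e).
  move=> Ja; have [H|H] := TS a; first exact/H/Ta.
  have /TP[b [s [Ss E]]] := H e S'e.
  have [c c1] : exists c, c * (1 - b * a) = 1.
    by apply: one_sub_unit; apply: (smZ (s := J)).
  case: nSe; rewrite -[e]scale1r -c1 -scalerA; apply: smZ.
  by rewrite scalerBl scale1r -scalerA {1}E addrC addrA addNr add0r.
have SJ a : S (a *: e) -> J a.
  move=> Sae; have [//|/Junit[y ya]] := pselect (J a).
  by case: nSe; rewrite -[e]scale1r -ya -scalerA; apply: smZ.
pose v := orbit_map (V := subm S') (sm_mk S'e).
have vE a : sm_incl S' (v a) = a *: e by apply: (linearZ_LR (sm_incl S')).

have [u uP] : exists u : {linear res_mod -> quo (sm_preim (sm_incl S') S)},
    forall a, u (quo_proj J a) = lcomp (quo_proj _) v a.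
  apply: surj_factor => [|a /quo_proj_eq0 Ja]; first exact: quo_proj_surj.
  by apply/quo_proj_eq0; rewrite -[sm_set _ _]/(S (sm_incl S' (v a))) vE; apply: JS.
exists u; split.
  apply: lin_inj => x; have [a <-] := quo_proj_surj x.
  rewrite uP => /quo_proj_eq0; rewrite -[sm_set _ _]/(S (sm_incl S' (v a))) vE.
  by move/SJ/quo_proj_eq0.
move=> y; have [x <-] := quo_proj_surj y.
have [H|H] := TS 1.
  by case: nSe; apply: H; have := Ta 1; rewrite scale1r.
have /TP[b [s [Ss E]]] := H _ (sm_inclP x).
exists (quo_proj J b); rewrite uP; apply/quo_pi_eq.
rewrite -[sm_set _ _]/(S (sm_incl S' (v b - x))) linearB vE.
by rewrite [sm_incl S' x]E scale1r opprD addrA subrr add0r; apply: smN.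
Qed.

(** Each step of a composition series is an extension by a copy of [res_mod], by [simple_factor]. *)
Lemma finite_length_ind (C : lmodType A -> Prop) :
  (forall Z : lmodType A, (forall z : Z, z = 0) -> C Z) -> C res_mod ->
  (forall (L' L L'' : lmodType A) (i : {linear L' -> L}) (p : {linear L -> L''}),
     ses i p -> C L' -> C L'' -> C L) ->
  forall V, finite_length V -> C V.
Proof.
move=> C0 CD Cext.
(* An isomorphic copy is an extension of the zero module by the original. *)
have Ciso (Z Y : lmodType A) (f : {linear Z -> Y}) : injective f -> surj f -> C Z -> C Y.
  move=> fi fs CZ; apply: (Cext _ _ 'rV[A]_0 f \0) => //.
    by split=> // y; exists 0; rewrite [y]thinmx0.
  by apply: C0 => z; rewrite [z]thinmx0.
move=> V [n [S [S0 Sn Si]]].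
have CS i : (i <= n)%N -> C (subm (S i)).
  elim: i => [_|i IHi iN].
    by apply: C0 => z; apply: (@sm_incl_inj _ _ (S 0%N)); rewrite linear0; apply/S0/sm_inclP.
  have [SS ex simp] := Si i iN.
  have [u [ui us]] := simple_factor SS ex simp.
  have [a aP] : exists a : {linear subm (S i) -> subm (S i.+1)},
      forall x, sm_incl _ (a x) = sm_incl _ x.
    apply: inj_factor => [|x]; first exact: sm_incl_inj.
    by exists (sm_mk (SS _ (sm_inclP x))).
  apply: (Cext _ _ _ a (quo_proj (sm_preim (sm_incl (S i.+1)) (S i)))); last 1 first.
  - exact: Ciso ui us CD.
  - split=> [||x]; last 1 first.
    + rewrite quo_proj_eq0; split=> [Sx|[y <-]]; last first.
        by rewrite -[sm_set _ _]/(S i (sm_incl _ (a y))) aP; apply: sm_inclP.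
      by exists (sm_mk (S := S i) Sx); apply: sm_incl_inj; rewrite aP.
    + apply: lin_inj => x ax; apply: (@sm_incl_inj _ _ (S i)).
      by rewrite -aP ax !linear0.
    + exact: quo_proj_surj.
  - exact: IHi (ltnW iN).
apply: (Ciso _ _ (sm_incl (S n))) (CS n (leqnn n)); first exact: sm_incl_inj.
by move=> x; exists (sm_mk (Sn x)).
Qed.

Lemma finite_length_socle (V : lmodType A) :
  finite_length V -> (exists x : V, x != 0) ->
  exists u : {linear res_mod -> V}, injective u.
Proof.
move=> [[|n] [S [S0 Sn Si]]] [x x0]; first by rewrite (S0 _ (Sn x)) eqxx in x0.
have [SS ex simp] := Si 0%N isT.
have [u [ui us]] := simple_factor SS ex simp.
have [w wP] : exists w : {linear quo (sm_preim (sm_incl (S 1%N)) (S 0%N)) -> V},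
    forall x, w (quo_proj _ x) = sm_incl (S 1%N) x.
  apply: surj_factor => [|y /quo_proj_eq0 Sy]; first exact: quo_proj_surj.
  exact: S0.
exists (lcomp w u); apply: lin_inj => y /=.
have [z zy] := quo_proj_surj (u y); rewrite -[w _]/(w (u y)) -zy wP => z0.
apply: ui; rewrite linear0 -zy; apply/quo_proj_eq0.
rewrite -[sm_set _ _]/(S 0%N (sm_incl _ z)) z0.
exact: sm0.
Qed.

Lemma ext_vanish_upto_eq0 n (Z : lmodType A) : (forall z : Z, z = 0) -> ext_vanish_upto n Z.
Proof.
elim: n Z => // n IHn Z Z0; exists 0%N, 'rV[A]_0, (lid _), \0; split.
- split=> // [y|x]; first by exists 0; rewrite [y]Z0.
  by split=> // _; exists x.
- by move=> f; exists f.
- by apply: IHn => z; rewrite [z]thinmx0.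
Qed.

Lemma finite_length_ext_vanish_upto n (V : lmodType A) :
  ext_vanish_upto n res_mod -> finite_length V -> ext_vanish_upto n V.
Proof.
move=> xD; apply: (finite_length_ind (C := ext_vanish_upto n)) => // [Z|L' L L'' i p].
  exact: ext_vanish_upto_eq0.
exact: ext_vanish_upto_ext.
Qed.

Lemma finite_length_hom (V : lmodType A) : (forall (f : {linear res_mod -> A^o}) x, f x = 0) ->
  finite_length V -> forall (f : {linear V -> A^o}) x, f x = 0.
Proof.
move=> D0; apply: (finite_length_ind (C := fun Z : lmodType A => forall (f : {linear Z -> A^o}) x, f x = 0)).
- by move=> Z Z0 f x; rewrite (Z0 x) linear0.
- exact: D0.
- move=> L' L L'' i p [ii ps e] L'0 L''0 f x.
  have [g gP] : exists g : {linear L'' -> A^o}, forall x, g (p x) = f x.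
    by apply: surj_factor => // y /e[z <-]; apply: (L'0 (lcomp f i)).
  by rewrite -gP L''0.
Qed.

End LocalIdeal.

(** * Ext computed in coordinates from the syzygy resolution *)

Section ExtResolution.
Variables (A B : nzRingType) (o : opp_pair A B) (nA : noetherian A) (M : fpmod A).

Definition rk i : nat := p_n (pres (fpow (Omega nA) i M)).
Definition rd i : {linear 'rV[A]_(rk i.+1) -> 'rV[A]_(rk i)} := res_d nA M i.
Definition raug i : {linear 'rV[A]_(rk i) -> fpow (Omega nA) i M} := aug _.
Definition rincl i : {linear fpow (Omega nA) i.+1 M -> 'rV[A]_(rk i)} :=
  syz_incl nA (fpow (Omega nA) i M).

Lemma rdE i x : rd i x = rincl i (raug i.+1 x). Proof. by []. Qed.

Lemma rses i : ses (rincl i) (raug i).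
Proof. exact: ses_ker (@aug_surj _ _). Qed.

Lemma rd_exact i x : rd i x = 0 <-> exists y, rd i.+1 y = x.
Proof. by have [_ _ _ e] := res_exact nA M; apply: e. Qed.

Lemma raug_exact x : raug 0 x = 0 <-> exists y, rd 0 y = x.
Proof. by have [_ _ e _] := res_exact nA M; apply: e. Qed.

(** Ext^i(M, A) = 0 in coordinates, in the shape of the hypothesis [coex]. *)
Definition ext_vanish_at i := forall y, transp o (rd i) y = 0 -> xsub o rd i y.

Definition ext_cocycles i : lmodType B := subm (sm_ker (transp o (rd i))).

(** [k] takes a cocycle, written as a row vector over [B], to its class; this transports [Ext] to
    the coordinate complex. *)
Lemma ext_class_ex i : exists k : {linear ext_cocycles i -> Ext (op_l o) nA i M},
  surj k /\ forall v, k v = 0 <-> xsub o rd i (sm_incl _ v).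
Proof.
have cS (v : ext_cocycles i) : cocycles (op_l o) nA M i
    (lcomp (dual_free (op_l o) (rk i)) (sm_incl _) v).
  apply: (etrans (dual_map_free o (rd i) (sm_incl (sm_ker (transp o (rd i))) v))).
  by rewrite (sm_inclP v : transp o (rd i) _ = 0) linear0.
exists (lcomp (quo_proj _) (sm_corestr cS)); split=> [x|v].
  have [c <-] := quo_proj_surj x.
  have [y yc] := dual_free_surj (sm_incl (cocycles (op_l o) nA M i) c).
  have yK : sm_ker (transp o (rd i)) y.
    apply: (@dual_free_inj _ _ (op_l o)); rewrite -dual_map_free yc linear0.
    exact: (sm_inclP (S := cocycles (op_l o) nA M i) c).
  exists (sm_mk yK); rewrite lcompE; congr (quo_proj _ _).
  exact: (@sm_incl_inj _ _ (cocycles (op_l o) nA M i)).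
rewrite lcompE quo_proj_eq0.
rewrite -[sm_set _ _]/(coboundaries (op_l o) nA M i (dual_free (op_l o) (rk i) (sm_incl _ v))).
case: i cS v => [|i] cS v.
  split=> [v0|v0]; last by rewrite (v0 : sm_incl _ v = 0); apply: linear0.
  by apply: (@dual_free_inj _ _ (op_l o)); rewrite linear0; apply: v0.
split=> [[f fv]|[z zv]].
  have [z zf] := dual_free_surj f; exists z.
  by apply: (@dual_free_inj _ _ (op_l o)); rewrite -fv -zf -dual_map_free.
by exists (dual_free (op_l o) (rk i) z); rewrite -zv -dual_map_free.
Qed.

Lemma ext_vanish_atP i : ext_vanish_at i <-> ~ exists x : Ext (op_l o) nA i M, x != 0.
Proof.
have [k [ks kP]] := ext_class_ex i; split=> [H [x /eqP[]]|H y yK].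
  have [v <-] := ks x; apply/kP/H; exact: (sm_inclP v).
apply: (kP (sm_mk (S := sm_ker (transp o (rd i))) yK)).1.
by apply/eqP; apply: contra_notT H => x0; eexists; exact: x0.
Qed.

(** Dimension shifting: Ext^j(Omega^m M, A) is Ext^(m+j)(M, A) for j > 0, as the truncated
    resolution resolves Omega^m M. *)
Lemma ext_vanish_at_upto n m :
  (forall i, (m < i <= m + n)%N -> ext_vanish_at i) -> ext_vanish_upto n (fpow (Omega nA) m M).
Proof.
elim: n m => // n IHn m H.
exists (rk m), (fpow (Omega nA) m.+1 M), (rincl m), (raug m); split.
- exact: rses.
- move=> f; have [y yP] := functional_pairing o (lcomp f (raug m.+1)).
  have [z zy] : exists z, transp o (rd m) z = y.
    apply: (H m.+1); first by rewrite ltnSn addnS ltnS leq_addr.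
    apply: (pairing_nondeg_r (o := o)) => x.
    rewrite pairing0r -pairing_transp -yP lcompE rdE (ses0 (rses m.+1)).
    exact: linear0.
  exists (pairing_lin o z) => x; have [w <-] := @aug_surj _ _ x.
  by rewrite -[f _]/(lcomp f (raug m.+1) w) yP -zy -pairing_transp.
- by apply: IHn => i /andP[mi im]; apply: H; rewrite ltnW // addnS -addSn.
Qed.

Lemma ext_vanish_at_hom : ext_vanish_at 0 -> forall (f : {linear M -> A^o}) x, f x = 0.
Proof.
move=> H f x; have [y yP] := functional_pairing o (lcomp f (raug 0)).
have y0 : y = 0.
  apply: (H y); apply: (pairing_nondeg_r (o := o)) => z.
  rewrite pairing0r -pairing_transp -yP lcompE rdE (ses0 (rses 0)).
  exact: linear0.
have [w <-] := @aug_surj _ _ x.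
by rewrite -[f _]/(lcomp f (raug 0) w) yP y0 pairing0r.
Qed.

End ExtResolution.

Section LocalResolution.
Variables (A : nzRingType) (nA : noetherian A) (J : submod A^o).
Hypotheses (J1 : ~ J 1) (Junit : forall x : A, ~ J x -> exists y, y * x = 1).

Definition resD : fpmod A := FpMod (cyclic_fp nA J).

(** The cokernel of the first differential is A/J, in which every nonzero element generates; this
    supplies [simple_coker]. *)
Lemma resD_simple_coker z : ~ (exists z', rd nA resD 0 z' = z) ->
  forall x, exists a z', x = a *: z + rd nA resD 0 z'.
Proof.
move=> nz x.
have [a az] := quo_proj_surj (raug nA resD 0 z : quo J).
have [b bx] := quo_proj_surj (raug nA resD 0 x : quo J).
have [y ya] : exists y, y * a = 1.
  by apply: Junit => Ja; apply/nz/raug_exact; rewrite -az; apply/quo_proj_eq0.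
have [w wP] : exists w, rd nA resD 0 w = x - (b * y) *: z.
  apply/raug_exact; rewrite linearB linearZ -az -bx.
  apply/eqP; rewrite subr_eq0; apply/eqP.
  by rewrite -[RHS](linearZ_LR (quo_proj J) (b * y) a) /GRing.scale /= -mulrA ya mulr1.
by exists (b * y), w; rewrite wP addrC subrK.
Qed.

Lemma resD_neq0 : exists x : resD, x <> 0.
Proof. by exists (quo_proj J 1 : quo J); move=> /quo_proj_eq0. Qed.

End LocalResolution.

(** * Comparison of the depths on the two sides *)

Section DepthComparison.
Variables (A B : nzRingType) (o : opp_pair A B) (nA : noetherian A) (nB : noetherian B).
Variables (JA : submod A^o) (JB : submod B^o).
Hypotheses (JB1 : ~ JB 1) (JBunit : forall x : B, ~ JB x -> exists y, y * x = 1).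

Let DA := resD nA JA.
Let DB := resD nB JB.

(** Otherwise [hom_xmod_eq0] makes every map from [DB] to X_d zero, but a socle element of Ext^d,
    embedded in X_d by [m], gives a nonzero one. *)
Lemma depth_exchange d : finite_length (Ext (op_l o) nA d DA) ->
  (forall i, (i < d)%N -> ext_vanish_at o nA DA i) -> ~ ext_vanish_at o nA DA d ->
  exists2 i, (i <= d)%N & ~ ext_vanish_at (opp_sym o) nB DB i.
Proof.
move=> fl van nvan; apply: contrapT => H.
have vanB i : (i <= d)%N -> ext_vanish_at (opp_sym o) nB DB i.
  by move=> id; apply: contrapT => nv; apply: H; exists i.
have [k [ks kP]] := ext_class_ex o nA DA d.
have ex : exists x : Ext (op_l o) nA d DA, x != 0.
  by apply: contrapT => nex; apply/nvan/ext_vanish_atP.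
have [u ui] := finite_length_socle JB1 JBunit fl ex.
have [m mP] : exists m : {linear Ext (op_l o) nA d DA -> xmod o (rd nA DA) d},
    forall v, m (k v) = lcomp (xproj o (rd nA DA) d) (sm_incl _) v.
  by apply: surj_factor => // v /kP Sv; rewrite lcompE; apply/xproj_eq0.
have [x x0] := resD_neq0 nB JB1; apply: x0; apply: ui; rewrite linear0.
have [v vu] := ks (u x); rewrite -vu; apply/kP/xproj_eq0.
rewrite -[LHS]mP vu.
apply: (hom_xmod_eq0 (@rd_exact _ nA DA) (N := d) van (L := DB) (lcomp m u) (leqnn d)).
  by apply: (ext_vanish_at_upto (o := opp_sym o) (nA := nB) (M := DB) (m := 0)) => i /andP[_]; exact: vanB.
exact: (ext_vanish_at_hom (o := opp_sym o) (nA := nB) (M := DB) (vanB 0%N isT)).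
Qed.

End DepthComparison.

(** * Cosyzygies *)


(* [cosyz n M]: there are short exact sequences 0 -> M_i -> F_i -> M_(i+1) -> 0
   for i < n, with M_0 = M, F_i free and Ext^1(M_(i+1), A) = 0. *)
Fixpoint cosyz (A : nzRingType) (n : nat) (M : lmodType A) : Prop :=
  if n is m.+1 then
    exists k (M' : lmodType A) (a : {linear M -> 'rV[A]_k}) (q : {linear 'rV[A]_k -> M'}),
      [/\ ses a q, extends a A^o & cosyz m M']
  else True.

Section Bilinear.
Variables (A B : nzRingType) (o : opp_pair A B).
Implicit Types (M : lmodType A) (V : lmodType B).

Let os := opp_sym o.

(* A pairing [M x V -> A] through which V is identified with the dual of M. *)
Record dpair M V := Dpair {
  dp :> M -> V -> A;
  dp_lin_l : forall v, linear (fun m => dp m v : A^o);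
  dp_lin_r : forall m, linear (fun v => op_r o (dp m v) : B^o);
  dp_nondeg : forall v, (forall m, dp m v = 0) -> v = 0;
  dp_full : forall f : {linear M -> A^o}, exists v, forall m, f m = dp m v }.

Definition dp_faithful M V (b : dpair M V) :=
  forall m, (forall v, b m v = 0) -> m = 0.

(** This identifies [M] with the dual of [V]; as [V] is the dual of [M], it is reflexivity. *)
Definition dp_reflexive M V (b : dpair M V) :=
  dp_faithful b /\ forall f : {linear V -> B^o}, exists m, forall v, f v = op_r o (b m v).

(** The dual of [p] embeds [M] in a free module, and its cokernel [M'] is paired with [V'] by
    evaluation. A functional on [M] is an element of [V], so it extends by lifting along [p]. If the
    old pairing is reflexive, an element of the free module orthogonal to [V'] comes from [M]; if
    moreover Ext^1(V, B) = 0, functionals on [V'] extend and the new pairing is reflexive. *)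
Lemma dpair_step M V V' k (b : dpair M V) (i : {linear V' -> 'rV[B]_k})
    (p : {linear 'rV[B]_k -> V}) :
  ses i p -> dp_faithful b ->
  exists (M' : lmodType A) (a : {linear M -> 'rV[A]_k}) (q : {linear 'rV[A]_k -> M'})
    (b' : dpair M' V'),
    [/\ ses a q, extends a A^o, dp_reflexive b -> dp_faithful b'
      & dp_reflexive b -> extends i B^o -> dp_reflexive b'].
Proof.
move=> [ii ps e] bf.
have /choice[a aP] m : exists x : 'rV[A]_k, forall y, b m (p y) = pairing o x y.
  have [x xP] := functional_pairing os (lcomp (mklin (dp_lin_r b m)) p).
  exists x => y; apply: (can_inj (op_rK o)).
  by rewrite -pairing_sym -xP.
have aL : linear a.
  move=> c m m'; apply: (pairing_nondeg_l (o := o)) => y.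
  rewrite pairingDl pairingZl -!aP.
  exact: (linearP (mklin (dp_lin_l b (p y)))).
pose al : {linear M -> 'rV[A]_k} := mklin aL.
have alP m y : pairing o (al m) y = b m (p y) by rewrite aP.
have ai : injective al.
  apply: lin_inj => m am0; apply: bf => v; have [y <-] := ps v.
  by rewrite -alP am0 pairing0l.
pose M' : lmodType A := quo (sm_im al).
pose q : {linear 'rV[A]_k -> M'} := quo_proj (sm_im al).
have [_ qs qe] := ses_coker ai.
have /choice[s sP] := qs.
pose th (m : M') (v : V') := pairing o (s m) (i v).
have thE x v : th (q x) v = pairing o x (i v).
  rewrite /th; apply/eqP; rewrite -subr_eq0 -pairingBl; apply/eqP.
  have /qe[m <-] : q (s (q x) - x) = 0 by rewrite linearB sP subrr.
  rewrite alP; have -> : p (i v) = 0 by apply/e; exists v.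
  by apply: (can_inj (op_rK o)); rewrite op0; exact: (linear0 (mklin (dp_lin_r b m))).
have th_l v : linear (fun m => th m v : A^o).
  move=> c m m'; have [[x <-] [x' <-]] := (qs m, qs m').
  by rewrite -linearP !thE pairingDl pairingZl.
have th_r m : linear (fun v => op_r o (th m v) : B^o).
  move=> c v v'; rewrite /th linearP -!pairing_sym.
  by rewrite pairingDl pairingZl.
have th_n v : (forall m, th m v = 0) -> v = 0.
  move=> v0; apply: ii; rewrite linear0; apply: (pairing_nondeg_r (o := o)) => x.
  by rewrite -thE v0 pairing0r.
have th_f (f : {linear M' -> A^o}) : exists v, forall m, f m = th m v.
  have [y yP] := functional_pairing o (lcomp f q).
  have /e[v vy] : p y = 0.
    apply: (dp_nondeg (d := b)) => m; rewrite -alP -yP lcompE.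
    have -> : q (al m) = 0 by apply/qe; exists m.
    exact: linear0.
  by exists v => m; have [x <-] := qs m; rewrite thE vy -yP.
have faith' : dp_reflexive b -> dp_faithful (Dpair th_l th_r th_n th_f).
  move=> [_ br] m m0; have [x xm] := qs m; rewrite -xm.
  have [f fP] : exists f : {linear V -> B^o}, forall y, f (p y) = pairing_lin os x y.
    apply: surj_factor => // y /e[v <-].
    rewrite -[LHS]/(pairing os (i v) x) pairing_sym -thE xm.
    by rewrite [th _ _]m0 op0.
  have [m' m'P] := br f; apply/qe; exists m'.
  apply: (pairing_nondeg_l (o := o)) => y; rewrite alP.
  by apply: (can_inj (op_rK o)); rewrite -m'P fP -pairing_sym.
exists M', al, q, (Dpair th_l th_r th_n th_f); split=> //.
- by move=> f; have [v vP] := dp_full b f; have [y yv] := ps v;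
    exists (pairing_lin o y) => m; rewrite vP -yv -alP.
- move=> br ext; split; first exact: faith'.
  move=> f; have [g gP] := ext f; have [x xP] := functional_pairing os g.
  by exists (q x) => v; rewrite /= thE -pairing_sym -xP.
Qed.

Lemma fg_kernel (nB : noetherian B) V V' k (i : {linear V' -> 'rV[B]_k})
    (p : {linear 'rV[B]_k -> V}) :
  ses i p -> exists l (p' : {linear 'rV[B]_l -> V'}), surj p'.
Proof.
move=> [ii ps e]; have [l [g gP]] := sub_free_fg nB (sm_ker p).
have [p' p'P] : exists p' : {linear 'rV[B]_l -> V'}, forall x, i (p' x) = g x.
  by apply: inj_factor => // x; apply/e/(gP (g x)); exists x.
exists l, p' => v; have [x ext_vanish_upto] : exists x, g x = i v by apply/gP/e; exists v.
by exists x; apply: ii; rewrite p'P.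
Qed.

Lemma dpair_cosyz1 M V k (b : dpair M V) (p : {linear 'rV[B]_k -> V}) :
  dp_faithful b -> surj p -> cosyz 1 M.
Proof.
move=> bf ps; have [M' [a [q [b' [s ext _ _]]]]] := dpair_step (ses_ker ps) bf.
by exists k, M', a, q.
Qed.

(** A faithful pairing allows one step and a reflexive one two; each vanishing Ext of [V] preserves
    reflexivity once more, whence [n.+2]. *)
Lemma dpair_cosyz (nB : noetherian B) n M V k (b : dpair M V)
    (p : {linear 'rV[B]_k -> V}) :
  dp_reflexive b -> surj p -> ext_vanish_upto n V -> cosyz n.+2 M.
Proof.
elim: n M V k b p => [|n IHn] M V k b p br ps.
  move=> _; have [M' [a [q [b' [s ext bf' _]]]]] := dpair_step (ses_ker ps) br.1.
  have [l [p' ps']] := fg_kernel nB (ses_ker ps).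
  exists k, M', a, q; split=> //; exact: dpair_cosyz1 (bf' br) ps'.
move=> [k' [V' [i [p' [s' ext' x']]]]].
have [M' [a [q [b' [s ext _ br']]]]] := dpair_step s' br.1.
have [l [p'' ps'']] := fg_kernel nB s'.
by exists k', M', a, q; split=> //; apply: (IHn _ _ _ b' p'') => //; apply: br'.
Qed.

End Bilinear.

Section CosyzygyResidue.
Variables (A B : nzRingType) (o : opp_pair A B) (nA : noetherian A) (nB : noetherian B).
Variables (JA : submod A^o) (JB : submod B^o).
Hypotheses (JA1 : ~ JA 1) (JAunit : forall x : A, ~ JA x -> exists y, y * x = 1).
Hypotheses (JB1 : ~ JB 1) (JBunit : forall x : B, ~ JB x -> exists y, y * x = 1).

Let DA := resD nA JA.
Let DB := resD nB JB.
Let os := opp_sym o.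

Section Pairing.
Variables (M : fpmod A) (d : nat).
Let V := ext_cocycles o nA M d.

(** Omega^d M is the cokernel of the differential into P_d, so its dual is the kernel of the
    transposed differential. *)
Lemma omega_dpair : exists b : dpair o (fpow (Omega nA) d M) V,
  forall x v, b (raug nA M d x) v = pairing o x (sm_incl _ v).
Proof.
have rs : surj (raug nA M d) by exact: aug_surj.
have [_ _ re] := rses nA M d.
have /choice[s sP] := rs.
pose th m (v : V) := pairing o (s m) (sm_incl _ v).
have thE x v : th (raug nA M d x) v = pairing o x (sm_incl _ v).
  apply/eqP; rewrite -subr_eq0 -pairingBl; apply/eqP.
  have /re[w wP] : raug nA M d (s (raug nA M d x) - x) = 0 by rewrite linearB sP subrr.
  have [w' w'w] := @aug_surj _ _ w.
  have -> : s (raug nA M d x) - x = rd nA M d w' by rewrite -wP -w'w.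
  by rewrite pairing_transp (sm_inclP v : transp o (rd nA M d) _ = 0) pairing0r.
unshelve eexists (@Dpair _ _ o _ _ th _ _ _ _).
- move=> v c m m'; have [[x <-] [x' <-]] := (rs m, rs m').
  by rewrite -linearP !thE pairingDl pairingZl.
- move=> m c v v'; rewrite /th linearP -!pairing_sym.
  by rewrite pairingDl pairingZl.
- move=> v v0; apply: (@sm_incl_inj _ _ (sm_ker (transp o (rd nA M d)))); rewrite linear0.
  by apply: (pairing_nondeg_r (o := o)) => x; rewrite -thE v0 pairing0r.
- move=> f; have [y yP] := functional_pairing o (lcomp f (raug nA M d)).
  have y0 : transp o (rd nA M d) y = 0.
    apply: (pairing_nondeg_r (o := o)) => x.
    rewrite pairing0r -pairing_transp -yP lcompE rdE (ses0 (rses nA M d)).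
    exact: linear0.
  exists (sm_mk (S := sm_ker (transp o (rd nA M d))) y0) => m; have [x <-] := rs m.
  by rewrite thE -yP.
- exact: thE.
Qed.

End Pairing.

Lemma cosyz_omega_residue d :
  (forall i, (i < d)%N -> ext_vanish_at o nA DA i) -> ~ ext_vanish_at o nA DA d ->
  finite_length (Ext (op_l o) nA d DA) ->
  (forall i, (i < d)%N -> ext_vanish_at os nB DB i) ->
  cosyz d.+1 (fpow (Omega nA) d DA).
Proof.
move=> van nvan fl vanB.
have fgV e : exists l (p : {linear 'rV[B]_l -> ext_cocycles o nA DA e}), surj p.
  have [l [g gP]] := sub_free_fg nB (sm_ker (transp o (rd nA DA e))).
  have gS x : sm_ker (transp o (rd nA DA e)) (g x) by apply/gP; exists x.
  exists l, (sm_corestr gS) => v; have [x ext_vanish_upto] := (gP _).1 (sm_inclP v).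
  by exists x; apply: (@sm_incl_inj _ _ (sm_ker (transp o (rd nA DA e)))).
have [l [p ps]] := fgV d; case: d van nvan fl vanB l p ps => [|d] van nvan fl vanB l p ps.
  (* In depth zero a single step is wanted, so faithfulness suffices: a nonzero element killed by
     all functionals generates the simple module and would make every cocycle zero. *)
  have [b bE] := omega_dpair DA 0.
  apply: (dpair_cosyz1 (b := b) (p := p)) => // m m0.
  have [x xm] := @aug_surj _ _ m; rewrite -xm; apply/raug_exact.
  apply: contrapT => nx; apply: nvan => y yK.
  apply: (pairing_nondeg_r (o := o)) => w.
  have [a [z ->]] := resD_simple_coker JAunit nx w.
  have := bE x (sm_mk (S := sm_ker (transp o (rd nA DA 0))) yK).
  rewrite [raug _ _ _ x]xm m0 => xy.
  by rewrite pairing0r pairingDl pairingZl -[pairing o x y]xy pairing_transp yK pairing0r mulr0 addr0.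
(* From here the depth is [d.+1]; [g] and [k] below make [V] an extension of [E] by X_d. *)
pose V := ext_cocycles o nA DA d.+1; pose E := Ext (op_l o) nA d.+1 DA.
have [b bE] := omega_dpair DA d.+1.
have xE : ext_vanish_upto d E.
  apply: (finite_length_ext_vanish_upto JB1 JBunit) fl.
  by apply: (ext_vanish_at_upto (o := os) (nA := nB) (M := DB) (m := 0)) => i /andP[_]; apply: vanB.
have hE : forall (f : {linear E -> B^o}) x, f x = 0.
  apply: (finite_length_hom JB1 JBunit) fl.
  exact: (ext_vanish_at_hom (o := os) (nA := nB) (M := DB) (vanB 0%N isT)).
have [k [ks kP]] := ext_class_ex o nA DA d.+1.
have dx := @rd_exact _ nA DA.
have [g gP] : exists g : {linear xmod o (rd nA DA) d -> V},
    forall x, sm_incl _ (g x) = xinc o dx d x.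
  apply: inj_factor => [|x]; first exact: sm_incl_inj.
  have [y yx] := xproj_surj x.
  have Kx : sm_ker (transp o (rd nA DA d.+1)) (xinc o dx d x).
    by rewrite -yx xincE; apply: transp_dd.
  by exists (sm_mk Kx).
have [xi _ xe] := xses dx van (ltnSn d).
have sg : ses g k.
  split=> // [|v].
    by apply: lin_inj => x gx; apply: xi; rewrite -gP gx !linear0.
  rewrite kP -xproj_eq0 xe; split=> [[x ext_vanish_upto]|[x <-]]; exists x => //.
  by apply: (@sm_incl_inj _ _ (sm_ker (transp o (rd nA DA d.+1)))); rewrite gP.
have [_ _ ge] := sg.
have [[h hP]|[xV Vf]] := xmod_extension (dex := dx) van (resD_simple_coker JAunit)
    (e := sm_incl _) (leqnSn d) sg gP xE.
  (* Were X_d a summand of [V], the complement would give a map [w] from [E] into a free module;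
     since Hom(E, B) = 0 it vanishes, and then every cocycle is a coboundary. *)
  case: nvan => y yK; pose v : V := sm_mk (S := sm_ker (transp o (rd nA DA d.+1))) yK.
  apply/(kP v); rewrite -[RHS](ses0 sg (h v)); congr (k _).
  have [w wP] : exists w : {linear E -> V}, forall v, w (k v) = (lid V \- lcomp g h) v.
    apply: surj_factor => // u /ge[x <-].
    by rewrite -[LHS]/(g x - g (h (g x))) hP subrr.
  have w0 u : w u = 0.
    apply: (@sm_incl_inj _ _ (sm_ker (transp o (rd nA DA d.+1)))); rewrite linear0.
    exact: (hom_free_eq0 (lcomp (sm_incl _) w) hE).
  by apply/eqP; rewrite -subr_eq0 -[X in X == 0](wP v) w0.
apply: (dpair_cosyz nB (b := b) (p := p)) => //; split=> [m m0|f].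
  have [x xm] := @aug_surj _ _ m; rewrite -xm.
  have x0 : rd nA DA d x = 0.
    apply: (pairing_nondeg_l (o := o)) => z; rewrite pairing0l pairing_transp.
    have zK := transp_dd o dx z.
    by have := bE x (sm_mk (S := sm_ker (transp o (rd nA DA d.+1))) zK); rewrite [raug _ _ _ x]xm m0.
  by have [ri _ _] := rses nA DA d; apply: ri; rewrite linear0 -x0 rdE.
(* On X_d the functional [f] is evaluation at [z]; the difference is a functional on [E], hence
   zero. *)
have [z zP] := Vf f.
have [w wP] : exists w : {linear E -> B^o},
    forall v, w (k v) = (f \- lcomp (pairing_lin os z) (sm_incl _)) v.
  apply: surj_factor => // v /ge[x <-]; have [y <-] := xproj_surj x.
  rewrite -[LHS]/(f (g (xproj o (rd nA DA) d y)) - pairing os (sm_incl _ (g (xproj o (rd nA DA) d y))) z).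
  by rewrite zP gP xincE [X in _ - X]pairing_transp transpK subrr.
exists (raug nA DA d.+1 z) => v; rewrite bE -pairing_sym.
by apply/eqP; rewrite -subr_eq0 -[X in X == 0](wP v) hE.
Qed.

End CosyzygyResidue.

(** * Stable categories *)


Section Stable.
Variable A : nzRingType.
Implicit Types X Y Z W : fpmod A.

Lemma lcompA (U V W X : lmodType A) (h : {linear W -> X}) (g : {linear V -> W})
  (f : {linear U -> V}) : lcomp h (lcomp g f) = lcomp (lcomp h g) f.
Proof. exact: linear_eqP. Qed.

Lemma lcomp1l (U V : lmodType A) (f : {linear U -> V}) : lcomp (lid V) f = f.
Proof. exact: linear_eqP. Qed.

Lemma lcomp1r (U V : lmodType A) (f : {linear U -> V}) : lcomp f (lid U) = f.
Proof. exact: linear_eqP. Qed.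

Lemma stable_free X Y (f g : {linear X -> Y}) n (a : {linear X -> 'rV[A]_n})
  (b : {linear 'rV[A]_n -> Y}) : (forall x, f x - g x = b (a x)) -> stable_eq f g.
Proof. by move=> fg; exists (free_mod A n), a, b; split=> //; exact: free_projective. Qed.

Lemma stable_compl X Y Z (g : {linear Y -> Z}) (f f' : {linear X -> Y}) :
  stable_eq f f' -> stable_eq (lcomp g f) (lcomp g f').
Proof.
move=> [P [a [b [pP ff]]]]; exists P, a, (lcomp g b); split=> // x.
by rewrite !lcompE -ff linearB.
Qed.

Lemma stable_compr X Y Z (g g' : {linear Y -> Z}) (f : {linear X -> Y}) :
  stable_eq g g' -> stable_eq (lcomp g f) (lcomp g' f).
Proof.
move=> [P [a [b [pP ff]]]]; exists P, (lcomp a f), b; split=> // x.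
by rewrite !lcompE -ff.
Qed.

Lemma stable_compE X Y Z (g g' : {linear Y -> Z}) (f f' : {linear X -> Y}) :
  stable_eq g g' -> stable_eq f f' -> stable_eq (lcomp g f) (lcomp g' f').
Proof.
by move=> gg ff; apply: stable_trans (stable_compr _ gg) (stable_compl _ ff).
Qed.

Definition stable_inv X Y (f : {linear X -> Y}) (g : {linear Y -> X}) :=
  stable_eq (lcomp g f) (lid X) /\ stable_eq (lcomp f g) (lid Y).

Lemma stable_cancel X Y Z (f : {linear X -> Y}) g (h : {linear X -> Z}) :
  stable_inv f g -> stable_eq (lcomp (lcomp h g) f) h.
Proof.
move=> [gf _]; rewrite -lcompA -{2}(lcomp1r h); exact: stable_compl.
Qed.

Lemma stable_inv_sym X Y (f : {linear X -> Y}) g : stable_inv f g -> stable_inv g f.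
Proof. by case. Qed.

Lemma stable_inv_comp X Y Z (f : {linear X -> Y}) f' (g : {linear Y -> Z}) g' :
  stable_inv f f' -> stable_inv g g' -> stable_inv (lcomp g f) (lcomp f' g').
Proof.
move=> ff gg; split.
  apply: stable_trans ff.1; rewrite lcompA; apply: stable_compr.
  exact: (stable_cancel _ gg).
apply: stable_trans gg.2; rewrite lcompA; apply: stable_compr.
exact: (stable_cancel _ (stable_inv_sym ff)).
Qed.

End Stable.

(** * Fullness and the invertibility of units *)

Section Functor.
Variables (A B : nzRingType) (F : sfunctor A B).

Lemma fmor_inv (X Y : fpmod A) (f : {linear X -> Y}) g :
  stable_inv f g -> stable_inv (fmor F f) (fmor F g).
Proof.
move=> [gf fg]; split; apply: stable_trans (fmor_id F _);
  by apply: stable_trans (stable_sym (fmor_comp F _ _)) _; apply: fmor_eq.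
Qed.

Definition full_at (S : fpmod A) := forall (Y : fpmod A) (h : {linear F S -> F Y}),
  exists g : {linear S -> Y}, stable_eq (fmor F g) h.

Lemma full_at_iso (S S' : fpmod A) (f : {linear S -> S'}) g :
  stable_inv f g -> full_at S -> full_at S'.
Proof.
move=> fg FS Y h; have [k kP] := FS Y (lcomp h (fmor F f)).
exists (lcomp k g); apply: stable_trans (fmor_comp F _ _) _.
apply: stable_trans (stable_compr _ kP) _.
exact: (stable_cancel _ (stable_inv_sym (fmor_inv fg))).
Qed.

End Functor.

Section Unit.
Variables (A B : nzRingType) (F : sfunctor A B) (G : sfunctor B A) (a : adjunction F G).

Lemma adj_comp (X : fpmod A) (Y Y' : fpmod B) (f : {linear F X -> Y}) (g : {linear Y -> Y'}) :
  stable_eq (adj a (lcomp g f)) (lcomp (fmor G g) (adj a f)).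
Proof.
have := adj_nat a (lid X) f g; rewrite lcomp1r; apply: stable_trans.
apply/adj_eq/stable_compl; rewrite -{1}(lcomp1r f); apply: stable_compl.
exact/stable_sym/fmor_id.
Qed.

(** Let [u] be the adjunct of [f]. Fullness gives [v] with G v = e g, and injectivity of the
    adjunction gives v u = 1; hence [lcomp g (fmor G u)] inverts the unit [e]. *)
Lemma adj_unit_iso (X : fpmod A) (S : fpmod B) (f : {linear X -> G S}) g :
  stable_inv f g -> full_at G S -> stable_iso (adj_unit a X).
Proof.
move=> fg GS; set e := adj_unit a X.
have [u uf] := adj_surj a f.
have uE : stable_eq (lcomp (fmor G u) e) f.
  apply: stable_trans uf; apply: stable_sym; apply: stable_trans (adj_comp _ _).
  by rewrite lcomp1r; apply: stable_refl.
have [v vE] := GS _ (lcomp e g).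
have vu : stable_eq (lcomp v u) (lid (F X)).
  apply/(adj_eq a); rewrite -{1}(lcomp1r u) lcompA.
  apply: stable_trans (adj_comp _ _) _.
  apply: stable_trans (stable_compr _ (fmor_comp G _ _)) _.
  rewrite -lcompA; apply: stable_trans (stable_compE vE uE) _.
  exact: stable_cancel fg.
exists (lcomp g (fmor G u)); split.
  by rewrite -lcompA; apply: stable_trans (stable_compl _ uE) fg.1.
rewrite lcompA; apply: stable_trans (stable_compr _ (stable_sym vE)) _.
apply: stable_trans (stable_sym (fmor_comp G _ _)) _.
by apply: stable_trans (fmor_id G _); apply: fmor_eq.
Qed.

End Unit.

Section OmegaFull.
Variables (A : nzRingType) (nA : noetherian A).
Let Om := Omega nA.

Section Step.
Variables (M M' : fpmod A) (k : nat) (a : {linear M -> 'rV[A]_k}) (q : {linear 'rV[A]_k -> M'}).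
Hypothesis s : ses a q.

(** Schanuel's lemma: lifts in both directions between [q] and the chosen cover of [M'] induce
    stably inverse maps on kernels. *)
Lemma cosyz_step_iso : exists (f : {linear M -> syz nA M'}) (g : {linear syz nA M' -> M})
  (G : {linear cover0 M' -> 'rV[A]_k}), [/\ stable_inv f g, forall x, q (G x) = aug M' x
   & forall x, a (g x) = G (syz_incl nA M' x)].
Proof.
have [ai qs e] := s; have [ii as_ ie] : ses (syz_incl nA M') (aug M') by exact: ses_ker (@aug_surj _ _).
have [F FP] := free_projective (n := k) q as_.
have [G GP] := free_projective (n := p_n (pres M')) (aug M') qs.
have [f fP] : exists f : {linear M -> syz nA M'}, forall x, syz_incl nA M' (f x) = lcomp F a x.
  by apply: inj_factor => // x; apply/ie; rewrite lcompE FP (ses0 s).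
have [g gP] : exists g : {linear syz nA M' -> M}, forall x, a (g x) = lcomp G (syz_incl nA M') x.
  by apply: inj_factor => // x; apply/e; rewrite lcompE GP syz_inclP.
exists f, g, G; split=> //; split.
  have [h hP] : exists h : {linear 'rV[A]_k -> M}, forall x, a (h x) = (lcomp G F \- lid _) x.
    apply: inj_factor => // x; apply/e.
    by rewrite -[X in q X]/(G (F x) - x) linearB GP FP subrr.
  apply: (stable_free (a := a) (b := h)) => x; apply: ai.
  by rewrite linearB lcompE gP lcompE fP hP.
have [h hP] : exists h : {linear cover0 M' -> syz nA M'},
    forall x, syz_incl nA M' (h x) = (lcomp F G \- lid _) x.
  apply: inj_factor => // x; apply/ie.
  by rewrite -[X in aug M' X]/(F (G x) - x) linearB FP GP subrr.
apply: (@stable_free _ _ _ _ _ (p_n (pres M')) (syz_incl nA M') h) => x; apply: ii.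
by rewrite linearB lcompE fP lcompE gP hP.
Qed.

(** A map Omega M' -> Omega Y becomes a map from [M] to the cover of [Y]; since Ext^1(M', A) = 0 it
    extends to the free module containing [M], and the induced map on cokernels is the preimage. *)
Lemma cosyz_step_full : extends a A^o -> full_at Om M'.
Proof.
move=> ext Y h; have [f [g [G [fg qG ag]]]] := cosyz_step_iso.
have [psi psiP] := extends_free (n := p_n (pres Y)) ext (lcomp (syz_incl nA Y) (lcomp h f)).
have [_ qs e] := s.
have [u uP] : exists u : {linear M' -> Y}, forall x, u (q x) = lcomp (aug Y) psi x.
  apply: surj_factor => // x /e[m <-].
  by rewrite lcompE psiP; exact: syz_inclP.
exists u; apply: (@stable_trans _ _ _ (lcomp (lcomp h f) g)); last first.
  exact: (stable_cancel _ (stable_inv_sym fg)).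
apply: syz_lift_eq (stable_refl u) (syz_mapP nA u) _.
exists (lcomp psi G); split=> x; first by rewrite lcompE -[RHS]/(u (aug M' x)) -qG uP.
by rewrite -[RHS]/(psi (G (syz_incl nA M' x))) -ag psiP.
Qed.

End Step.

(** A morphism out of Omega^(n+1) S is lifted first through Omega, then through Omega^n; fullness of
    Omega at [M'] is transported to Omega^n S along their stable isomorphism. *)
Lemma cosyz_full n (M : fpmod A) : cosyz n M ->
  exists (S : fpmod A) (f : {linear M -> fpow Om n S}) (g : {linear fpow Om n S -> M}),
    stable_inv f g /\ full_at (fpow Om n) S.
Proof.
elim: n M => [|n IHn] M.
  move=> _; exists M, (lid M), (lid M); split; last by move=> Y h; exists h; apply: stable_refl.
  by split; rewrite lcomp1r; apply: stable_refl.
move=> [k [M1 [a [q [s ext cM]]]]]; have [_ qs _] := s.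
pose M' := FpMod (fg_fp nA qs).
have [S [f [g [fg Sfull]]]] := IHn M' cM.
have [f0 [g0 [G [fg0 _ _]]]] := @cosyz_step_iso M M' k a q s.
exists S, (lcomp (fmor Om f) f0), (lcomp g0 (fmor Om g)); split.
  exact: stable_inv_comp fg0 (fmor_inv Om fg).
move=> Y h; have OmS := full_at_iso fg (@cosyz_step_full M M' k a q s ext).
have [h1 h1P] := OmS _ h; have [h2 h2P] := Sfull _ h1.
by exists h2; apply: stable_trans h1P; apply: (fmor_eq Om).
Qed.

End OmegaFull.

(** * Projective dimension *)


Section ProjectiveDimension.
Variable A : nzRingType.
Implicit Types Z F Q : lmodType A.

Lemma projective_retract Z Q (s : {linear Z -> Q}) (p : {linear Q -> Z}) :
  projective Q -> (forall x, p (s x) = x) -> projective Z.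
Proof.
move=> pQ ps U V g f gs; have [h hP] := pQ U V g (lcomp f p) gs.
by exists (lcomp h s) => x; rewrite lcompE hP lcompE ps.
Qed.

Lemma has_resolution0 Z : projective Z -> has_resolution Z 0.
Proof.
move=> pZ; exists (fun i => if i is _.+1 then 'rV[A]_0 : lmodType A else Z), (fun i => \0), (lid Z).
split=> //.
- by case=> // i; apply: free_projective.
- by move=> x; exists x.
- by move=> x; split=> [x0|[y <-]] //; exists 0; exact: (esym x0).
- by move=> i x; split=> // _; exists 0; rewrite [x]thinmx0.
- by case=> // i _ x; rewrite [x]thinmx0.
Qed.

Lemma has_resolutionS Z' F Z (i : {linear Z' -> F}) (p : {linear F -> Z}) n :
  ses i p -> projective F -> has_resolution Z' n -> has_resolution Z n.+1.
Proof.
move=> [ii ps e] pF [P [d [f [Pp fs f0 dex Pn]]]].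
pose P' j : lmodType A := if j is k.+1 then P k else F.
pose d' j : {linear P' j.+1 -> P' j} :=
  match j return {linear P' j.+1 -> P' j} with 0 => lcomp i f | k.+1 => d k end.
exists P', d', p; split=> //.
- by case.
- move=> x; rewrite e; split=> [[y <-]|[y <-]]; last by exists (f y).
  by have [z <-] := fs y; exists z.
- case=> [|j] x; last exact: dex.
  rewrite -[_ <-> _]/(i (f x) = 0 <-> exists y, d 0%N y = x) -f0.
  by split=> [|->]; rewrite ?linear0 // => ix; apply: ii; rewrite linear0.
- by case=> // j; apply: Pn.
Qed.

(** Quantifying over all covers makes it applicable to the chosen syzygies. *)
Fixpoint projdim_le n Z : Prop :=
  if n is m.+1 then
    forall Z' F (i : {linear Z' -> F}) (p : {linear F -> Z}), ses i p -> projective F -> projdim_le m Z'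
  else projective Z.

(** The equation makes [Z2] a stable retract of [Z]. This relation passes to the kernels of two
    different projective covers, so the induction compares the given resolution with arbitrary
    syzygies. *)
Lemma has_resolution_projdim_le n Z Z2 Q (s : {linear Z2 -> Z}) (t : {linear Z -> Z2})
    (a : {linear Z2 -> Q}) (b : {linear Q -> Z2}) :
  has_resolution Z n -> projective Q -> (forall x, x = t (s x) + b (a x)) -> projdim_le n Z2.
Proof.
elim: n Z Z2 Q s t a b => [|n IHn] Z Z2 Q s t a b [P [d [e [Pp es e0 dex Pn]]]] pQ st.
  have [s0 s0P] : exists s0 : {linear Z -> P 0%N}, forall x, s0 (e x) = lid _ x.
    by apply: surj_factor => // x /e0[y <-]; rewrite (Pn 1%N isT y) linear0.
  have pZ : projective Z.
    apply: (projective_retract (s := s0) (p := e)) => // x.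
    by have [y <-] := es x; rewrite s0P.
  move=> U V g f gs; have [h1 h1P] := pZ _ _ g (lcomp f t) gs.
  have [h2 h2P] := pQ _ _ g (lcomp f b) gs.
  exists (lcomp h1 s \+ lcomp h2 a) => x.
  by rewrite -[X in g X]/(h1 (s x) + h2 (a x)) linearD h1P h2P [in RHS](st x) linearD.
move=> Z' F i p [ii ps pe] pF.
have [ki _ ke] := ses_ker es; set j := sm_incl _ in ki ke.
have [e' e'P] : exists e' : {linear P 1%N -> subm (sm_ker e)}, forall x, j (e' x) = d 0%N x.
  by apply: inj_factor => // x; apply/ke/e0; exists x.
have rK : has_resolution (subm (sm_ker e)) n.
  exists (fun i => P i.+1), (fun i => d i.+1), e'; split=> //.
  - by move=> y; have /e0[x xy] := (ke (j y)).2 (ex_intro _ y erefl); exists x; apply: ki; rewrite e'P.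
  - move=> x; rewrite -dex -e'P; split=> [->|jx]; first exact: linear0.
    by apply: ki; rewrite linear0.
  - by move=> k nk; apply: Pn.
have [S SP] := pF _ _ e (lcomp s p) es.
have [T TP] := Pp 0%N _ _ p (lcomp t e) ps.
have [c cP] := pQ _ _ p b ps.
have [S' S'P] : exists S' : {linear Z' -> subm (sm_ker e)}, forall x, j (S' x) = lcomp S i x.
  apply: inj_factor => // x; apply/ke.
  by rewrite lcompE SP lcompE (pe (i x)).2 ?linear0 //; exists x.
have [T' T'P] : exists T' : {linear subm (sm_ker e) -> Z'}, forall x, i (T' x) = lcomp T j x.
  apply: inj_factor => // x; apply/pe.
  by rewrite lcompE TP lcompE (ke (j x)).2 ?linear0 //; exists x.
have [h hP] : exists h : {linear F -> Z'},
    forall x, i (h x) = ((lid F \- lcomp T S) \- lcomp c (lcomp a p)) x.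
  apply: inj_factor => // x; apply/pe.
  rewrite -[X in p X]/(x - T (S x) - c (a (p x))) !linearB TP lcompE SP cP.
  by rewrite {1}(st (p x)) lcompE -addrA -opprD subrr.
apply: (IHn _ _ _ S' T' i h rK pF) => x; apply: ii.
rewrite linearD T'P lcompE S'P lcompE hP.
rewrite -[X in _ = _ + X]/(i x - T (S (i x)) - c (a (p (i x)))) (pe (i x)).2; last by exists x.
by rewrite (linear0 a) (linear0 c) subr0 addrC subrK.
Qed.

Lemma has_resolution_projdim_le_id n Z : has_resolution Z n -> projdim_le n Z.
Proof.
move=> H; apply: (has_resolution_projdim_le (s := lid Z) (t := lid Z) (Q := 'rV[A]_0) (a := \0) (b := \0) H).
  exact: free_projective.
by move=> x /=; rewrite addr0.
Qed.

Lemma split_projective Z' F Z (i : {linear Z' -> F}) (p : {linear F -> Z}) :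
  ses i p -> projective F -> projective Z ->
  exists h : {linear F -> Z'}, forall x, h (i x) = x.
Proof.
move=> [ii ps e] pF pZ; have [s sP] := pZ _ _ p (lid Z) ps.
have [h hP] : exists h : {linear F -> Z'}, forall x, i (h x) = (lid F \- lcomp s p) x.
  by apply: inj_factor => // x; apply/e; rewrite -[X in p X]/(x - s (p x)) linearB sP subrr.
exists h => x; apply: ii; rewrite hP -[LHS]/(i x - s (p (i x))) (e (i x)).2; last by exists x.
by rewrite linear0 subr0.
Qed.

Lemma retract_projective Z' F Z (i : {linear Z' -> F}) (p : {linear F -> Z}) (h : {linear F -> Z'}) :
  ses i p -> projective F -> (forall x, h (i x) = x) -> projective Z.
Proof.
move=> [ii ps e] pF hi.
have [s sP] : exists s : {linear Z -> F}, forall x, s (p x) = (lid F \- lcomp i h) x.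
  apply: surj_factor => // x /e[y <-].
  by rewrite -[LHS]/(i y - i (h (i y))) hi subrr.
apply: (projective_retract (s := s) (p := p)) => // z; have [x <-] := ps z.
rewrite sP -[X in p X]/(x - i (h x)) linearB (e (i _)).2 ?subr0 //.
by exists (h x).
Qed.

End ProjectiveDimension.

Section OmegaProjdim.
Variables (A : nzRingType) (nA : noetherian A) (M : fpmod A).
Let Om := Omega nA.

Lemma projdim_le_omega n k : projdim_le n (fpow Om k M) -> projective (fpow Om (n + k) M).
Proof.
elim: n k => // n IHn k H; rewrite addSn -addnS; apply: IHn.
by apply: H (rses nA M k) _; exact: free_projective.
Qed.

Lemma has_resolution_omega n k :
  projective (fpow Om (n + k) M) -> has_resolution (fpow Om k M) n.
Proof.
elim: n k => [|n IHn] k; first exact: has_resolution0.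
rewrite addSn -addnS => /IHn; apply: has_resolutionS (rses nA M k) _.
exact: free_projective.
Qed.

Lemma projdim_omega n : projdim M = Some n <->
  projective (fpow Om n M) /\ forall m, projective (fpow Om m M) -> (n <= m)%N.
Proof.
have E m : has_resolution M m <-> projective (fpow Om m M).
  split=> [/has_resolution_projdim_le_id /(projdim_le_omega (k := 0))|]; first by rewrite addn0.
  by rewrite -{1}(addn0 m) => /has_resolution_omega.
rewrite einf_some E; split=> -[pn nm]; split=> // m /E; exact: nm.
Qed.

End OmegaProjdim.

(** * Projective dimension of the modules X_i *)

Section DualComplexDimension.
Variables (A B : nzRingType) (o : opp_pair A B).
Variables (r : nat -> nat) (d : forall i, {linear 'rV[A]_(r i.+1) -> 'rV[A]_(r i)}).
Hypothesis dex : forall i x, d i x = 0 <-> exists y, d i.+1 y = x.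
Variable N : nat.
Hypothesis coex : forall i, (i < N)%N -> forall y, transp o (d i) y = 0 -> xsub o d i y.
Hypothesis d0_nsurj : ~ surj (d 0).

Let os := opp_sym o.

Lemma xmod0_projective : projective (xmod o d 0).
Proof.
have [s [sx xs]] := xmod0_section o d.
by apply: (projective_retract (s := s) (p := xproj o d 0)) => //; exact: free_projective.
Qed.

(** If X_1 were projective, X_0 -> P_1^* would split, and transposing a retraction would give a
    section of [d 0]. If X_(i+2) were, X_(i+1) would be a summand of a free module. *)
Lemma xmod_nprojective i : (i < N)%N -> ~ projective (xmod o d i.+1).
Proof.
elim: i => [|i IHi] iN pX;
  have [h hP] := split_projective (xses dex coex iN) (@free_projective _ _) pX.
  have [s [sx xs]] := xmod0_section o d; apply: d0_nsurj => x.
  exists (transp os (lcomp s h) x).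
  rewrite -(transpK o (d 0)) -transp_comp -[RHS](transp_id os); apply: transp_eq => y.
  by rewrite !lcompE -(xincE o dex) hP sx.
apply: (IHi (ltnW iN)).
by apply: (projective_retract (s := xinc o dex i.+1) (p := h)) => //; exact: free_projective.
Qed.

Lemma xmod_has_resolution i : (i <= N)%N -> has_resolution (xmod o d i) i.
Proof.
elim: i => [_|i IHi iN]; first exact/has_resolution0/xmod0_projective.
by apply: has_resolutionS (xses dex coex iN) _ (IHi (ltnW iN)); exact: free_projective.
Qed.

Lemma xmod_nprojdim_le m i : (m + i.+1 <= N)%N -> ~ projdim_le m (xmod o d (m + i.+1)).
Proof.
elim: m i => [|m IHm] i mN; first exact: xmod_nprojective.
move=> H; apply: (IHm i (ltnW mN)).
by apply: H (xses dex coex mN) _; exact: free_projective.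
Qed.

Lemma xmod_projdim : projdim (xmod o d N) = Some N.
Proof.
apply/einf_some; split=> [|m /has_resolution_projdim_le_id plm]; first exact: xmod_has_resolution.
rewrite leqNgt; apply/negP => mN.
have E : (m + (N - m).-1.+1)%N = N by rewrite prednK ?subn_gt0 // subnKC // ltnW.
by apply: (@xmod_nprojdim_le m (N - m).-1); rewrite E.
Qed.

End DualComplexDimension.

(** * Finitistic dimension and delooping level *)


Section Nakayama.
Variables (B : nzRingType) (J : submod B^o).
Hypotheses (J1 : ~ J 1) (Junit : forall x : B, ~ J x -> exists y, y * x = 1).

(** Induction on the number of generators. If the first is not redundant, the quotient by the others
    is cyclic and nonzero; the annihilator of its generator lies in [J], as elements outside [J]
    have left inverses, so it maps onto B/J. *)
Lemma residue_quotient k (T : lmodType B) (p : {linear 'rV[B]_k -> T}) :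
  surj p -> (exists x : T, x <> 0) ->
  exists (u : {linear T -> res_mod J}) (x : T), u x <> 0.
Proof.
elim: k T p => [|k IHk] T p ps [t t0].
  by have [x xt] := ps t; case: t0; rewrite -xt [x]thinmx0 linear0.
have [qs|nqs] := pselect (surj (lcomp p (rinr B 1 k))).
  by apply: (IHk T _ qs); exists t.
pose Y := sm_im (lcomp p (rinr B 1 k)); pose e := p (rinl B 1 k (const_mx 1)).
pose v := orbit_map (V := quo Y) (quo_proj Y e).
have vE b : v b = quo_proj Y (b *: e) by rewrite linearZ_LR.
have vs : surj v.
  move=> y; have [z <-] := quo_proj_surj y; have [x <-] := ps z.
  have xE : p x = x 0 0 *: e + p (rinr B 1 k (rprr B 1 k x)).
    rewrite /e -[_ *: p _](linearZ_LR p) -linearD {1}(row_eta (x : 'rV_(1 + k))).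
    congr (p (_ + _)); rewrite -[RHS](linearZ_LR (rinl B 1 k)); congr (rinl B 1 k _).
    apply/rowP => j; rewrite ord1 !mxE mulr1; congr (x _ _); exact: val_inj.
  exists (x 0 0); rewrite vE; apply/quo_pi_eq.
  exists (- rprr B 1 k x); rewrite linearN lcompE xE opprD addrA subrr add0r.
  by [].
have [g gP] : exists g : {linear quo Y -> res_mod J}, forall b, g (v b) = quo_proj J b.
  apply: surj_factor => // b vb; apply/quo_proj_eq0.
  have [//|/Junit[y yb]] := pselect (J b).
  have v1 c : v c = 0.
    by rewrite -[c]mulr1 -yb mulrA -[_ * b]/((c * y : B) *: (b : B^o)) linearZ_LR vb scaler0.
  case: nqs => z; have [c cz] := vs (quo_proj Y z).
  have /quo_proj_eq0[w wz] : quo_proj Y z = 0 by rewrite -cz v1.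
  by exists w.
exists (lcomp g (quo_proj Y)), e; rewrite lcompE -[e]scale1r -vE gP.
by move/quo_proj_eq0.
Qed.

End Nakayama.

(* In this section, maps out of the dual of a free resolution r, d of an
   A-module M play the role of chains of the resolution with coefficients in a
   B-module X: [tor_van j X] expresses that Tor_(j+1)(X, M) = 0. *)
Section TorVanishing.
Variables (A B : nzRingType) (o : opp_pair A B) (nB : noetherian B).
Variables (r : nat -> nat) (d : forall i, {linear 'rV[A]_(r i.+1) -> 'rV[A]_(r i)}).
Hypothesis dex : forall i x, d i x = 0 <-> exists y, d i.+1 y = x.

Let os := opp_sym o.

Definition tor_van j (X : lmodType B) := forall v : {linear 'rV[B]_(r j.+1) -> X},
  (forall y, v (transp o (d j) y) = 0) ->
  exists w : {linear 'rV[B]_(r j.+2) -> X}, forall y, v y = w (transp o (d j.+1) y).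

(** With free coefficients this is exactness of [d], transposed. *)
Lemma tor_van_free j n : tor_van j 'rV[B]_n.
Proof.
move=> v vd.
have [w wP] : exists w : {linear 'rV[A]_n -> 'rV[A]_(r j.+2)}, forall x, d j.+1 (w x) = transp os v x.
  apply: free_lift => x; apply/dex; rewrite -(transpK o (d j)) -transp_comp.
  by apply: transp0 => y; apply: vd.
exists (transp o w) => y; rewrite -(transpK os v) -transp_comp.
by apply: transp_eq => x; rewrite lcompE wP.
Qed.

(** Dimension shifting between Tor_(j+1)(Y, M) and Tor_(j+2)(X, M); [tor_van_cosyz] is the other
    direction. *)
Lemma tor_van_syz j n (Y X : lmodType B) (i : {linear Y -> 'rV[B]_n})
    (p : {linear 'rV[B]_n -> X}) :
  ses i p -> tor_van j.+1 X -> tor_van j Y.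
Proof.
move=> s tX v vd; have [ii ps e] := s.
have [w wP] : exists w : {linear 'rV[B]_(r j.+2) -> 'rV[B]_n}, forall y, lcomp i v y = w (transp o (d j.+1) y).
  by apply: tor_van_free => y; rewrite lcompE vd linear0.
have [z zP] : exists z : {linear 'rV[B]_(r j.+3) -> X}, forall y, lcomp p w y = z (transp o (d j.+2) y).
  by apply: tX => y; rewrite lcompE -wP; apply: (ses0 s).
have [z' z'P] := free_projective z ps.
have [w' w'P] : exists w' : {linear 'rV[B]_(r j.+2) -> Y},
    forall y, i (w' y) = (w \- lcomp z' (transp o (d j.+2))) y.
  apply: inj_factor => // y; apply/e.
  by rewrite -[X in p X]/(w y - z' (transp o (d j.+2) y)) linearB z'P -zP lcompE subrr.
exists w' => y; apply: ii; rewrite w'P -[RHS]/(w _ - z' (transp o (d j.+2) (transp o (d j.+1) y))).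
by rewrite transp_dd // linear0 subr0 -wP.
Qed.

Lemma tor_van_cosyz j n (Y X : lmodType B) (i : {linear Y -> 'rV[B]_n})
    (p : {linear 'rV[B]_n -> X}) :
  ses i p -> tor_van j Y -> tor_van j.+1 X.
Proof.
move=> s tY v vd; have [ii ps e] := s.
have [u uP] := free_projective v ps.
have [v' v'P] : exists v' : {linear 'rV[B]_(r j.+1) -> Y},
    forall y, i (v' y) = lcomp u (transp o (d j.+1)) y.
  by apply: inj_factor => // y; apply/e; rewrite lcompE uP vd.
have [w wP] : exists w : {linear 'rV[B]_(r j.+2) -> Y}, forall y, v' y = w (transp o (d j.+1) y).
  by apply: tY => y; apply: ii; rewrite v'P lcompE transp_dd // !linear0.
have [z zP] : exists z : {linear 'rV[B]_(r j.+3) -> 'rV[B]_n},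
    forall y, (u \- lcomp i w) y = z (transp o (d j.+2) y).
  apply: tor_van_free => y.
  by rewrite -[LHS]/(u (transp o (d j.+1) y) - i (w (transp o (d j.+1) y))) -wP v'P subrr.
exists (lcomp p z) => y; rewrite lcompE -zP -[X in p X]/(u y - i (w y)).
by rewrite linearB uP (ses0 s) subr0.
Qed.

Lemma tor_van_retract j (X X' : fpmod B) (s : {linear X -> X'}) (t : {linear X' -> X}) :
  stable_eq (lcomp t s) (lid X) -> tor_van j X' -> tor_van j X.
Proof.
move=> /stable_eq_free[n [a [b E]]] tX v vd.
have [w wP] : exists w : {linear 'rV[B]_(r j.+2) -> X'}, forall y, lcomp s v y = w (transp o (d j.+1) y).
  by apply: tX => y; rewrite lcompE vd linear0.
have [z zP] : exists z : {linear 'rV[B]_(r j.+2) -> 'rV[B]_n}, forall y, lcomp a v y = z (transp o (d j.+1) y).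
  by apply: tor_van_free => y; rewrite lcompE vd linear0.
exists (lcomp t w \- lcomp b z) => y.
rewrite -[RHS]/(t (w (transp o (d j.+1) y)) - b (z (transp o (d j.+1) y))) -wP -zP lcompE -E.
by rewrite lcompE -[X in X - (X - _)]/(t (s (v y))) subKr.
Qed.

Lemma tor_van_omega j k (X : fpmod B) :
  tor_van j (fpow (Omega nB) k X) <-> tor_van (k + j) X.
Proof.
elim: k j => // k IHk j; rewrite addSn -addnS -IHk; split.
  exact: tor_van_cosyz (rses nB X k).
exact: tor_van_syz (rses nB X k).
Qed.

End TorVanishing.

Section FindimDell.
Variables (A B : nzRingType) (o : opp_pair A B) (nA : noetherian A) (nB : noetherian B).
Variables (JB : submod B^o).
Hypotheses (JB1 : ~ JB 1) (JBunit : forall x : B, ~ JB x -> exists y, y * x = 1).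
Variable M : fpmod A.

Let Om := Omega nA.
Let os := opp_sym o.
Let D := resD nB JB.

(** Projectivity of Omega^n M splits the resolution from degree n on; [k] and [lcomp s h] form a
    contracting homotopy in degree n + 1. *)
Lemma tor_van_projdim n (X : lmodType B) :
  projective (fpow Om n M) -> tor_van o (rd nA M) n X.
Proof.
move=> pn v vd.
have [h hP] := split_projective (rses nA M n) (@free_projective _ _) pn.
have pn1 : projective (fpow Om n.+1 M).
  by apply: projective_retract hP; exact: free_projective.
have [s sP] := pn1 _ _ (raug nA M n.+1) (lid _) (@aug_surj _ _).
have [_ _ re] := rses nA M n.+1.
have [k kP] : exists k : {linear 'rV[A]_(rk nA M n.+1) -> 'rV[A]_(rk nA M n.+2)},
    forall x, rd nA M n.+1 (k x) = (lid _ \- lcomp (lcomp s h) (rd nA M n)) x.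
  apply: free_lift => x.
  have /re[y yx] : raug nA M n.+1 (x - s (h (rd nA M n x))) = 0.
    by rewrite linearB sP rdE hP subrr.
  have [z zy] := @aug_surj _ _ y.
  by exists z; rewrite rdE [raug _ _ _ z]zy yx.
exists (lcomp v (transp o k)) => y; rewrite lcompE -transp_comp.
rewrite (transp_eq o (g := lid _ \- lcomp (lcomp s h) (rd nA M n))); last by move=> x; rewrite lcompE kP.
by rewrite transpB transp_id transp_comp linearB vd subr0.
Qed.

(** Vanishing of Tor says that the inclusion of the projective module Omega^(m+1) M in P_m stays
    injective after tensoring with the residue module; by Nakayama's lemma it splits. *)
Lemma projective_of_tor_van m : projective (fpow Om m.+1 M) ->
  tor_van o (rd nA M) m D -> projective (fpow Om m M).
Proof.
move=> pm tD.
have [s sP] := pm _ _ (raug nA M m.+1) (lid _) (@aug_surj _ _).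
(* An idempotent of P_(m+1) with image a copy of Omega^(m+1) M. *)
pose pi := lcomp s (raug nA M m.+1).
have piD y : transp o pi (transp o (rd nA M m) y) = transp o (rd nA M m) y.
  by rewrite -transp_comp; apply: transp_eq => x; rewrite lcompE !rdE /pi lcompE sP.
have pipi y : transp o pi (transp o pi y) = transp o pi y.
  by rewrite -transp_comp; apply: transp_eq => x; rewrite /pi !lcompE sP.
pose K := sm_im (copair (transp o (rd nA M m)) (lid _ \- transp o pi)).
(* Were [K] proper, a nonzero map [u] from its quotient to [D] would be a cycle, hence factor
   through the transpose of [rd m.+1]. But composing [u] with the transpose of [pi] does not change
   it, and [pi] kills the image of [rd m.+1]. *)
have Ktop y : K y.
  have [//|nKy] := pselect (K y).
  have [u [x ux]] : exists (u : {linear quo K -> res_mod JB}) (x : quo K), u x <> 0.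
    apply: (residue_quotient JB1 JBunit (@quo_proj_surj _ _ K)).
    by exists (quo_proj K y) => /quo_proj_eq0.
  case: ux; have [z <-] := quo_proj_surj x.
  have uK w : K w -> u (quo_proj K w) = 0.
    by move=> Kw; rewrite (_ : quo_proj K w = 0) ?linear0 //; apply/quo_proj_eq0.
  have [w wP] : exists w : {linear 'rV[B]_(rk nA M m.+2) -> D},
      forall y, lcomp u (quo_proj K) y = w (transp o (rd nA M m.+1) y).
    apply: tD => z'; apply: uK; exists (rinl B _ _ z').
    exact: copair_inl.
  have -> : u (quo_proj K z) = lcomp u (quo_proj K) (transp o pi z).
    apply/eqP; rewrite lcompE -subr_eq0 -!linearB; apply/eqP/uK.
    by exists (rinr B _ _ z); apply: copair_inr.
  rewrite wP -transp_comp transp0 ?linear0 // => z'.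
  by rewrite lcompE /pi lcompE rdE (ses0 (rses nA M m.+1)) linear0.
(* The transpose of [th] followed by [raug] will be the retraction of P_m onto Omega^(m+1) M. *)
have [th thP] : exists th : {linear 'rV[B]_(rk nA M m.+1) -> 'rV[B]_(rk nA M m)},
    forall y, transp o (rd nA M m) (th y) = transp o pi y.
  apply: free_lift => y; have [x xy] := Ktop y; exists (rprl B _ _ x).
  rewrite -xy copairE linearD piD.
  rewrite -[X in _ = _ + transp o pi X]/(rprr B _ _ x - transp o pi (rprr B _ _ x)) linearB.
  by rewrite pipi subrr addr0.
apply: (retract_projective (h := lcomp (raug nA M m.+1) (transp os th)) (rses nA M m)).
  exact: free_projective.
move=> u; have [x xu] := @aug_surj _ _ u.
have piE : pi x = transp os th (rd nA M m x).
  rewrite -(transpK o pi) -(transpK o (rd nA M m)) -transp_comp.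
  by apply: transp_eq => y; rewrite lcompE thP.
rewrite -xu lcompE -[rincl nA M m _]/(rd nA M m x) -piE.
by rewrite /pi lcompE sP.
Qed.

Lemma projdim_le_dell n k (N : fpmod B) : projdim M = Some n ->
  stable_retract (fpow (Omega nB) k D) (fpow (Omega nB) k.+1 N) -> (n <= k)%N.
Proof.
move=> /(projdim_omega nA)[pn nmin] [s [t st]]; rewrite leqNgt; apply/negP => kn.
case: n pn nmin kn => // m pn nmin; rewrite ltnS => km.
have /nmin : projective (fpow Om m M); last by rewrite ltnn.
apply: projective_of_tor_van => //.
have dx := @rd_exact _ nA M.
(* Tor_(m+1) of [D] is Tor_(m-k+1) of Omega^k D, a summand of Tor_(m-k+1) of Omega^(k+1) N, which is
   Tor_(m+2) of [N]. *)
rewrite -(subnKC km); apply/(tor_van_omega o nB dx).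
apply: (tor_van_retract dx st); apply/(tor_van_omega o nB dx).
by rewrite addSn subnKC //; apply: tor_van_projdim.
Qed.

End FindimDell.

(** * The adjunction between Sigma and Omega *)


Section TransposeFree.
Variables (A B : nzRingType) (o : opp_pair A B).

Definition tau (X : fpmod A) : {linear 'rV[B]_(p_m (pres X)) -> tr (op_l o) X} :=
  lcomp (tr_proj (op_l o) X) (dual_free (op_l o) (p_m (pres X))).

Lemma tau_surj X : surj (tau X).
Proof.
move=> y; have [f <-] := @quo_proj_surj _ _ (tr_sub (op_l o) X) y.
by have [z <-] := dual_free_surj f; exists z.
Qed.

Lemma tau_eq0 X x : tau X x = 0 <-> exists y, transp o (rel1 X) y = x.
Proof.
rewrite lcompE quo_proj_eq0; split=> [[f fx]|[y <-]].
  have [z zf] := dual_free_surj f; exists z.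
  by apply: (@dual_free_inj _ _ (op_l o)); rewrite -dual_map_free zf.
by exists (dual_free (op_l o) _ y); rewrite -dual_map_free.
Qed.

Lemma tau_rel1 X y : tau X (transp o (rel1 X) y) = 0.
Proof. by apply/tau_eq0; exists y. Qed.

Lemma tr_map_tau (X Y : fpmod A) (f : {linear X -> Y}) :
  exists (F0 : {linear cover0 X -> cover0 Y}) (F1 : {linear cover1 X -> cover1 Y}),
    [/\ forall x, aug Y (F0 x) = f (aug X x),
        forall x, rel1 Y (F1 x) = F0 (rel1 X x)
      & forall y, tr_map (op_l o) f (tau Y y) = tau X (transp o F1 y)].
Proof.
have [F0 [F1 [F0P F1P aP]]] := tr_mapP (op_l o) f.
by exists F0, F1; split=> // y; rewrite lcompE aP; congr (tr_proj _ _ _); apply: dual_map_free.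
Qed.

(** The kernel of the transposed relations is the dual of [X], so [h] amounts to [k] functionals on
    [X]. *)
Lemma annihilator_factor (X : fpmod A) k (h : {linear 'rV[B]_k -> 'rV[B]_(p_n (pres X))}) :
  (forall y, transp o (rel1 X) (h y) = 0) ->
  exists w : {linear X -> 'rV[A]_k}, forall x, w (aug X x) = transp (opp_sym o) h x.
Proof.
move=> h0; apply: surj_factor => [|x /aug_exact[z <-]]; first exact: aug_surj.
by rewrite -(transpK o (rel1 X)) -transp_comp; apply: transp0 => y; rewrite lcompE h0.
Qed.

End TransposeFree.

Lemma stable_free2 (A : nzRingType) (X Y : fpmod A) (f g : {linear X -> Y}) m n
    (a : {linear X -> 'rV[A]_m}) (b : {linear 'rV[A]_m -> Y})
    (c : {linear X -> 'rV[A]_n}) (e : {linear 'rV[A]_n -> Y}) :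
  (forall x, f x - g x = b (a x) + e (c x)) -> stable_eq f g.
Proof.
move=> fg; apply: (@stable_trans _ _ _ (f \- lcomp b a)).
  by apply: (stable_free (a := a) (b := b)) => x; rewrite /= subKr.
apply: (stable_free (a := c) (b := e)) => x.
by rewrite -[LHS]/(f x - b (a x) - g x) addrAC fg addrAC subrr add0r.
Qed.

Section Unit.
Variables (A B : nzRingType) (o : opp_pair A B) (nA : noetherian A) (nB : noetherian B).

Let os := opp_sym o.

Section Data.
Variable X : fpmod A.

Definition sgW : fpmod B := tr (op_l o) X.
Definition sgU : fpmod B := syz nB sgW.
Definition sgS : fpmod A := tr (op_l os) sgU.

Definition sg_d : {linear cover0 sgU -> cover0 sgW} := lcomp (syz_incl nB sgW) (aug sgU).

Lemma sg_d_exact x : aug sgW x = 0 <-> exists y, sg_d y = x.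
Proof.
have [_ _ e] : ses (syz_incl nB sgW) (aug sgW) by exact: ses_ker (@aug_surj _ _).
rewrite e; split=> [[u <-]|[y <-]]; last by exists (aug sgU y).
by have [y <-] := @aug_surj _ sgU u; exists y.
Qed.

Lemma sg_d_eq0 x : sg_d x = 0 -> aug sgU x = 0.
Proof.
move=> x0; apply: (@sm_incl_inj _ _ (sm_ker (aug sgW))); rewrite linear0.
exact: x0.
Qed.

Lemma sg_d_rel1 x : sg_d (rel1 sgU x) = 0.
Proof. by rewrite lcompE aug_rel1 linear0. Qed.

(* The dual P_0^* -> P_1^* of the presentation of X also begins a resolution of
   Tr X; chain maps compare it with the chosen one, in both directions. *)
Record comparison := Comparison {
  cmp1 : {linear cover0 sgW -> 'rV[B]_(p_m (pres X))};
  cmp0 : {linear cover0 sgU -> 'rV[B]_(p_n (pres X))};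
  cmp1P : forall x, tau o X (cmp1 x) = aug sgW x;
  cmp0P : forall x, transp o (rel1 X) (cmp0 x) = cmp1 (sg_d x) }.

Record back_comparison := BackComparison {
  bcmp1 : {linear 'rV[B]_(p_m (pres X)) -> cover0 sgW};
  bcmp0 : {linear 'rV[B]_(p_n (pres X)) -> cover0 sgU};
  bcmp1P : forall x, aug sgW (bcmp1 x) = tau o X x;
  bcmp0P : forall x, sg_d (bcmp0 x) = bcmp1 (transp o (rel1 X) x) }.

Lemma comparison_ex : inhabited comparison.
Proof.
have [c1 c1P] := free_projective (aug sgW) (@tau_surj _ _ o X).
have [c0 c0P] : exists c0 : {linear cover0 sgU -> 'rV[B]_(p_n (pres X))},
    forall x, transp o (rel1 X) (c0 x) = lcomp c1 sg_d x.
  apply: free_lift => x; apply/tau_eq0; rewrite c1P.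
  by apply/sg_d_exact; exists x.
by split; exists c1 c0.
Qed.

Lemma back_comparison_ex : inhabited back_comparison.
Proof.
have [c1 c1P] := free_projective (tau o X) (@aug_surj _ sgW).
have [c0 c0P] : exists c0 : {linear 'rV[B]_(p_n (pres X)) -> cover0 sgU},
    forall x, sg_d (c0 x) = lcomp c1 (transp o (rel1 X)) x.
  by apply: free_lift => x; apply/sg_d_exact; rewrite lcompE c1P tau_rel1.
by split; exists c1 c0.
Qed.

Variable c : comparison.

(** With U = Omega Tr X, this is the transpose of cover1 U -> cover0 U -> P_0^*; it kills the
    relations of [X] and so induces the map from [X] to a free module on which the unit is built. *)
Definition sg_i : {linear 'rV[A]_(p_n (pres X)) -> 'rV[A]_(p_m (pres sgU))} :=
  transp os (lcomp (cmp0 c) (rel1 sgU)).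

Lemma sg_iE x : sg_i x = transp os (rel1 sgU) (transp os (cmp0 c) x).
Proof. exact: transp_comp. Qed.

Lemma sg_i_factor : exists j : {linear X -> 'rV[A]_(p_m (pres sgU))},
  forall x, j (aug X x) = sg_i x.
Proof.
by apply: annihilator_factor => y; rewrite lcompE cmp0P sg_d_rel1 linear0.
Qed.

(** [L] carries the map of [sg_i_factor] into the chosen cover of Sigma X; the result lies in the
    syzygy since [sg_i] takes values in relations of Sigma X. *)
Definition sg_unit (L : {linear 'rV[A]_(p_m (pres sgU)) -> cover0 sgS})
    (al : {linear X -> syz nA sgS}) :=
  (forall z, aug sgS (L z) = tau os sgU z) /\
  (forall x, syz_incl nA sgS (al (aug X x)) = L (sg_i x)).

Lemma sg_unit_ex : exists L al, sg_unit L al.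
Proof.
have [L LP] := free_projective (tau os sgU) (@aug_surj _ sgS).
have [j jP] := sg_i_factor.
have [ai _ e] : ses (syz_incl nA sgS) (aug sgS) by exact: ses_ker (@aug_surj _ _).
have [al alP] : exists al : {linear X -> syz nA sgS}, forall x, syz_incl nA sgS (al x) = lcomp L j x.
  apply: inj_factor => // x; apply/e; have [w <-] := @aug_surj _ X x.
  by rewrite lcompE LP jP sg_iE tau_rel1.
by exists L, al; split=> // x; rewrite alP lcompE jP.
Qed.

Variables (L : {linear 'rV[A]_(p_m (pres sgU)) -> cover0 sgS}) (al : {linear X -> syz nA sgS}).
Hypothesis alP : sg_unit L al.

Section Extend.
Variable b : back_comparison.

(* A map from X to a free module extends along [sg_i] up to stable equivalence. *)
Lemma sg_extend k (l : {linear X -> 'rV[A]_k}) :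
  exists K : {linear 'rV[A]_(p_m (pres sgU)) -> 'rV[A]_k},
    (forall z, K (transp os (rel1 sgU) z) = l (aug X (transp os (bcmp0 b) z))) /\
    (forall x, K (sg_i x) = l (aug X (transp os (lcomp (cmp0 c) (bcmp0 b)) x))).
Proof.
pose ll := lcomp l (aug X).
have [k0 k0P] : exists k0 : {linear 'rV[B]_k -> cover1 sgU},
    forall y, rel1 sgU (k0 y) = lcomp (bcmp0 b) (transp o ll) y.
  apply: free_lift => y; apply/aug_exact/sg_d_eq0; rewrite [X in sg_d X]lcompE bcmp0P -transp_comp.
  rewrite (transp0 o) ?linear0 // => x.
  by rewrite !lcompE aug_rel1 linear0.
have KP z : transp os k0 (transp os (rel1 sgU) z) = ll (transp os (bcmp0 b) z).
  by rewrite -transp_comp (transp_eq os (f := lcomp (rel1 sgU) k0) k0P) transp_comp transpK.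
exists (transp os k0); split=> // x.
by rewrite sg_iE KP -transp_comp.
Qed.

(** Up to the homotopy [s], the composite of the two comparisons differs from the identity by a map
    into the dual of [X], which gives [w]. *)
Lemma sg_roundtrip : exists w : {linear X -> 'rV[A]_(p_n (pres X))},
  forall x, aug X (transp os (lcomp (cmp0 c) (bcmp0 b)) x) = aug X x + aug X (w (aug X x)).
Proof.
have [s sP] : exists s : {linear 'rV[B]_(p_m (pres X)) -> 'rV[B]_(p_n (pres X))},
    forall x, transp o (rel1 X) (s x) = (lcomp (cmp1 c) (bcmp1 b) \- lid _) x.
  apply: free_lift => x; apply/tau_eq0.
  by rewrite -[X in tau o _ X]/(cmp1 c (bcmp1 b x) - x) linearB cmp1P bcmp1P subrr.
pose om : {linear 'rV[B]_(p_n (pres X)) -> 'rV[B]_(p_n (pres X))} :=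
  (lcomp (cmp0 c) (bcmp0 b) \- lid _) \- lcomp s (transp o (rel1 X)).
have [w wP] : exists w : {linear X -> 'rV[A]_(p_n (pres X))}, forall x, w (aug X x) = transp os om x.
  apply: annihilator_factor => y.
  rewrite -[X in transp o _ X]/(cmp0 c (bcmp0 b y) - y - s (transp o (rel1 X) y)) !linearB sP.
  rewrite cmp0P bcmp0P -[X in _ - X]/(cmp1 c (bcmp1 b (transp o (rel1 X) y)) - transp o (rel1 X) y).
  exact: subrr.
exists w => x; rewrite wP /om 2!transpB transp_id transp_comp transpK (linearB (aug X)) (linearB (aug X)).
by rewrite [aug X (rel1 X _)]aug_rel1 subr0 addrC subrK.
Qed.

Lemma sg_back_roundtrip : exists (s : {linear cover0 sgW -> cover0 sgU})
    (k : {linear cover0 sgU -> cover1 sgU}),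
  forall x, bcmp0 b (cmp0 c x) = x + s (sg_d x) + rel1 sgU (k x).
Proof.
have [s sP] : exists s : {linear cover0 sgW -> cover0 sgU},
    forall x, sg_d (s x) = (lcomp (bcmp1 b) (cmp1 c) \- lid _) x.
  apply: free_lift => x; apply/sg_d_exact.
  by rewrite -[X in aug _ X]/(bcmp1 b (cmp1 c x) - x) linearB bcmp1P cmp1P subrr.
have [k kP] : exists k : {linear cover0 sgU -> cover1 sgU},
    forall x, rel1 sgU (k x) = ((lcomp (bcmp0 b) (cmp0 c) \- lid _) \- lcomp s sg_d) x.
  apply: free_lift => x; apply/aug_exact/sg_d_eq0.
  rewrite -[X in sg_d X]/(bcmp0 b (cmp0 c x) - x - s (sg_d x)) !linearB sP bcmp0P cmp0P.
  rewrite -[X in _ - X]/(bcmp1 b (cmp1 c (sg_d x)) - sg_d x).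
  exact: subrr.
exists s, k => x; rewrite kP -[X in _ + _ + X]/(bcmp0 b (cmp0 c x) - x - s (sg_d x)).
by rewrite -[X in _ + X]addrA -opprD [RHS]addrC subrK.
Qed.

End Extend.

(** Extend [g], followed into the cover of [Y], along [sg_i] to [K]; then [lcomp (aug Y) K] kills
    the relations of Sigma X and defines [f]. *)
Lemma sg_unit_surj (Y : fpmod A) (g : {linear X -> syz nA Y}) :
  exists f : {linear sgS -> Y}, stable_eq (lcomp (syz_map nA f) al) g.
Proof.
have [b] := back_comparison_ex; have [LP alE] := alP.
have [ii _ ie] : ses (syz_incl nA Y) (aug Y) by exact: ses_ker (@aug_surj _ _).
have [K [K1 K2]] := @sg_extend b (p_n (pres Y)) (lcomp (syz_incl nA Y) g).
have [f fP] : exists f : {linear sgS -> Y}, forall z, f (tau os sgU z) = lcomp (aug Y) K z.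
  apply: surj_factor => [|z /tau_eq0[y <-]]; first exact: tau_surj.
  by rewrite lcompE K1; exact: syz_inclP.
exists f; have [Phi [Phi1 Phi2]] := syz_mapP nA f.
have [be beP] : exists be : {linear 'rV[A]_(p_m (pres sgU)) -> syz nA Y},
    forall z, syz_incl nA Y (be z) = (lcomp Phi L \- K) z.
  apply: inj_factor => // z; apply/ie.
  by rewrite -[X in aug _ X]/(Phi (L z) - K z) linearB Phi1 LP fP subrr.
have [w wP] := sg_roundtrip b; have [j jP] := sg_i_factor.
(* The error through [j] compares [lcomp Phi L] with [K]; the one through [w] comes from
   [sg_roundtrip]. *)
apply: (stable_free2 (a := j) (b := be) (c := w) (e := lcomp g (aug X))) => u.
have [x <-] := @aug_surj _ X u; apply: ii.
rewrite linearB linearD beP lcompE Phi2 alE jP.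
have KE : K (sg_i x) = syz_incl nA Y (g (aug X x)) + syz_incl nA Y (g (aug X (w (aug X x)))).
  by rewrite K2 wP linearD.
rewrite -[X in _ = X + _]/(Phi (L (sg_i x)) - K (sg_i x)) KE.
by rewrite opprD addrA subrK.
Qed.

(** The difference of [f] and [f'] is induced by [F]. Subtracting from [F] a map [be] into the
    syzygy of [Y] that agrees with it on the relations of Sigma X yields [v], which lifts this
    difference to the cover of [Y]. *)
Lemma sg_unit_inj (Y : fpmod A) (f f' : {linear sgS -> Y}) :
  stable_eq (lcomp (syz_map nA f) al) (lcomp (syz_map nA f') al) -> stable_eq f f'.
Proof.
move=> /stable_eq_free[n [l [e E]]].
have [b] := back_comparison_ex; have [LP alE] := alP.
have [ii _ ie] : ses (syz_incl nA Y) (aug Y) by exact: ses_ker (@aug_surj _ _).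
have [Phi [Phi1 Phi2]] := syz_mapP nA f; have [Phi' [Phi1' Phi2']] := syz_mapP nA f'.
pose F := lcomp (Phi \- Phi') L.
have FE z : F z = Phi (L z) - Phi' (L z) by [].
have augF z : aug Y (F z) = f (tau os sgU z) - f' (tau os sgU z).
  by rewrite FE linearB Phi1 Phi1' LP.
have Fi x : F (sg_i x) = syz_incl nA Y (e (l (aug X x))).
  by rewrite -E linearB !lcompE Phi2 Phi2' alE.
have [ga gaP] : exists ga : {linear 'rV[A]_(p_n (pres sgU)) -> syz nA Y},
    forall z, syz_incl nA Y (ga z) = lcomp F (transp os (rel1 sgU)) z.
  by apply: inj_factor => // z; apply/ie;
    rewrite -[X in aug _ X]/(F (transp os (rel1 sgU) z)) augF tau_rel1 (linear0 f) (linear0 f') subrr.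
have [K [K1 K2]] := @sg_extend b n l.
have [s [k skP]] := sg_back_roundtrip b.
(* The second term cancels the homotopy [k] of [sg_back_roundtrip]. *)
pose be := lcomp e K \- lcomp ga (transp os k).
have beP z : be (transp os (rel1 sgU) z) = ga z.
  have zE : transp os (cmp0 c) (transp os (bcmp0 b) z) =
      z + transp os sg_d (transp os s z) + transp os k (transp os (rel1 sgU) z).
    apply: (pairing_nondeg_r (o := os)) => x.
    by rewrite -!pairing_transp skP !pairingDl !pairingDr -!pairing_transp.
  have gad y : ga (transp os sg_d y) = 0.
    apply: ii; rewrite gaP lcompE -transp_comp transp0 ?linear0 // => x.
    by rewrite [LHS]lcompE sg_d_rel1.
  have gac y : ga (transp os (cmp0 c) y) = e (l (aug X y)).
    by apply: ii; rewrite gaP lcompE -sg_iE Fi.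
  have := gac (transp os (bcmp0 b) z); rewrite zE !linearD gad addr0 -K1.
  move=> ez; rewrite -[LHS]/(e (K (transp os (rel1 sgU) z)) - ga (transp os k (transp os (rel1 sgU) z))).
  by rewrite -ez addrK.
have [v vP] : exists v : {linear sgS -> cover0 Y},
    forall z, v (tau os sgU z) = (F \- lcomp (syz_incl nA Y) be) z.
  apply: surj_factor => [|z /tau_eq0[y <-]]; first exact: tau_surj.
  rewrite -[LHS]/(F (transp os (rel1 sgU) y) - syz_incl nA Y (be (transp os (rel1 sgU) y))).
  by rewrite beP gaP lcompE subrr.
apply: (@stable_free _ _ _ _ _ (p_n (pres Y)) v (aug Y)) => x.
have [z <-] := @tau_surj _ _ os sgU x.
rewrite vP -[X in aug Y X]/(F z - syz_incl nA Y (be z)) linearB augF.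
by rewrite (syz_inclP (be z)) subr0.
Qed.

End Data.

(** Both sides come from chain maps, from the resolution of Tr X to that of Tr X', which lift the
    same map and hence are homotopic. *)
Lemma sg_unit_nat (X' X : fpmod A) (c' : comparison X') (c : comparison X) L' al' L al
    (h : {linear X' -> X}) : sg_unit c' L' al' -> sg_unit c L al ->
  stable_eq (lcomp (syz_map nA (tr_map (op_l os) (syz_map nB (tr_map (op_l o) h)))) al')
            (lcomp al h).
Proof.
move=> [LP' alE'] [LP alE].
have [F0 [F1 [F0P F1P]]] := tr_map_tau o h; set k := tr_map _ h => kP.
have [G [GP]] := syz_mapP nB k; set a := syz_map _ k => aP.
have [H0 [H1 [H0P H1P]]] := tr_map_tau os a; set b := tr_map _ a => bP.
have [Phi [PhiP]] := syz_mapP nA b; set sb := syz_map _ b => sbP.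
have [ii _ ie] : ses (syz_incl nA (sgS X)) (aug (sgS X)) by exact: ses_ker (@aug_surj _ _).
have dG x : sg_d X' (H0 x) = G (sg_d X x) by rewrite lcompE H0P aP.
have [s sP] : exists s : {linear cover0 (sgW X) -> 'rV[B]_(p_n (pres X'))},
    forall x, transp o (rel1 X') (s x) = (lcomp (cmp1 c') G \- lcomp (transp o F1) (cmp1 c)) x.
  apply: free_lift => x; apply/tau_eq0.
  by rewrite -[X in tau _ _ X]/(cmp1 c' (G x) - transp o F1 (cmp1 c x)) linearB cmp1P GP -kP cmp1P subrr.
pose de : {linear cover0 (sgU X) -> 'rV[B]_(p_n (pres X'))} :=
  lcomp (cmp0 c') H0 \- lcomp (transp o F0) (cmp0 c).
(* Without the homotopy, the difference [de] takes values in the dual of [X'] and gives [rb]. *)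
pose r := de \- lcomp s (sg_d X).
have F01 y : transp o (rel1 X') (transp o F0 y) = transp o F1 (transp o (rel1 X) y).
  by rewrite -!transp_comp; apply: transp_eq => x; rewrite !lcompE F1P.
have [rb rbP] : exists rb : {linear X' -> 'rV[A]_(p_n (pres (sgU X)))},
    forall x, rb (aug X' x) = transp os r x.
  apply: annihilator_factor => y.
  rewrite -[X in transp o _ X]/((cmp0 c' (H0 y) - transp o F0 (cmp0 c y)) - s (sg_d X y)).
  rewrite (linearB (transp o (rel1 X'))) (linearB (transp o (rel1 X'))) sP F01 !cmp0P dG.
  rewrite -[X in _ - X]/(cmp1 c' (G (sg_d X y)) - transp o F1 (cmp1 c (sg_d X y))).
  exact: subrr.
have [mu muP] : exists mu : {linear 'rV[A]_(p_n (pres (sgU X))) -> syz nA (sgS X)},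
    forall z, syz_incl nA (sgS X) (mu z) = lcomp L (transp os (rel1 (sgU X))) z.
  by apply: inj_factor => // z; apply/ie; rewrite lcompE LP tau_rel1.
have [be beP] : exists be : {linear 'rV[A]_(p_m (pres (sgU X'))) -> syz nA (sgS X)},
    forall z, syz_incl nA (sgS X) (be z) = (lcomp Phi L' \- lcomp L (transp os H1)) z.
  apply: inj_factor => // z; apply/ie.
  by rewrite -[X in aug _ X]/(Phi (L' z) - L (transp os H1 z)) linearB PhiP LP' LP bP subrr.
have [j jP] := sg_i_factor c'.
apply: (stable_free2 (a := j) (b := be) (c := rb) (e := mu)) => u.
have [x <-] := @aug_surj _ X' u; apply: ii.
rewrite linearB linearD beP muP 2!lcompE sbP alE' -F0P alE jP rbP.
rewrite -[X in _ = X + _]/(Phi (L' (sg_i c' x)) - L (transp os H1 (sg_i c' x))).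
have HE : transp os H1 (sg_i c' x) = transp os (rel1 (sgU X)) (transp os H0 (transp os (cmp0 c') x)).
  by rewrite sg_iE -!transp_comp; apply: transp_eq => y; rewrite !lcompE H1P.
have rE : transp os r x = transp os H0 (transp os (cmp0 c') x) - transp os (cmp0 c) (F0 x)
    - transp os (sg_d X) (transp os s x).
  by rewrite /r /de 2!transpB 3!transp_comp transpK.
have d0 y : transp os (rel1 (sgU X)) (transp os (sg_d X) y) = 0.
  by rewrite -transp_comp transp0 // => z; rewrite [LHS]lcompE sg_d_rel1.
rewrite HE rE (linearB (transp os (rel1 (sgU X)))) (linearB (transp os (rel1 (sgU X)))) d0 subr0.
by rewrite -(sg_iE c) linearB addrA subrK.
Qed.

Lemma omega_sigma_adjunction : inhabited (adjunction (Sigma (op_l o) (op_r o) nB) (Omega nA)).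
Proof.
have al_ex (X : fpmod A) : exists al : {linear X -> syz nA (sgS X)},
    exists c L, sg_unit (X := X) c L al.
  have [c] := comparison_ex X; have [L [al alP]] := sg_unit_ex c.
  by exists al, c, L.
pose al X := projT1 (cid (al_ex X)).
have alP X : exists c L, sg_unit (X := X) c L (al X) := projT2 (cid (al_ex X)).
pose Sg := Sigma (op_l o) (op_r o) nB; pose Om := Omega nA.
pose ad (X Y : fpmod A) (f : {linear Sg X -> Y}) : {linear X -> Om Y} :=
  lcomp (fmor Om f) (al X).
have ad_eq (X Y : fpmod A) (f g : {linear Sg X -> Y}) : stable_eq f g <-> stable_eq (ad _ _ f) (ad _ _ g).
  have [c [L alX]] := alP X; split; last exact: (sg_unit_inj alX).
  by move=> fg; apply: stable_compr; apply: (fmor_eq Om).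
split; apply: (@Adjunction _ _ Sg Om ad) => // [X Y h|X' X Y Y' h f g].
  by have [c [L alX]] := alP X; apply: (sg_unit_surj alX).
have [[c [L alX]] [c' [L' alX']]] := (alP X, alP X').
apply: (@stable_trans _ _ _ (lcomp (lcomp (fmor Om g) (lcomp (fmor Om f) (fmor Om (fmor Sg h)))) (al X'))).
  apply: stable_compr; apply: stable_trans (fmor_comp Om _ _) _.
  by apply: stable_compl; apply: (fmor_comp Om).
rewrite -lcompA; apply: stable_compl; rewrite -!lcompA; apply: stable_compl.
exact: (sg_unit_nat h alX' alX).
Qed.

End Unit.

Section AdjunctionPowers.

Lemma adjunction_comp (A B C : nzRingType) (F : sfunctor A B) (G : sfunctor B A)
    (F' : sfunctor B C) (G' : sfunctor C B) :
  adjunction F G -> adjunction F' G' -> adjunction (fcomp F' F) (fcomp G G').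
Proof.
move=> a a'.
apply: (@Adjunction _ _ (fcomp F' F) (fcomp G G') (fun X Y f => adj a (adj a' f))).
- by move=> X Y f g; apply: iff_trans (adj_eq a' f g) (adj_eq a _ _).
- move=> X Y h; have [f fh] := adj_surj a h; have [g gf] := adj_surj a' f.
  by exists g; apply: stable_trans fh; apply/adj_eq.
- move=> X' X Y Y' h f g; apply: stable_trans (adj_nat a _ _ _).
  exact/adj_eq/(adj_nat a').
Qed.

Lemma adjunction_iso (A B : nzRingType) (F : sfunctor A B) (G G' : sfunctor B A)
    (i : forall Y, {linear G Y -> G' Y}) (j : forall Y, {linear G' Y -> G Y}) :
  (forall Y, stable_inv (i Y) (j Y)) ->
  (forall (Y Y' : fpmod B) (f : {linear Y -> Y'}),
     stable_eq (lcomp (fmor G' f) (i Y)) (lcomp (i Y') (fmor G f))) ->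
  adjunction F G -> adjunction F G'.
Proof.
move=> ij inat a.
have K (X : fpmod A) (Y : fpmod B) (f : {linear X -> G Y}) :
    stable_eq (lcomp (j Y) (lcomp (i Y) f)) f.
  by rewrite lcompA -{2}(lcomp1l f); apply: stable_compr; case: (ij Y).
apply: (@Adjunction _ _ F G' (fun X Y f => lcomp (i Y) (adj a f))).
- move=> X Y f g; rewrite (adj_eq a); split=> [|E]; first exact: stable_compl.
  apply: stable_trans (stable_sym (K _ _ _)) (stable_trans _ (K _ _ _)).
  exact: stable_compl.
- move=> X Y h; have [f fh] := adj_surj a (lcomp (j Y) h); exists f.
  apply: stable_trans (stable_compl _ fh) _.
  by rewrite lcompA -{2}(lcomp1l h); apply: stable_compr; case: (ij Y).
- move=> X' X Y Y' h f g; apply: stable_trans (stable_compl _ (adj_nat a h f g)) _.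
  rewrite -!lcompA lcompA [X in stable_eq _ X]lcompA; apply: stable_compr.
  exact/stable_sym.
Qed.

(** Composing adjunctions yields the right adjoint G^n G, while [fpow] is G G^n; this natural
    isomorphism restores the order. *)
Lemma fpow_commute (A : nzRingType) (F : sfunctor A A) n :
  exists (i : forall X, {linear fpow F n (F X) -> F (fpow F n X)})
         (j : forall X, {linear F (fpow F n X) -> fpow F n (F X)}),
    (forall X, stable_inv (i X) (j X)) /\
    (forall (X Y : fpmod A) (f : {linear X -> Y}),
      stable_eq (lcomp (fmor F (fmor (fpow F n) f)) (i X))
                (lcomp (i Y) (fmor (fpow F n) (fmor F f)))).
Proof.
elim: n => [|n [i [j [ij inat]]]].
  exists (fun X => lid _), (fun X => lid _); split=> [X|X Y f].
    by split; rewrite lcomp1r; apply: stable_refl.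
  by rewrite lcomp1r lcomp1l; apply: stable_refl.
exists (fun X => fmor F (i X)), (fun X => fmor F (j X)); split=> [X|X Y f].
  exact: (fmor_inv F (ij X)).
apply: stable_trans (stable_sym (fmor_comp F _ _)) _.
apply: (@stable_trans _ _ _ (fmor F (lcomp (i Y) (fmor (fpow F n) (fmor F f))))).
  exact: (fmor_eq F (inat X Y f)).
exact: (fmor_comp F).
Qed.

Lemma adjunction_pow (A : nzRingType) (F G : sfunctor A A) n :
  adjunction F G -> inhabited (adjunction (fpow F n) (fpow G n)).
Proof.
move=> a; elim: n => [|n [an]].
  split; apply: (@Adjunction _ _ (fid A) (fid A) (fun X Y f => f)) => // [X Y h|X' X Y Y' h f g].
    by exists h; apply: stable_refl.
  exact: stable_refl.
have [i [j [ij inat]]] := fpow_commute G n.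
split; apply: (@adjunction_iso _ _ _ (fcomp (fpow G n) G) (fpow G n.+1) i j ij inat).
exact: adjunction_comp an a.
Qed.

End AdjunctionPowers.

(** * Local rings *)


Section MaximalIdeal.
Variables (R : nzRingType) (I : submod R^o).
Hypothesis I1 : ~ I 1.

(** Zorn's lemma on the left ideals that contain [I] and avoid 1. *)
Lemma maximal_left_ideal_ex : exists2 K, maximal_left_ideal K & forall x, I x -> K x.
Proof.
pose T := {K : submod R^o | (forall x, I x -> K x) /\ ~ K 1}.
pose le (K L : T) := `[< forall x, sval K x -> sval L x >].
have t0 : T by exists I.
have [|K L M /asboolP KL /asboolP LM|C Ctot|[K [IK K1]] Kmax] := @ZL_preorder T t0 le.
- by move=> K; apply/asboolP.
- by apply/asboolP => x /KL /LM.
- have [[K0 CK0]|C0] := pselect (exists K, C K); last first.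
    by exists t0 => K CK; case: C0; exists K.
  pose U x := exists2 K : T, C K & sval K x.
  have UD x y : U x -> U y -> U (x + y).
    move=> [K CK Kx] [L CL Ly]; have [/asboolP KL|/asboolP LK] := Ctot _ _ CK CL.
      by exists L => //; apply: smD => //; apply: KL.
    by exists K => //; apply: smD => //; apply: LK.
  have UZ (a : R) (x : R^o) : U x -> U (a *: x).
    by move=> [K CK Kx]; exists K => //; apply: smZ.
  have U0 : U 0 by exists K0 => //; apply: sm0.
  pose US : submod R^o := Submod (sm_set := U : R^o -> Prop) U0 UD UZ.
  have USP : (forall x, I x -> US x) /\ ~ US 1.
    split=> [x Ix|[K CK]]; last by case: (svalP K).
    by exists K0 => //; case: (svalP K0) => + _; apply.
  by exists (exist _ US USP) => K CK; apply/asboolP => x Kx; exists K.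
exists K => //; split=> // L KL L1 x Lx.
have LP : (forall x, I x -> L x) /\ ~ L 1 by split=> // y /IK /KL.
have /asboolP H : le (exist _ L LP) (exist _ K (conj IK K1)) by apply: Kmax; apply/asboolP.
exact: H.
Qed.

End MaximalIdeal.

Section LocalUnits.
Variable R : nzRingType.

(** Otherwise R (1 + j) lies in a maximal left ideal, which contains [j] and hence 1. *)
Lemma jrad_one_add (j : R) : jrad j -> exists u, u * (1 + j) = 1.
Proof.
move=> jj; apply: contrapT => nu.
pose I := sm_im (orbit_map (V := R^o) (1 + j)).
have [K [K1 Kmax] IK] : exists2 K, maximal_left_ideal K & forall x, I x -> K x.
  by apply: maximal_left_ideal_ex => -[u u1]; apply: nu; exists u.
apply: (K1); rewrite -(addrK j 1); apply: (smB (S := K)).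
  by apply: IK; exists 1; exact: mul1r.
exact: (jj K (conj K1 Kmax)).
Qed.

(** The left inverse [u] equals 1 - u j, so it has a left inverse itself, which must be 1 + j. *)
Lemma jrad_one_add_unit (j : R) : jrad j ->
  exists u, u * (1 + j) = 1 /\ (1 + j) * u = 1.
Proof.
move=> jj; have [u u1] := jrad_one_add jj.
have [v v1] : exists v, v * (1 + - (u * j)) = 1.
  apply: jrad_one_add; apply: (smN (S := jrad_left R)).
  exact: (smZ (s := jrad_left R) u jj).
have uE : 1 - u * j = u by rewrite -{1}u1 mulrDr mulr1 addrK.
exists u; split=> //; rewrite uE in v1.
by rewrite -[1 + j]mul1r -{1}v1 -(mulrA v) u1 mulr1.
Qed.

Hypothesis hloc : is_local R.

Lemma jrad_left_unit (x : R) : ~ jrad_left R x -> exists y, y * x = 1.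
Proof.
move=> /hloc.2[y [_ yx]]; have [u [u1 _]] := jrad_one_add_unit yx.
have E : y * x = 1 + (y * x - 1) by rewrite addrC subrK.
by exists (u * y); rewrite -mulrA E.
Qed.

(** Products in [R^c] are reversed, so a right inverse in [R] is needed. *)
Lemma jrad_right_unit (x : R^c) : ~ jrad_right R x -> exists y : R^c, y * x = 1.
Proof.
move=> /hloc.2[y [xy _]]; have [u [_ u1]] := jrad_one_add_unit xy.
exists ((y : R) * u : R); rewrite -[LHS]/((x : R) * (y * u) : R).
have E : (x : R) * y = 1 + ((x : R) * y - 1) by rewrite addrC subrK.
by rewrite mulrA E.
Qed.

Definition converse_pair : opp_pair R^c R :=
  @OppPair R^c R (c_opposite R) (opposite_c R) (fun _ => erefl) (fun _ => erefl).

End LocalUnits.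

Section LocalPair.
Variables (A B : nzRingType) (o : opp_pair A B) (nA : noetherian A) (nB : noetherian B).
Variables (JA : submod A^o) (JB : submod B^o).
Hypotheses (JA1 : ~ JA 1) (JAunit : forall x : A, ~ JA x -> exists y, y * x = 1).
Hypotheses (JB1 : ~ JB 1) (JBunit : forall x : B, ~ JB x -> exists y, y * x = 1).

Let DA := resD nA JA.
Let DB := resD nB JB.
Let os := opp_sym o.

Hypothesis flA : forall i, finite_length (Ext (op_l o) nA i DA).

Lemma depth_some d : depth (op_l o) nA DA = Some d <->
  ~ ext_vanish_at o nA DA d /\ forall i, (i < d)%N -> ext_vanish_at o nA DA i.
Proof.
rewrite einf_some ext_vanish_atP; split=> -[H H']; split.
- by move=> nH; apply: nH.
- by move=> i id; apply/ext_vanish_atP => /H'; rewrite leqNgt id.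
- exact: contrapT.
- move=> m xm; rewrite leqNgt; apply/negP => /H' /ext_vanish_atP; exact.
Qed.

Lemma depth_none : depth (op_l o) nA DA = None -> forall i, ext_vanish_at o nA DA i.
Proof. by move/einf_none => H i; apply/ext_vanish_atP/H. Qed.

(** The module is X_d; the first differential is not surjective because the residue module is
    nonzero. *)
Lemma findim_lower d : (forall i, (i < d)%N -> ext_vanish_at o nA DA i) ->
  exists M : fpmod B, projdim M = Some d.
Proof.
move=> van; exists (FpMod (fg_fp nB (@xproj_surj _ _ o _ (rd nA DA) d))).
apply: (xmod_projdim (@rd_exact _ nA DA) van) => d0s.
have [x x0] := resD_neq0 nA JA1; have [w wx] := @aug_surj _ DA x.
by apply: x0; rewrite -wx; apply/raug_exact/d0s.
Qed.

(** A retract as in [dell] bounds all finite projective dimensions over [B], and X_d attains the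
    bound. *)
Lemma depth_le_findim_dell :
  (forall n, depth (op_l o) nA DA = Some n -> exists N,
     stable_retract (fpow (Omega nA) n DA) (fpow (Omega nA) n.+1 N)) ->
  findim B = depth (op_l o) nA DA /\ dell nA DA = depth (op_l o) nA DA.
Proof.
move=> retr.
have dellP k N d (M : fpmod B) : projdim M = Some d ->
    stable_retract (fpow (Omega nA) k DA) (fpow (Omega nA) k.+1 N) -> (d <= k)%N.
  exact: (projdim_le_dell os nB JA1 JAunit).
(* In infinite depth every X_i has projective dimension [i], which excludes both a bound and a
   retract. *)
case E : (depth _ _ _) => [d|]; last first.
  have van := depth_none E; split; apply/einf_none.
    move=> b H; have [M Mb] := @findim_lower b.+1 (fun i _ => van i).
    by have := H b.+1 (ex_intro _ M Mb); rewrite ltnn.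
  move=> k [N /dellP H]; have [M Mk] := @findim_lower k.+1 (fun i _ => van i).
  by have := H _ _ Mk; rewrite ltnn.
have [_ van] := (depth_some d).1 E; have [M Md] := findim_lower van.
have [N dN] := retr d E; split; apply/einf_some; split.
- by move=> n [M' Mn]; apply: dellP Mn dN.
- by move=> b; apply; exists M.
- by exists N.
- by move=> k [N' kN]; apply: dellP Md kN.
Qed.

Lemma depth_swap_le d : depth (op_l o) nA DA = Some d ->
  exists2 i, (i <= d)%N & depth (op_l os) nB DB = Some i.
Proof.
move=> /depth_some[nvan van].
have [i id nv] := depth_exchange nB JB1 JBunit (flA d) van nvan.
case E : (depth _ _ _) => [j|].
  exists j => //; apply: leq_trans id; move/einf_some: E => [_]; apply.
  by apply: contrapT => /(ext_vanish_atP os).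
by case: nv; apply/(ext_vanish_atP os); move/einf_none: E => H /H.
Qed.

End LocalPair.

Section LocalPairs.
Variables (A B : nzRingType) (o : opp_pair A B) (nA : noetherian A) (nB : noetherian B).
Variables (JA : submod A^o) (JB : submod B^o).
Hypotheses (JA1 : ~ JA 1) (JAunit : forall x : A, ~ JA x -> exists y, y * x = 1).
Hypotheses (JB1 : ~ JB 1) (JBunit : forall x : B, ~ JB x -> exists y, y * x = 1).

Let DA := resD nA JA.
Let DB := resD nB JB.
Let os := opp_sym o.

Hypothesis flA : forall i, finite_length (Ext (op_l o) nA i DA).
Hypothesis flB : forall i, finite_length (Ext (op_l os) nB i DB).

Lemma depth_swap : depth (op_l os) nB DB = depth (op_l o) nA DA.
Proof.
have AB := depth_swap_le (o := o) (nA := nA) nB JB1 JBunit flA.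
have BA d : depth (op_l os) nB DB = Some d ->
    exists2 i, (i <= d)%N & depth (op_l o) nA DA = Some i.
  exact: (depth_swap_le (o := os) (nA := nB) nA JA1 JAunit flB).
case E : (depth (op_l o) nA DA) => [d|].
  have [i id Ei] := AB d E; have [j ji] := BA i Ei.
  by rewrite E Ei => -[dj]; congr Some; apply/eqP; rewrite eqn_leq id dj.
by case E' : (depth _ _ _) => [d|] //; have [i _] := BA d E'; rewrite E.
Qed.

Lemma cosyz_depth d : depth (op_l o) nA DA = Some d ->
  exists (S : fpmod A) (f : {linear fpow (Omega nA) d DA -> fpow (Omega nA) d.+1 S})
         (g : {linear fpow (Omega nA) d.+1 S -> fpow (Omega nA) d DA}),
    stable_inv f g /\ full_at (fpow (Omega nA) d.+1) S.
Proof.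
move=> E; have [nvan van] := (depth_some o nA JA d).1 E.
have EB := E; rewrite -depth_swap in EB.
have [_ vanB] := (depth_some os nB JB d).1 EB.
exact: (cosyz_full nA (cosyz_omega_residue JAunit JB1 JBunit van nvan (flA d) vanB)).
Qed.

Lemma findim_dell : findim B = depth (op_l o) nA DA /\ dell nA DA = depth (op_l o) nA DA.
Proof.
apply: depth_le_findim_dell => // n /cosyz_depth[S [f [g [fg _]]]].
by exists S, f, g; case: fg.
Qed.

End LocalPairs.

(* Right modules over R are left modules over R^c: the invariants of the ring
   itself are those of R^c-modules, the invariants of its opposite are those of
   R-modules. *)
Theorem theorem3p2 (R : nzRingType)
    (nL : noetherian R) (nR : noetherian R^c) (hloc : is_local R)
    (hExt : forall i : nat,
       finite_length (Ext (c_opposite R) nR i (residue_right nR)))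
    (hExt_op : forall i : nat,
       finite_length (Ext (opposite_c R) nL i (residue_left nL))) :
  let D := residue_right nR in
  let D_op := residue_left nL in
  let depth_R := depth (c_opposite R) nR D in
  let depth_Rop := depth (opposite_c R) nL D_op in
  let findim_R := findim R^c in
  let findim_Rop := findim R in
  let dell_R := dell nR D in
  let dell_Rop := dell nL D_op in
  let Om := Omega nR in
  let Sg := Sigma (c_opposite R) (opposite_c R) nL in
  (depth_Rop = depth_R /\ depth_R = findim_Rop /\ findim_Rop = findim_R /\
   findim_R = dell_Rop /\ dell_Rop = dell_R) /\
  inhabited (forall n : nat, adjunction (fpow Sg n) (fpow Om n)) /\
  (forall (a : forall n : nat, adjunction (fpow Sg n) (fpow Om n)) (d : nat),
     depth_R = Some d ->
     stable_iso (adj_unit (a d.+1) (fpow Om d D)) /\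
     (forall n : nat,
        stable_iso (adj_unit (a n.+1) (fpow Om n D)) -> (d <= n)%N)).
Proof.
move=> D D_op depth_R depth_Rop findim_R findim_Rop dell_R dell_Rop Om Sg.
pose o := converse_pair R.
have l1 : ~ jrad_left R 1 by case: hloc.
have r1 : ~ jrad_right R 1 by case: hloc.
have lu := jrad_left_unit hloc; have ru := jrad_right_unit hloc.
have dE : depth_Rop = depth_R := depth_swap (o := o) r1 ru l1 lu hExt hExt_op.
(* Depth and delooping level on one side are matched with the finitistic dimension on the other, so
   the lemma is used for both orders of the pair. *)
have [fE eE] : findim_Rop = depth_R /\ dell_R = depth_R :=
  findim_dell (o := o) r1 ru l1 lu hExt hExt_op.
have [fE' eE'] : findim_R = depth_Rop /\ dell_Rop = depth_Rop :=
  findim_dell (o := opp_sym o) l1 lu r1 ru hExt_op hExt.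
split; first by rewrite fE fE' eE eE' dE.
split.
  have [a] := omega_sigma_adjunction o nR nL.
  split=> n; exact: inhabited_witness (adjunction_pow n a).
move=> a d Ed; split.
  have [S [f [g [fg full]]]] := cosyz_depth (o := o) r1 ru l1 lu hExt hExt_op Ed.
  exact: adj_unit_iso fg full.
(* An inverse of the unit makes Omega^n D a stable retract of an (n+1)-st syzygy, so [n] is at least
   the delooping level, which is [d]. *)
move=> n [g [gf _]]; have : dell_R = Some d by rewrite eE.
move=> /einf_some[_]; apply.
by exists (fpow Sg n.+1 (fpow Om n D)), (adj_unit (a n.+1) (fpow Om n D)), g.
Qed.
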